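(* Let $n\ge2$, $p>1$, $q>2$, and let $B_1=B_1(0)\subset\mathbb{R}^n$. Suppose that $u_0\in C^2(\overline{B_1})$ is radial, $u_0\ge0$ and $u_0\not\equiv0$ in $B_1$, and $u_0=0$ on $\partial B_1$. Let $u$ be the viscosity solution of $$u_t=|Du|^{q-2}\big(\Delta u+(p-2)\Delta_\infty^N u\big)\ \text{in }B_1\times(0,\infty),\quad u(\cdot,0)=u_0\text{ in }B_1,\quad u=0\text{ on }\partial B_1\times(0,\infty).$$ Then $$\lim_{t\to\infty}t^{\frac1{q-2}}u(x,t)=V(|x|)$$ uniformly in $x\in B_1$, and $$u(x,t)\le t^{-\frac1{q-2}}V(|x|)\quad\text{for every }x\in B_1,\ t>0,$$ where $V$ is the positive bounded profile such that $x\mapsto V(|x|)$ is the unique positive viscosity solution of the stationary problem $|DV|^{q-2}(\Delta V+(p-2)\Delta_\infty^N V)+\frac1{q-2}V=0$ in $B_1$ with zero Dirichlet boundary values.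
   Context: For $\xi\in\mathbb{R}^n\setminus\{0\}$ and a symmetric $n\times n$ matrix $X$ let $F(\xi,X)=|\xi|^{q-2}\big(\operatorname{tr}X+(p-2)\frac{\langle X\xi,\xi\rangle}{|\xi|^2}\big)$; thus $|Du|^{q-2}(\Delta u+(p-2)\Delta_\infty^N u)=F(Du,D^2u)$, where $\Delta_\infty^N u=\sum_{i,j}\frac{\partial_i u}{|Du|}\frac{\partial_j u}{|Du|}\partial_{ij}u$. Stationary problem. Since $q>2$, $F$ extends continuously by $F(0,X)=0$. A continuous function $w$ is a viscosity solution of $F(Dw,D^2w)+\frac1{q-2}w=0$ if $F(D\varphi(x_0),D^2\varphi(x_0))+\frac1{q-2}w(x_0)\le0$ (respectively $\ge0$) whenever $\varphi\in C^2$ touches $w$ from below (respectively above) at $x_0$. The profile $V$ (which exists and is unique) is continuous on $[0,1]$, positive on $[0,1)$, $V(1)=0$; equivalently $t^{-1/(q-2)}V(|x|)$ is the unique positive separable radial viscosity solution of the evolution equation in $B_1\times(0,\infty)$ with zero lateral boundary values. Viscosity solutions of the evolution equation. Solutions of the initial-boundary value problem are taken continuous on $\overline{B_1}\times[0,\infty)$. Let $\mathcal F$ be the set of $f\in C^2([0,\infty))$ with $f(0)=f'(0)=f''(0)=0$, $f''(r)>0$ for all $r>0$, and such that $g(x):=f(|x|)$ satisfies $\lim_{x\to0,\,x\ne0}F(Dg(x),D^2g(x))=0$. Let $\Sigma$ be the set of even $\sigma\in C^1(\mathbb{R})$ with $\sigma(0)=\sigma'(0)=0$ and $\sigma(r)>0$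 for $r\neq0$. Let $\Theta\subset\mathbb{R}^{n+1}$ be open. A function $\varphi\in C^2(\Theta)$ is admissible if for every $(x_0,t_0)\in\Theta$ with $D\varphi(x_0,t_0)=0$ there are $\delta>0$, $f\in\mathcal F$, $\sigma\in\Sigma$ with $|\varphi(x,t)-\varphi(x_0,t_0)-\varphi_t(x_0,t_0)(t-t_0)|\le f(|x-x_0|)+\sigma(t-t_0)$ for all $(x,t)\in B_\delta(x_0)\times(t_0-\delta,t_0+\delta)$. $\varphi$ touches $u$ from below at $(x_0,t_0)\in\Theta$ if $u(x_0,t_0)=\varphi(x_0,t_0)$ and $u(x,t)>\varphi(x,t)$ for all other $(x,t)\in\Theta$; touching from above is analogous. $u:\Theta\to\mathbb{R}\cup\{\infty\}$ is a viscosity supersolution if it is lower semicontinuous, finite in a dense subset of $\Theta$, and whenever an admissible $\varphi\in C^2(\Theta)$ touches $u$ from below at $(x_0,t_0)$ one has $\varphi_t(x_0,t_0)-F(D\varphi(x_0,t_0),D^2\varphi(x_0,t_0))\ge0$ if $D\varphi(x_0,t_0)\ne0$, and $\varphi_t(x_0,t_0)\ge0$ if $D\varphi(x_0,t_0)=0$. $u$ is a viscosity subsolution if it satisfies the analogous conditions with upper semicontinuity, touching from above and reversed inequalities. A continuous function that is both is a viscosity solution. *)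

(* Defs.v *)
From HB Require Import structures.
From mathcomp Require Import all_boot all_order all_algebra.
From mathcomp Require Import all_classical all_reals all_analysis.

Set Implicit Arguments.
Unset Strict Implicit.
Unset Printing Implicit Defensive.

Import Order.TTheory GRing.Theory Num.Theory.
Import numFieldNormedType.Exports.

Local Open Scope ring_scope.
Local Open Scope classical_set_scope.

Section Smoothness.
Context {R : realType} {V : normedModType R}.
Implicit Types (O : set V) (f g : V -> R).

(* C^1 and C^2 on an open set O, through directional derivatives; V is
   finite-dimensional in every use below, where this is the usual notion.
   Values outside O are irrelevant. *)
Definition C1_on O f : Prop :=
  forall v, (forall x, O x -> derivable f x v) /\
            (forall x, O x -> {for x, continuous ('D_v f)}).

Definition C2_on O f : Prop :=
  C1_on O f /\ forall v, C1_on O ('D_v f).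

Definition extends_to_closure O g : Prop :=
  exists2 h : V -> R,
    {within closure O, continuous h} & forall x, O x -> h x = g x.

(* C^2(closure O): f is C^2 in O and f, together with all its derivatives of
   order <= 2, extends continuously to closure O (for f itself, the extension
   is f). *)
Definition C2_on_closure O f : Prop :=
  [/\ C2_on O f,
      {within closure O, continuous f},
      (forall v, extends_to_closure O ('D_v f)) &
      (forall v w, extends_to_closure O ('D_w ('D_v f)))].

End Smoothness.

Section Operator.
Context {R : realType} {n : nat}.
Implicit Types (x xi : 'rV[R]_n) (g : 'rV[R]_n -> R).

(* The library norm on 'rV[R]_n is the sup norm, hence a separate Euclidean
   norm; both induce the same topology. *)
Definition enorm x : R := Num.sqrt (\sum_(i < n) x ord0 i ^+ 2).

Definition unit_ball : set 'rV[R]_n := [set x | enorm x < 1].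

Definition gradient g x : 'rV[R]_n :=
  \row_(i < n) 'D_(delta_mx ord0 i) g x.

Definition hessian g x : 'M[R]_n :=
  \matrix_(i < n, j < n) 'D_(delta_mx ord0 i) ('D_(delta_mx ord0 j) g) x.

(* F(xi, X) = |xi|^(q-2) (tr X + (p-2) <X xi, xi> / |xi|^2). For q > 2 the
   first factor vanishes at xi = 0, so this is the continuous extension
   F(0, X) = 0. *)
Definition Fop (p q : R) xi (X : 'M[R]_n) : R :=
  enorm xi `^ (q - 2) *
    (\tr X + (p - 2) * ((xi *m X *m xi^T) ord0 ord0 / enorm xi ^+ 2)).

End Operator.

Section Touching.
Context {R : realType} {T : Type}.
Implicit Types (O : set T) (u : T -> \bar R) (phi : T -> R) (z : T).

Definition touches_from_below O phi u z : Prop :=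
  u z = (phi z)%:E /\ forall y, O y -> y <> z -> ((phi y)%:E < u y)%E.

Definition touches_from_above O phi u z : Prop :=
  u z = (phi z)%:E /\ forall y, O y -> y <> z -> (u y < (phi y)%:E)%E.

End Touching.

Section Stationary.
Context {R : realType} {n : nat}.
Variables p q : R.

Definition stationary_viscosity_solution
    (O : set 'rV[R]_n) (w : 'rV[R]_n -> R) : Prop :=
  [/\ {within O, continuous w},
      (forall (phi : 'rV[R]_n -> R) x0, O x0 -> C2_on O phi ->
         touches_from_below O phi (EFin \o w) x0 ->
         Fop p q (gradient phi x0) (hessian phi x0)
           + (q - 2)^-1 * w x0 <= 0) &
      (forall (phi : 'rV[R]_n -> R) x0, O x0 -> C2_on O phi ->
         touches_from_above O phi (EFin \o w) x0 ->
         0 <= Fop p q (gradient phi x0) (hessian phi x0)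
                + (q - 2)^-1 * w x0)].

End Stationary.

(* V is the profile in dimension n; only its values on [0, 1] matter. *)
Definition is_profile {R : realType} (n : nat) (p q : R) (V : R -> R) : Prop :=
  [/\ {within `[0, 1], continuous V},
      (forall r, 0 <= r < 1 -> 0 < V r),
      V 1 = 0 &
      stationary_viscosity_solution p q (@unit_ball R n)
        (fun x => V (enorm x))].

Section Evolution.
Context {R : realType} {n : nat}.
Variables p q : R.

Local Notation spacetime := ('rV[R]_n * R)%type.
Implicit Types (Theta : set spacetime) (phi : spacetime -> R)
  (u : spacetime -> \bar R) (z : spacetime).

(* f'(0) and f''(0) are the values at 0 of the continuous extensions of f' and
   f'' from ]0, +oo[, that is, their limits at 0 from the right. *)
Definition classF (f : R -> R) : Prop :=
  [/\ C2_on_closure [set r : R | 0 < r] f,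
      [/\ f 0 = 0, f^`() r @[r --> 0^'+] --> (0 : R)
        & f^`(2) r @[r --> 0^'+] --> (0 : R)],
      (forall r, 0 < r -> 0 < f^`(2) r) &
      let g := fun x : 'rV[R]_n => f (enorm x) in
      Fop p q (gradient g x) (hessian g x) @[x --> (0 : 'rV[R]_n)^'] --> (0 : R)].

Definition classSigma (sigma : R -> R) : Prop :=
  [/\ (forall r, sigma (- r) = sigma r),
      C1_on setT sigma,
      sigma 0 = 0, sigma^`() 0 = 0 &
      (forall r, r != 0 -> 0 < sigma r)].

Definition spatial_gradient phi z : 'rV[R]_n :=
  gradient (fun x => phi (x, z.2)) z.1.

Definition spatial_hessian phi z : 'M[R]_n :=
  hessian (fun x => phi (x, z.2)) z.1.

Definition time_derivative phi z : R :=
  ((fun t => phi (z.1, t))^`())%classic z.2.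

Definition admissible Theta phi : Prop :=
  C2_on Theta phi /\
  forall z0, Theta z0 -> spatial_gradient phi z0 = 0 ->
    exists (delta : R) (f sigma : R -> R),
      [/\ 0 < delta, classF f, classSigma sigma &
        forall z, Theta z ->
          enorm (z.1 - z0.1) < delta -> `|z.2 - z0.2| < delta ->
          `|phi z - phi z0 - time_derivative phi z0 * (z.2 - z0.2)|
            <= f (enorm (z.1 - z0.1)) + sigma (z.2 - z0.2)].

(* Theta is open in every use, so neighborhoods in the whole space suffice. *)
Definition lsc_on Theta u : Prop :=
  forall z, Theta z -> forall a : R, (a%:E < u z)%E ->
    \forall y \near z, (a%:E < u y)%E.

Definition usc_on Theta u : Prop :=
  forall z, Theta z -> forall a : R, (u z < a%:E)%E ->
    \forall y \near z, (u y < a%:E)%E.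

Definition finite_densely Theta u : Prop :=
  Theta `<=` closure (Theta `&` [set z | u z \is a fin_num]).

Definition viscosity_supersolution Theta u : Prop :=
  [/\ (forall z, Theta z -> u z <> -oo%E),
      lsc_on Theta u,
      finite_densely Theta u &
      forall phi z0, Theta z0 -> admissible Theta phi ->
        touches_from_below Theta phi u z0 ->
        (spatial_gradient phi z0 <> 0 ->
           0 <= time_derivative phi z0
                - Fop p q (spatial_gradient phi z0) (spatial_hessian phi z0)) /\
        (spatial_gradient phi z0 = 0 -> 0 <= time_derivative phi z0)].

Definition viscosity_subsolution Theta u : Prop :=
  [/\ (forall z, Theta z -> u z <> +oo%E),
      usc_on Theta u,
      finite_densely Theta u &
      forall phi z0, Theta z0 -> admissible Theta phi ->
        touches_from_above Theta phi u z0 ->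
        (spatial_gradient phi z0 <> 0 ->
           time_derivative phi z0
           - Fop p q (spatial_gradient phi z0) (spatial_hessian phi z0) <= 0) /\
        (spatial_gradient phi z0 = 0 -> time_derivative phi z0 <= 0)].

Definition viscosity_solution Theta (u : spacetime -> R) : Prop :=
  [/\ {within Theta, continuous u},
      viscosity_supersolution Theta (EFin \o u) &
      viscosity_subsolution Theta (EFin \o u)].

(* The solution of the initial-boundary value problem in B_1 x ]0, +oo[ with
   initial values u0 and zero lateral boundary values. *)
Definition ibvp_solution (u0 : 'rV[R]_n -> R) (u : spacetime -> R) : Prop :=
  [/\ {within [set z : spacetime | enorm z.1 <= 1 /\ 0 <= z.2], continuous u},
      viscosity_solution [set z | unit_ball z.1 /\ 0 < z.2] u,
      (forall x, unit_ball x -> u (x, 0) = u0 x) &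
      (forall x t, enorm x = 1 -> 0 < t -> u (x, t) = 0)].

End Evolution.

Definition radial_on {R : realType} {n : nat} (A : set 'rV[R]_n)
    (g : 'rV[R]_n -> R) : Prop :=
  forall x y, A x -> A y -> enorm x = enorm y -> g x = g y.

(* Main.v *)
(** The profile coincides with the explicitly integrable solution [W] of the
    radial ODE whose source term is the profile itself, as one sees by comparing
    it with slightly dilated copies of [W]. Separated functions [mu (t +
    tau)^(-1/(q-2)) W(|x - y| / r0)] then serve as barriers: dilated profiles
    with [r0 > 1] lie above the solution, and profiles of smaller balls,
    flattened to fourth order at their centre so that they are admissible there,
    lie below it. Positivity, known near one point, is carried to a ball around
    the origin through a chain of balls and, inside each of them, by a barrier
    built from a negative power of the distance; from then on the flattened
    profiles with [r0 < 1] close to 1 give the lower bound. Comparison is always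
    with an explicit radial barrier: at a maximum of the penalized difference
    the barrier is replaced by a quartic polynomial in squared distances, cut
    off outside a bounded range so that it becomes an admissible test function. *)

Require Import Defs.
From HB Require Import structures.
From mathcomp Require Import all_boot all_order all_algebra.
From mathcomp Require Import all_classical all_reals all_analysis.
From mathcomp Require Import ring lra.
Import Order.TTheory GRing.Theory Num.Theory.
Import numFieldNormedType.Exports.
Set Implicit Arguments.
Unset Strict Implicit.
Unset Printing Implicit Defensive.
Local Open Scope ring_scope.
Local Open Scope classical_set_scope.

(** * Test functions *)

(** The obstacle is the notion of test function: it must touch strictly in the whole unbounded
    cylinder and be flat, in the sense of [classF], at each of its critical points, not only at the
    contact. A barrier that touches only locally must therefore be replaced by a global function
    whose critical points are under control; [sided_contact] does this once and for all. As one of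
    the two functions compared is always explicit, no doubling of variables is needed: the
    second-order jet of the barrier at one point suffices, up to an error that tends to zero. Taking
    V/(q-2) as a given source makes the radial equation solvable by two quadratures, and continuity
    of V is enough. At the centre of a barrier the gradient vanishes and the equation says little.
    From above, a contact there gives no contradiction, so the centre is moved. From below, [W0]
    leaves its maximum like r^(q/(q-1)), an exponent less than 2, so that no C^2 function fits under
    it; hence the flattened variants. The amplitude r0^(q/(q-2)) of a dilated barrier comes from
    homogeneity: F scales like the power q - 1 of the amplitude and -q of the length. *)

Section C2functions.
Context {R : realType} {V : normedModType R}.
Implicit Types f g : V -> R.

(** The directional derivative at [x] is the derivative at 0 of the restriction to the line through
    [x] in direction [v], so the one-variable chain rule suffices and Frechet differentiability need
    not be known. *)
Lemma is_derive_comp1 f (g : R -> R) (x v : V) (df dg : R) :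
  is_derive x v f df -> is_derive (f x) 1 g dg ->
  is_derive x v (g \o f) (dg * df).
Proof.
move=> [/derivable1P fxv dfE] gf.
have dE (W : normedModType R) (h : V -> W) :
    'D_v h x = 'D_1 (fun s : R => h (s *: v + x)) 0.
  rewrite /derive; set g1 := fun h => h^-1 *: _; set g2 := fun h => h^-1 *: _.
  suff -> : g1 = g2 by [].
  by rewrite funeqE /g1 /g2 => s /=; rewrite addr0 scale0r add0r [_%:A]mulr1.
have f1 : is_derive (0 : R) 1 (fun s : R => f (s *: v + x)) df.
  by apply: DeriveDef => //; rewrite -dE.
have gf' : is_derive (f (0 *: v + x)) 1 g dg by rewrite scale0r add0r.
have [h1 h2] := is_derive1_comp gf' f1.
by apply: DeriveDef; [exact/derivable1P|rewrite dE].
Qed.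

Lemma is_derive_linear (f : V -> R) (x v : V) :
  (forall (s : R) u w, f (s *: u + w) = s * f u + f w) ->
  is_derive x v f (f v).
Proof.
move=> fl.
have qE : \forall s \near 0^', s^-1 *: ((f \o shift x) (s *: v) - f x) = f v.
  near=> s; rewrite /= fl addrK [_ *: _]mulKf //.
  by near: s; exact: nbhs_dnbhs_neq.
have cv : s^-1 *: ((f \o shift x) (s *: v) - f x) @[s --> 0^'] --> f v.
  apply: cvg_near_cst; exact: qE.
by apply: DeriveDef; [apply/cvg_ex; exists (f v)|exact/cvg_lim].
Unshelve. all: by end_near. Qed.

(* Directional first and second derivatives are carried as explicit data. *)
Definition C2fun f := exists (D : V -> V -> R) (E : V -> V -> V -> R),
  [/\ continuous f, forall v x, is_derive x v f (D v x),
      forall v, continuous (D v),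
      forall v w x, is_derive x w (D v) (E v w x) &
      forall v w, continuous (E v w)].

Lemma C2fun_C2_on O f : C2fun f -> C2_on O f.
Proof.
move=> [D [E [cf fD cD DE cE]]].
have DfE v : 'D_v f = D v by apply/funext => x; exact: derive_val.
have DDfE v w : 'D_w (D v) = E v w by apply/funext => x; exact: derive_val.
split=> [v|v]; first by rewrite DfE; split=> x _; [exact: ex_derive|exact: cD].
move=> w; rewrite DfE DDfE; split=> x _; first exact: ex_derive.
exact: cE.
Qed.

Lemma C2fun_continuous f : C2fun f -> continuous f.
Proof. by case=> D [E []]. Qed.

Lemma C2fun_cst (k : R) : C2fun (fun=> k).
Proof.
exists (fun _ _ => 0), (fun _ _ _ => 0); split=> *; try exact: cvg_cst;
  exact: is_derive_cst.
Qed.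

Lemma C2fun_linear f : (forall (s : R) u w, f (s *: u + w) = s * f u + f w) ->
  continuous f -> C2fun f.
Proof.
move=> fl cf; exists (fun v _ => f v), (fun _ _ _ => 0); split=> //.
- by move=> v x; exact: is_derive_linear.
- by move=> v x; exact: cvg_cst.
- by move=> v w x; exact: is_derive_cst.
- by move=> v w x; exact: cvg_cst.
Qed.

Lemma C2funD f g : C2fun f -> C2fun g -> C2fun (fun x => f x + g x).
Proof.
move=> [D [E [cf fD cD DE cE]]] [D' [E' [cf' fD' cD' DE' cE']]].
exists (fun v x => D v x + D' v x), (fun v w x => E v w x + E' v w x); split.
- by move=> x; apply: cvgD; [exact: cf|exact: cf'].
- by move=> v x; exact: is_deriveD.
- by move=> v x; apply: cvgD; [exact: cD|exact: cD'].
- by move=> v w x; exact: is_deriveD.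
- by move=> v w x; apply: cvgD; [exact: cE|exact: cE'].
Qed.

Lemma C2funM f g : C2fun f -> C2fun g -> C2fun (fun x => f x * g x).
Proof.
move=> [D [E [cf fD cD DE cE]]] [D' [E' [cf' fD' cD' DE' cE']]].
exists (fun v x => f x * D' v x + g x * D v x),
  (fun v w x => (f x * E' v w x + D' v x * D w x)
                + (g x * E v w x + D v x * D' w x)); split.
- by move=> x; apply: cvgM; [exact: cf|exact: cf'].
- by move=> v x; exact: is_deriveM.
- move=> v x; apply: cvgD; apply: cvgM.
  + exact: cf.
  + exact: cD'.
  + exact: cf'.
  + exact: cD.
- move=> v w x; apply: is_deriveD; exact: is_deriveM.
- move=> v w x; apply: cvgD; apply: cvgD; apply: cvgM.
  + exact: cf.
  + exact: cE'.
  + exact: cD'.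
  + exact: cD.
  + exact: cf'.
  + exact: cE.
  + exact: cD.
  + exact: cD'.
Qed.

Lemma C2funX f k : C2fun f -> C2fun (fun x => f x ^+ k).
Proof.
move=> cf; elim: k => [|k ih]; first exact: C2fun_cst.
by under eq_fun do rewrite exprS; exact: C2funM.
Qed.

Lemma C2fun_sum (I : Type) (r : seq I) (F : I -> V -> R) :
  (forall i, C2fun (F i)) -> C2fun (fun x => \sum_(i <- r) F i x).
Proof.
move=> cF; elim: r => [|i r ih].
  by under eq_fun do rewrite big_nil; exact: C2fun_cst.
by under eq_fun do rewrite big_cons; exact: C2funD.
Qed.

End C2functions.

Section C2_composition.
Context {R : realType} {V : normedModType R}.

Lemma C2real_comp (h h1 h2 : R -> R) (f : V -> R) :
  (forall s : R, is_derive s 1 h (h1 s)) ->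
  (forall s : R, is_derive s 1 h1 (h2 s)) ->
  continuous h2 -> C2fun f -> C2fun (fun x => h (f x)).
Proof.
move=> hh1 hh2 ch2 [D [E [cf fD cD DE cE]]].
have ch : continuous h.
  by move=> s; apply/differentiable_continuous/derivable1_diffP/ex_derive.
have ch1 : continuous h1.
  by move=> s; apply/differentiable_continuous/derivable1_diffP/ex_derive.
exists (fun v x => h1 (f x) * D v x),
  (fun v w x => h1 (f x) * E v w x + D v x * (h2 (f x) * D w x)); split.
- by move=> x; apply: continuous_comp; [exact: cf|exact: ch].
- by move=> v x; apply: is_derive_comp1.
- move=> v x; apply: cvgM; last exact: cD.
  by apply: continuous_comp; [exact: cf|exact: ch1].
- move=> v w x.
  have h1f : is_derive x w (fun x => h1 (f x)) (h2 (f x) * D w x).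
    exact: is_derive_comp1.
  exact: is_deriveM.
- move=> v w x; apply: cvgD; apply: cvgM.
  + by apply: continuous_comp; [exact: cf|exact: ch1].
  + exact: cE.
  + exact: cD.
  + apply: cvgM; last exact: cD.
    by apply: continuous_comp; [exact: cf|exact: ch2].
Qed.

End C2_composition.

(** * Truncated powers max(s, 0)^k *)

Section TruncatedPowers.
Context {R : realType}.
Implicit Types s t : R.

Definition tpow (k : nat) (s : R) : R := Num.max s 0 ^+ k.

Lemma continuous_tpow k : continuous (tpow k).
Proof.
move=> s; apply: (@continuous_comp _ _ _ (fun s => Num.max s 0)
  (fun s => s ^+ k)); last exact: exprn_continuous.
apply: continuous_max; [exact: cvg_id|exact: cvg_cst].
Qed.

Lemma is_derive_tpow k s :
  is_derive s 1 (tpow k.+2) (k.+2%:R * tpow k.+1 s).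
Proof.
have [s0|s0|s0] := ltgtP s 0.
- have -> : k.+2%:R * tpow k.+1 s = 0.
    by rewrite /tpow max_r ?ltW// expr0n mulr0.
  apply: (@near_eq_is_derive _ _ _ (cst 0)).
  near=> t; rewrite /tpow max_r ?expr0n//; apply/ltW.
  by near: t; exact: lt_nbhsl.
- have -> : k.+2%:R * tpow k.+1 s = (k.+2%:R * s ^+ k.+1) *: 1.
    by rewrite /tpow max_l ?ltW// [RHS]mulr1.
  have id_s : is_derive s 1 (@id R) 1 by exact: is_derive_id.
  have := is_deriveX k.+2 id_s; rewrite /= => H.
  apply: near_eq_is_derive H; near=> t.
  have t0 : 0 <= t by apply/ltW; near: t; exact: lt_nbhsr.
  by rewrite /tpow max_l// exprfctE.
- subst s.
  have -> : k.+2%:R * tpow k.+1 0 = 0 :> R.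
    by rewrite /tpow max_l// expr0n mulr0.
  (* At the kink the difference quotient of [tpow k.+2] is [tpow k.+1] itself, which is continuous
     and vanishes at 0. *)
  have cv : h^-1 *: ((tpow k.+2 \o shift (0:R)) (h *: 1) - tpow k.+2 0)
      @[h --> 0^'] --> (0 : R).
    apply: (@cvg_trans _ (tpow k.+1 h @[h --> 0^'])).
      apply: near_eq_cvg; near=> h.
      rewrite /= addr0 [_%:A]mulr1 /tpow maxxx !expr0n/= subr0.
      have [h0|h0] := leP h 0; first by rewrite !expr0n /= scaler0.
      by rewrite [in RHS]exprS; apply/esym/mulKf; rewrite gt_eqF.
    have t0 : tpow k.+1 (0 : R) = 0 by rewrite /tpow maxxx expr0n.
    have : tpow k.+1 h @[h --> 0^'] --> tpow k.+1 (0 : R).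
      by apply: cvg_within_filter; exact: continuous_tpow.
    by rewrite t0.
  by apply: DeriveDef; [apply/cvg_ex; exists 0|exact/cvg_lim].
Unshelve. all: by end_near. Qed.

End TruncatedPowers.

(** * Euclidean inner product and squared distance *)

Section Dot.
Context {R : realType} {n : nat}.
Implicit Types (x y z v w : 'rV[R]_n) (k : R).

Definition dot x y : R := \sum_(i < n) x ord0 i * y ord0 i.

Lemma dotC x y : dot x y = dot y x.
Proof. by apply: eq_bigr => i _; rewrite mulrC. Qed.

Lemma dotDl x y z : dot (x + y) z = dot x z + dot y z.
Proof. by rewrite -big_split; apply: eq_bigr => i _; rewrite mxE mulrDl. Qed.

Lemma dotZl k x y : dot (k *: x) y = k * dot x y.
Proof. by rewrite /dot mulr_sumr; apply: eq_bigr => i _; rewrite mxE mulrA. Qed.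

Lemma dotNl x y : dot (- x) y = - dot x y.
Proof. by rewrite -scaleN1r dotZl mulN1r. Qed.

Lemma dotDr x y z : dot x (y + z) = dot x y + dot x z.
Proof. by rewrite dotC dotDl !(dotC x). Qed.

Lemma dotZr k x y : dot x (k *: y) = k * dot x y.
Proof. by rewrite dotC dotZl dotC. Qed.

Lemma dotNr x y : dot x (- y) = - dot x y.
Proof. by rewrite dotC dotNl dotC. Qed.

Definition dotE := (dotDl, dotDr, dotNl, dotNr, dotZl, dotZr).

Lemma dot0r x : dot x 0 = 0.
Proof. by rewrite -(scale0r 0) dotZr mul0r. Qed.

Lemma dotxx_ge0 x : 0 <= dot x x.
Proof. by apply: sumr_ge0 => i _; rewrite -expr2 sqr_ge0. Qed.

Lemma dotxx_eq0 x : (dot x x == 0) = (x == 0).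
Proof.
apply/eqP/eqP => [xx0|->]; last exact: dot0r.
apply/rowP => i; rewrite mxE; apply/eqP; rewrite -sqrf_eq0 expr2.
have/eqP := xx0; rewrite psumr_eq0 => [|j _]; last by rewrite -expr2 sqr_ge0.
by move/allP/(_ i (mem_index_enum _)).
Qed.

Lemma dotxx_gt0 x : (0 < dot x x) = (x != 0).
Proof. by rewrite lt_neqAle dotxx_ge0 eq_sym dotxx_eq0 andbT. Qed.

Lemma dot_delta x i : dot x (delta_mx ord0 i) = x ord0 i.
Proof.
rewrite /dot (bigD1 i)//= big1 ?addr0 ?mxE ?eqxx ?mulr1// => j ji.
by rewrite mxE eqxx (negbTE ji) mulr0.
Qed.

Lemma dot_CS x y : dot x y ^+ 2 <= dot x x * dot y y.
Proof.
have [->|x0] := eqVneq x 0; first by rewrite dotC !dot0r expr0n mul0r.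
rewrite -dotxx_gt0 in x0.
have := dotxx_ge0 (dot x x *: y - dot x y *: x).
rewrite !dotE (dotC y x).
set a := dot x x; set b := dot x y; set c := dot y y => H.
have {}H : 0 <= a * (a * c - b ^+ 2) by move: H; congr (0 <= _); ring.
by rewrite -subr_ge0 -(pmulr_rge0 _ x0).
Qed.

Lemma enorm_ge0 x : 0 <= enorm x.
Proof. exact: sqrtr_ge0. Qed.

Lemma enorm_sqr x : enorm x ^+ 2 = dot x x.
Proof.
rewrite /enorm (_ : \sum_(i < n) x ord0 i ^+ 2 = dot x x).
  by rewrite sqr_sqrtr// dotxx_ge0.
by apply: eq_bigr => i _; rewrite expr2.
Qed.

Lemma enormE x : enorm x = Num.sqrt (dot x x).
Proof. by rewrite -enorm_sqr sqrtr_sqr ger0_norm// enorm_ge0. Qed.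

Lemma enorm_eq0 x : (enorm x == 0) = (x == 0).
Proof. by rewrite -sqrf_eq0 enorm_sqr dotxx_eq0. Qed.

Lemma enorm_gt0 x : (0 < enorm x) = (x != 0).
Proof. by rewrite lt_neqAle enorm_ge0 eq_sym enorm_eq0 andbT. Qed.

Lemma enorm0 : enorm (0 : 'rV[R]_n) = 0.
Proof. by apply/eqP; rewrite enorm_eq0. Qed.

Lemma enormZ k x : enorm (k *: x) = `|k| * enorm x.
Proof.
rewrite !enormE dotZl dotZr mulrA -expr2 sqrtrM ?sqr_ge0// sqrtr_sqr//.
Qed.

Lemma enormN x : enorm (- x) = enorm x.
Proof. by rewrite -scaleN1r enormZ normrN1 mul1r. Qed.

Lemma enormB x y : enorm (x - y) = enorm (y - x).
Proof. by rewrite -enormN opprB. Qed.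

Lemma dot_le x y : `|dot x y| <= enorm x * enorm y.
Proof.
rewrite -[leRHS]ger0_norm ?mulr_ge0 ?enorm_ge0// -ler_sqr ?nnegrE//.
by rewrite -!normrX !ger0_norm ?sqr_ge0// exprMn !enorm_sqr dot_CS.
Qed.

Lemma ler_enormD x y : enorm (x + y) <= enorm x + enorm y.
Proof.
rewrite -ler_sqr ?nnegrE ?addr_ge0 ?enorm_ge0// sqrrD !enorm_sqr !dotE.
rewrite (dotC y x); have := le_trans (ler_norm _) (dot_le x y); lra.
Qed.

Lemma normv_le_enorm x : `|x| <= enorm x.
Proof.
rewrite [leLHS]/Num.Def.normr /= mx_normrE.
apply: bigmax_le => [|[j i] _]; first exact: enorm_ge0.
rewrite /= ord1 -ler_sqr ?nnegrE ?enorm_ge0// -normrX ger0_norm ?sqr_ge0//.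
rewrite enorm_sqr /dot (bigD1 i)//= -expr2 lerDl.
by apply: sumr_ge0 => k _; rewrite -expr2 sqr_ge0.
Qed.

Lemma continuous_coord (i : 'I_n) : continuous (fun x : 'rV[R]_n => x ord0 i).
Proof. by move=> x; exact: coord_continuous. Qed.

Lemma C2fun_coord (i : 'I_n) : C2fun (fun x : 'rV[R]_n => x ord0 i).
Proof.
apply: C2fun_linear; last exact: continuous_coord.
by move=> s u w; rewrite !mxE.
Qed.

Definition dist2 y x : R := dot (x - y) (x - y).

Lemma C2fun_dist2 y : C2fun (dist2 y).
Proof.
apply: C2fun_sum => i; apply: C2funM.
  all: under eq_fun do rewrite mxE; apply: C2funD; first exact: C2fun_coord.
  all: exact: C2fun_cst.
Qed.

Lemma is_derive_dist2 y x v : is_derive x v (dist2 y) (2 * dot (x - y) v).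
Proof.
have dxi i : is_derive x v (fun x : 'rV[R]_n => (x - y) ord0 i) (v ord0 i).
  have lin : is_derive x v (fun z : 'rV[R]_n => z ord0 i) (v ord0 i).
    by apply: (@is_derive_linear _ _ (fun z : 'rV[R]_n => z ord0 i)) => *;
      rewrite !mxE.
  have := is_deriveD lin (is_derive_cst (- y ord0 i) x v).
  rewrite addr0; suff -> : (fun z : 'rV[R]_n => (z - y) ord0 i)
      = (fun z => z ord0 i) + cst (- y ord0 i) by [].
  by apply/funext => z; rewrite !mxE.
have := is_derive_sum (fun i => is_deriveM (dxi i) (dxi i)).
have -> : \sum_(i < n) ((x - y) ord0 i *: v ord0 i
    + (x - y) ord0 i *: v ord0 i) = 2 * dot (x - y) v.
  by rewrite /dot mulr_sumr; apply: eq_bigr => i _; rewrite mulr_natl mulr2n.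
suff -> : dist2 y = \sum_(i < n) ((fun z : 'rV[R]_n => (z - y) ord0 i)
    * (fun z : 'rV[R]_n => (z - y) ord0 i)) by [].
by apply/funext => z; rewrite fct_sumE.
Qed.

Lemma continuous_enorm : continuous (@enorm R n).
Proof.
have -> : @enorm R n = Num.sqrt \o dist2 0.
  by apply/funext => x; rewrite enormE /= /dist2 subr0.
move=> x; apply: continuous_comp; last exact: sqrt_continuous.
exact/C2fun_continuous/C2fun_dist2.
Qed.

Lemma dist2E y x : dist2 y x = enorm (x - y) ^+ 2.
Proof. by rewrite enorm_sqr. Qed.

End Dot.

(** * The flattening spline *)

Section Spline.
Context {R : realType}.
Implicit Types s e t : R.

(* A quartic spline which vanishes for [s <= 0] and equals [s - 3/2] for
   [3 <= s]. *)
Definition spline s : R :=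
  (tpow 4 s - 3 * tpow 4 (s - 1) + 3 * tpow 4 (s - 2) - tpow 4 (s - 3)) / 24.
Definition spline1 s : R :=
  (tpow 3 s - 3 * tpow 3 (s - 1) + 3 * tpow 3 (s - 2) - tpow 3 (s - 3)) / 6.
(** The quadratic B-spline with knots 0, 1, 2, 3: a bump of integral 1 and mean 3/2. [spline1] is
    its distribution function, and [spline] the antiderivative of that; this explains the values 1
    and s - 3/2 beyond 3. *)
Definition spline2 s : R :=
  (tpow 2 s - 3 * tpow 2 (s - 1) + 3 * tpow 2 (s - 2) - tpow 2 (s - 3)) / 2.

Lemma is_derive_tpow_shift k (a s : R) :
  is_derive s 1 (fun s => tpow k.+2 (s - a)) (k.+2%:R * tpow k.+1 (s - a)).
Proof.
have h : is_derive s 1 (fun s : R => s - a) 1.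
  have := is_deriveD (is_derive_id s (1 : R)) (is_derive_cst (- a) s 1).
  by rewrite addr0.
have := is_derive_comp1 h (is_derive_tpow k (s - a)).
by rewrite mulr1.
Qed.

Lemma is_derive_tpow_comb (k : nat) (c s : R) : c != 0 ->
  is_derive s 1
    (fun s => (tpow k.+2 s - 3 * tpow k.+2 (s - 1) + 3 * tpow k.+2 (s - 2)
               - tpow k.+2 (s - 3)) / (k.+2%:R * c))
    ((tpow k.+1 s - 3 * tpow k.+1 (s - 1) + 3 * tpow k.+1 (s - 2)
               - tpow k.+1 (s - 3)) / c).
Proof.
move=> c0.
have H a := is_derive_tpow_shift k a s.
have := is_deriveZ (k.+2%:R * c)^-1 (is_deriveB (is_deriveD
  (is_deriveB (is_derive_tpow k s) (is_deriveZ 3 (H 1)))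
  (is_deriveZ 3 (H 2))) (H 3)).
set df := (X in is_derive _ _ _ X -> _).
have -> : df = (tpow k.+1 s - 3 * tpow k.+1 (s - 1) + 3 * tpow k.+1 (s - 2)
               - tpow k.+1 (s - 3)) / c.
  rewrite /df /GRing.scale/=; field.
  by rewrite c0/= -(natrD _ 2 k) pnatr_eq0.
set g := (X in is_derive _ _ X _ -> _).
suff -> : g = fun s => (tpow k.+2 s - 3 * tpow k.+2 (s - 1)
    + 3 * tpow k.+2 (s - 2) - tpow k.+2 (s - 3)) / (k.+2%:R * c) by [].
by apply/funext => t; rewrite /g [RHS]mulrC.
Qed.

Lemma is_derive_spline s : is_derive s 1 spline (spline1 s).
Proof.
have := @is_derive_tpow_comb 2 6 s; rewrite -natrM; apply.
by rewrite pnatr_eq0.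
Qed.

Lemma is_derive_spline1 s : is_derive s 1 spline1 (spline2 s).
Proof.
have := @is_derive_tpow_comb 1 2 s; rewrite -natrM; apply.
by rewrite pnatr_eq0.
Qed.

Lemma continuous_spline2 : continuous spline2.
Proof.
have H a : continuous (fun s : R => tpow 2 (s - a)).
  move=> s; apply: (@continuous_comp _ _ _ (fun s : R => s - a) (tpow 2)).
    by apply: cvgD; [exact: cvg_id|exact: cvg_cst].
  exact: continuous_tpow.
move=> s; apply: cvgM; last exact: cvg_cst.
apply: cvgB; last exact: H.
apply: cvgD; last by apply: cvgM; [exact: cvg_cst|exact: H].
by apply: cvgB; [exact: continuous_tpow|apply: cvgM; [exact: cvg_cst|exact: H]].
Qed.

Lemma tpow_ge k s : 0 <= s -> tpow k s = s ^+ k.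
Proof. by move=> s0; rewrite /tpow max_l. Qed.

Lemma tpow_le k s : s <= 0 -> tpow k.+1 s = 0.
Proof. by move=> s0; rewrite /tpow max_r// expr0n. Qed.

Lemma spline_id s : 3 <= s -> spline s = s - 3 / 2.
Proof. by move=> s3; rewrite /spline !tpow_ge; [field|lra..]. Qed.

Lemma spline1_id s : 3 <= s -> spline1 s = 1.
Proof. by move=> s3; rewrite /spline1 !tpow_ge; [field|lra..]. Qed.

Lemma spline2_id s : 3 <= s -> spline2 s = 0.
Proof. by move=> s3; rewrite /spline2 !tpow_ge; [field|lra..]. Qed.

Lemma spline_le0 s : s <= 0 -> spline s = 0.
Proof. by move=> s3; rewrite /spline !tpow_le; [field|lra..]. Qed.

(** The B-spline is symmetric about 3/2, so both sides have the same second derivative. The identity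
    halves the range to be checked for [spline_ge0] and converts it into [spline_ge]. *)
Lemma spline_sym s : spline s = spline (3 - s) + s - 3 / 2.
Proof.
have tN (x : R) : tpow 4 (- x) = x ^+ 4 - tpow 4 x.
  have [x0|x0] := leP 0 x; first by rewrite tpow_le ?tpow_ge ?subrr//; lra.
  by rewrite tpow_ge ?tpow_le//; [ring|lra..].
rewrite /spline.
have -> : 3 - s = - (s - 3) by ring.
have -> : - (s - 3) - 1 = - (s - 2) by ring.
have -> : - (s - 3) - 2 = - (s - 1) by ring.
have -> : - (s - 3) - 3 = - s by ring.
by rewrite !tN; field.
Qed.

Lemma spline_ge0 s : 0 <= spline s.
Proof.
wlog s32 : s / s <= 3 / 2.
  move=> H; have [|s32] := leP s (3 / 2); first exact: H.
  by rewrite spline_sym; have := H (3 - s); lra.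
have [s0|s0] := leP s 0; first by rewrite spline_le0.
rewrite /spline (tpow_le 3 (s:= s - 2)) ?(tpow_le 3 (s:= s - 3)); [|lra..].
rewrite tpow_ge; last exact: ltW.
have [s1|s1] := leP s 1.
  by rewrite tpow_le; [have := exprn_ge0 4 (ltW s0); lra|lra].
rewrite tpow_ge; last lra.
have : (s - 1) ^+ 2 <= 1 / 4 by nra.
have : 1 <= s ^+ 2 by nra.
have -> : s ^+ 4 = (s ^+ 2) ^+ 2 by rewrite -exprM.
have -> : (s - 1) ^+ 4 = ((s - 1) ^+ 2) ^+ 2 by rewrite -exprM.
have := sqr_ge0 (s - 1); set x := s ^+ 2; set y := (s - 1) ^+ 2; nra.
Qed.

Lemma spline_ge s : s - 3 / 2 <= spline s.
Proof. by rewrite spline_sym; have := spline_ge0 (3 - s); lra. Qed.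

(** Makes [flatten] strictly increasing wherever it is not constant, so that flattening creates
    critical points only where the polynomial is at most -4e. *)
Lemma spline1_gt0 s : 0 < s -> 0 < spline1 s.
Proof.
move=> s0; rewrite /spline1; have [s3|s3] := leP 3 s.
  by rewrite -/(spline1 s) spline1_id.
rewrite (tpow_le 2 (s:= s - 3)) ?(tpow_ge 3 (s:=s)); [|lra..].
have := exprn_gt0 3 s0 => s30.
have [s1|s1] := leP s 1; first by rewrite !tpow_le; lra.
rewrite (tpow_ge 3 (s:= s - 1)); last lra.
have [s2|s2] := leP s 2.
  rewrite tpow_le; last lra.
  have -> : s ^+ 3 - 3 * (s - 1) ^+ 3 + 3 * 0 - 0
    = 1 + 3 * (s - 1) + (s - 1) ^+ 2 * (3 - 2 * (s - 1)) by ring.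
  have := sqr_ge0 (s - 1); nra.
rewrite tpow_ge; last lra.
have -> : s ^+ 3 - 3 * (s - 1) ^+ 3 + 3 * (s - 2) ^+ 3 - 0
  = 6 - (3 - s) * (3 - s) ^+ 2 by ring.
have : (3 - s) ^+ 2 <= 1 by nra.
have := sqr_ge0 (3 - s); nra.
Qed.

(** The fourth-order start of the spline is what lets a flattened function leave its constant value
    slowly enough for [classF]. *)
Lemma spline_le_tpow s : spline s <= tpow 4 s.
Proof.
have [s0|s0] := leP s 0; first by rewrite spline_le0// tpow_le.
have mono (a b : R) : a <= b -> tpow 4 a <= tpow 4 b.
  move=> ab; rewrite /tpow lerXn2r ?nnegrE//; do ?by rewrite le_max lexx orbT.
  by rewrite ge_max !le_max ab lexx orbT.
rewrite /spline; have := mono (s - 2) (s - 1); have := mono (s - 1) s.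
have tge0 (a : R) : 0 <= tpow 4 a.
  by rewrite /tpow exprn_ge0// le_max lexx orbT.
have := tge0 s; have := tge0 (s - 1); have := tge0 (s - 2); have := tge0 (s - 3).
lra.
Qed.

(* [flatten e] is the identity on [-e, +oo[ and constant on ]-oo, -4e]. *)
Definition flatten e s := e * (spline (s / e + 4) - 5 / 2).

Section Flatten.
Variable e : R.
Hypothesis e0 : 0 < e.

Lemma is_derive_flatten s :
  is_derive s 1 (flatten e) (spline1 (s / e + 4)).
Proof.
have h : is_derive s 1 (fun s : R => s / e + 4) e^-1.
  have := is_deriveD (is_deriveZ e^-1 (is_derive_id s (1 : R)))
    (is_derive_cst (4 : R) s 1).
  rewrite addr0 [_ *: 1]mulr1.
  suff -> : e^-1 \*: id + cst 4 = (fun s : R => s / e + 4) by [].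
  by apply/funext => x; rewrite mulrC.
have := is_deriveZ e (is_deriveB (is_derive_comp1 h (is_derive_spline _))
  (is_derive_cst (5 / 2 : R) s 1)).
by rewrite subr0 [_ *: _]mulrCA divff ?gt_eqF// mulr1.
Qed.

Lemma is_derive_flatten1 s : is_derive s 1
  (fun s => spline1 (s / e + 4)) (spline2 (s / e + 4) / e).
Proof.
have h : is_derive s 1 (fun s : R => s / e + 4) e^-1.
  have := is_deriveD (is_deriveZ e^-1 (is_derive_id s (1 : R)))
    (is_derive_cst (4 : R) s 1).
  rewrite addr0 [_ *: 1]mulr1.
  suff -> : e^-1 \*: id + cst 4 = (fun s : R => s / e + 4) by [].
  by apply/funext => x; rewrite mulrC.
exact: is_derive_comp1 h (is_derive_spline1 _).
Qed.

Lemma continuous_flatten2 : continuous (fun s => spline2 (s / e + 4) / e).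
Proof.
move=> s; apply: cvgM; last exact: cvg_cst.
apply: (@continuous_comp _ _ _ (fun s : R => s / e + 4) spline2).
  by apply: cvgD; [apply: cvgM; [exact: cvg_id|]|]; exact: cvg_cst.
exact: continuous_spline2.
Qed.

Lemma flatten_ge s : s <= flatten e s.
Proof.
have := spline_ge (s / e + 4); rewrite /flatten => h.
rewrite -[leLHS](divfK (lt0r_neq0 e0)) mulrC ler_pM2l//; lra.
Qed.

(** The bound is the constant value on ]-oo, -4e]. For e at most 2/5 it is at least -1, a loss that
    the time part of the test function can absorb. *)
Lemma flatten_geN s : - (5 / 2 * e) <= flatten e s.
Proof.
by have := mulr_ge0 (ltW e0) (spline_ge0 (s / e + 4)); rewrite /flatten; lra.
Qed.

Lemma flatten0 : flatten e 0 = 0.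
Proof. by rewrite /flatten mul0r add0r spline_id; [field|lra]. Qed.

Lemma flatten_deriv_eq0 s : spline1 (s / e + 4) = 0 -> s <= - (4 * e).
Proof.
move=> s0; have [|h] := leP (s / e + 4) 0; last first.
  by have := spline1_gt0 h; rewrite s0 ltxx.
rewrite -lerBrDr sub0r ler_pdivrMr//; lra.
Qed.

(** Since s1/e + 4 <= 0, the argument s/e + 4 is positive only by virtue of s - s1, and the spline
    is below the fourth power of its positive part. *)
Lemma flatten_sub_le (s1 s : R) : s1 <= - (4 * e) ->
  `|flatten e s - flatten e s1| <= e * (`|s - s1| / e) ^+ 4.
Proof.
move=> s1e; rewrite /flatten (spline_le0 (s := s1 / e + 4)); last first.
  by rewrite -lerBrDr sub0r ler_pdivrMr//; lra.
have -> : e * (spline (s / e + 4) - 5 / 2) - e * (0 - 5 / 2)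
  = e * spline (s / e + 4) by ring.
rewrite ger0_norm; last by rewrite mulr_ge0 ?spline_ge0// ltW.
rewrite ler_pM2l//.
apply: le_trans (spline_le_tpow _) _.
rewrite /tpow lerXn2r ?nnegrE//; first by rewrite le_max lexx orbT.
  by rewrite divr_ge0// ltW.
rewrite ge_max divr_ge0 ?(ltW e0)// andbT.
have : (s - s1) / e <= `|s - s1| / e by rewrite ler_pM2r ?invr_gt0// ler_norm.
have : s1 / e <= - 4 by rewrite ler_pdivrMr//; lra.
rewrite mulrBl; lra.
Qed.

End Flatten.
End Spline.

(** * Critical values of the quartic polynomial *)

Section CriticalValues.
Context {R : realType}.

(* The function k1 sg + k2 sg^2 + K s^2, where s = |x - x0|^2 and
   sg = |x - y|^2 - |x0 - y|^2: for large K its critical values on a bounded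
   set are negative.  The hypotheses on sg and s at a critical point are
   Cauchy-Schwarz and the scalar consequences of the vanishing gradient. *)
Lemma critical_value_neg (z0 k1 k2 S : R) : 0 < z0 -> k1 != 0 -> 0 < S ->
  exists K0, forall K, K0 <= K -> exists2 e, 0 < e & forall s sg,
    0 <= s <= S -> (sg - s) ^+ 2 <= 4 * z0 * s ->
    (2 * k1 + 4 * k2 * sg) * (sg + s) / 2 = - (4 * K * s ^+ 2) ->
    (2 * k1 + 4 * k2 * sg) ^+ 2 * (z0 + sg) = 16 * K ^+ 2 * s ^+ 3 ->
    k1 * sg + k2 * sg ^+ 2 + K * s ^+ 2 <= - (4 * e).
Proof.
move=> z00 k10 S0.
pose L := Num.sqrt S + 2 * Num.sqrt z0.
have L0 : 0 < L by rewrite ltr_pwDl ?sqrtr_gt0// mulr_ge0// sqrtr_ge0.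
have ak1 : 0 < `|k1| by rewrite normr_gt0.
have ak2 := normr_ge0 k2.
(* For s <= r1^2 the bound |sg| <= L sqrt(s) gives |al| >= |k1| and z0 + sg >= z0/2, where [al] is 2
   k1 + 4 k2 sg. *)
pose r1 := Num.min (`|k1| / (4 * `|k2| * L + 1)) (z0 / (2 * L)).
have r10 : 0 < r1 by rewrite lt_min !divr_gt0//; nra.
pose c := k1 ^+ 2 * z0 / 32.
have c0 : 0 < c by rewrite /c divr_gt0// mulr_gt0// exprn_even_gt0.
pose C3 := `|k1| + 2 * `|k2| * L * Num.sqrt S + `|k2| * L ^+ 2.
have C30 : 0 < C3.
  have h1 : 0 <= 2 * `|k2| * L * Num.sqrt S.
    by rewrite !mulr_ge0 ?sqrtr_ge0// ltW.
  have h2 : 0 <= `|k2| * L ^+ 2 by rewrite mulr_ge0 ?sqr_ge0.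
  rewrite /C3; lra.
exists (Num.max 1 (Num.max (C3 / r1 ^+ 2) (C3 ^+ 3 / c))).
move=> K; rewrite !ge_max => /and3P[K1 Kr Kc].
have K0 : 0 < K by lra.
pose m := Num.min (K * (r1 ^+ 2) ^+ 2) (c / (K * S)).
have m0 : 0 < m.
  rewrite lt_min; apply/andP; split.
    by rewrite mulr_gt0// !exprn_gt0.
  by rewrite divr_gt0// mulr_gt0.
exists (m / 2); first lra.
move=> s sg /andP[s0 sS] CS eA eB.
pose r := Num.sqrt s.
have r0 : 0 <= r by exact: sqrtr_ge0.
have r2 : r ^+ 2 = s by rewrite sqr_sqrtr.
have rS : r <= Num.sqrt S by exact: ler_wsqrtr.
have sgL : `|sg| <= L * r.
  have h : `|sg - s| <= 2 * Num.sqrt z0 * r.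
    rewrite -ler_sqr ?nnegrE ?mulr_ge0 ?sqrtr_ge0//.
    rewrite -normrX ger0_norm ?sqr_ge0// !exprMn r2 sqr_sqrtr ?(ltW z00)//.
    by apply: le_trans CS _; rewrite -natrX.
  have : `|sg| <= `|sg - s| + s.
    by have := ler_normD (sg - s) s; rewrite subrK (ger0_norm s0).
  have : s <= Num.sqrt S * r by rewrite -[leLHS]r2 expr2 ler_wpM2r.
  rewrite /L; lra.
set al := 2 * k1 + 4 * k2 * sg in eA eB.
(* The radial identity [eA] eliminates the first-order term k1 sg. What remains is -3 K s^2 and
   terms of order s. *)
have PE : k1 * sg + k2 * sg ^+ 2 + K * s ^+ 2
    = - (3 * K * s ^+ 2) - al * s / 2 - k2 * sg ^+ 2.
  have -> : k1 * sg + k2 * sg ^+ 2 = al * (sg + s) / 2 - al * s / 2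
    - k2 * sg ^+ 2 by rewrite /al; field.
  by rewrite eA; field.
have sg2 : sg ^+ 2 <= L ^+ 2 * s.
  rewrite -r2 -exprMn -[sg ^+ 2]ger0_norm ?sqr_ge0// normrX.
  by rewrite lerXn2r// nnegrE// mulr_ge0// ltW.
have alb : `|al| <= 2 * `|k1| + 4 * `|k2| * L * Num.sqrt S.
  have h : `|k2| * `|sg| <= `|k2| * (L * Num.sqrt S).
    by rewrite ler_wpM2l//; apply: le_trans sgL _; rewrite ler_pM2l.
  apply: le_trans (ler_normD _ _) _; rewrite !normrM !normr_nat.
  lra.
have Pb : k1 * sg + k2 * sg ^+ 2 + K * s ^+ 2 <= - (3 * K * s ^+ 2) + C3 * s.
  have h1 : - (al * s) <= `|al| * s.
    by rewrite -mulNr ler_wpM2r// -normrN ler_norm.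
  have h2 : - (k2 * sg ^+ 2) <= `|k2| * (L ^+ 2 * s).
    rewrite -mulNr; apply: (@le_trans _ _ (`|k2| * sg ^+ 2)).
      by rewrite ler_wpM2r ?sqr_ge0// -normrN ler_norm.
    by rewrite ler_wpM2l.
  have h3 : `|al| * s <= (2 * `|k1| + 4 * `|k2| * L * Num.sqrt S) * s.
    by rewrite ler_wpM2r.
  rewrite PE /C3; lra.
(* Either s is bounded below, or the point is close to [x0]; there the gradient of the first two
   terms does not vanish, and by [eB] only K s^2 can balance it, which forces K^2 s^3 >= c. In both
   cases K s >= C3 for large K, and -3 K s^2 wins. *)
have dich : r1 ^+ 2 <= s \/ c <= K ^+ 2 * s ^+ 3.
  have [h|h] := leP (r1 ^+ 2) s; [by left|right].
  have rr1 : r <= r1.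
    by rewrite -ler_sqr ?nnegrE// ?r2 ?ltW.
  have := rr1; rewrite /r1 le_min => /andP[].
  rewrite !ler_pdivlMr ?mulr_gt0//; last by rewrite ltr_wpDl// !mulr_ge0// ltW.
  move=> ra rb.
  have a1 : `|k1| <= `|al|.
    have : `|2 * k1| <= `|al| + `|4 * k2 * sg|.
      have -> : 2 * k1 = al - 4 * k2 * sg by rewrite /al; ring.
      exact: ler_normB.
    rewrite !normrM !normr_nat.
    have : 4 * `|k2| * `|sg| <= 4 * `|k2| * (L * r) by rewrite ler_wpM2l ?mulr_ge0.
    lra.
  have a2 : k1 ^+ 2 <= al ^+ 2.
    rewrite -[k1 ^+ 2]ger0_norm ?sqr_ge0// -[al ^+ 2]ger0_norm ?sqr_ge0//.
    by rewrite !normrX lerXn2r// nnegrE.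
  have a3 : z0 / 2 <= z0 + sg.
    have := ler_norm (- sg); rewrite normrN; lra.
  have : k1 ^+ 2 * (z0 / 2) <= al ^+ 2 * (z0 + sg).
    by apply: ler_pM => //; [exact: sqr_ge0|lra].
  rewrite eB /c; lra.
have C3K : C3 <= K * s.
  case: dich => h.
    move: Kr; rewrite ler_pdivrMr ?exprn_gt0// => Kr.
    by apply: le_trans Kr _; rewrite ler_pM2l.
  move: Kc; rewrite ler_pdivrMr// => Kc.
  have : C3 ^+ 3 <= (K * s) ^+ 3.
    by apply: le_trans Kc _; rewrite exprMn (exprS K) -mulrA ler_pM2l.
  by rewrite ler_pXn2r// nnegrE ?mulr_ge0// ltW.
have mK : m <= K * s ^+ 2.
  rewrite /m ge_min; case: dich => h.
    by rewrite ler_pM2l// lerXn2r ?nnegrE ?sqr_ge0// h.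
  apply/orP; right; rewrite ler_pdivrMr ?mulr_gt0//.
  apply: le_trans h _.
  have -> : K * s ^+ 2 * (K * S) = K ^+ 2 * s ^+ 2 * S by ring.
  have -> : K ^+ 2 * s ^+ 3 = K ^+ 2 * s ^+ 2 * s by ring.
  by rewrite ler_wpM2l// mulr_ge0 ?sqr_ge0.
have : C3 * s <= K * s * s by rewrite ler_wpM2r.
rewrite -mulrA -expr2 => h; lra.
Qed.

End CriticalValues.

(** * Radial test functions and the operator F *)

Section RealTaylor.
Context {R : realType}.

Lemma is_derive_continuous (f f1 : R -> R) :
  (forall s : R, is_derive s 1 f (f1 s)) -> continuous f.
Proof.
by move=> fd s; apply/differentiable_continuous/derivable1_diffP/ex_derive.
Qed.

Lemma MVT_sym (f f1 : R -> R) (a b : R) :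
  (forall s : R, `|s - a| <= `|b - a| -> is_derive s 1 f (f1 s)) ->
  exists2 c, `|c - a| <= `|b - a| & f b - f a = f1 c * (b - a).
Proof.
have cw (u v : R) : (forall s : R, s \in `[u, v]%R -> is_derive s 1 f (f1 s)) ->
    {within `[u, v], continuous f}.
  move=> fd; apply: derivable_within_continuous => s sab.
  by have sd := fd _ sab; exact: ex_derive.
move=> fd; have [ab|ba] := leP a b.
  have fd' s : s \in `[a, b]%R -> is_derive s 1 f (f1 s).
    rewrite in_itv/= => /andP[as_ sb]; apply: fd.
    by rewrite !ger0_norm ?subr_ge0// lerD2r.
  have [c] := MVT_segment ab (fun s sab => fd' s (subset_itv_oo_cc sab))
    (cw _ _ fd').
  rewrite in_itv/= => /andP[ac cb] E; exists c => //.
  by rewrite !ger0_norm ?subr_ge0// lerD2r.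
have fd' s : s \in `[b, a]%R -> is_derive s 1 f (f1 s).
  rewrite in_itv/= => /andP[bs sa]; apply: fd.
  by rewrite !ler0_norm ?subr_le0// ?(ltW ba)// lerN2 lerD2r.
have [c] := MVT_segment (ltW ba) (fun s sab => fd' s (subset_itv_oo_cc sab))
  (cw _ _ fd').
rewrite in_itv/= => /andP[bc ca] E; exists c.
  by rewrite !ler0_norm ?subr_le0// ?(ltW ba)// lerN2 lerD2r.
by rewrite -[LHS]opprB E; ring.
Qed.

Lemma near_abs_lt (a : R) (P : R -> Prop) : (\forall s \near a, P s) ->
  exists2 d, 0 < d & forall s, `|s - a| < d -> P s.
Proof.
by move=> /nbhs_ballP[d /= d0 H]; exists d => // s sd; apply: H;
  rewrite /ball/= distrC.
Qed.

Lemma abs_lt_itv (t t0 lo hi : R) :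
  `|t - t0| < t0 - lo -> `|t - t0| < hi - t0 -> lo <= t <= hi.
Proof. by rewrite !ltr_norml => /andP[h1 _] /andP[_ h2]; lra. Qed.

(** Peano's form: the second derivative is needed at [a] alone, which is all that [radial_profile]
    provides. The mean value theorem turns the linear estimate of [g1] near [a] into the quadratic
    one of [g]. *)
Lemma taylor1_bound (g g1 : R -> R) (g2 a : R) :
  (\forall s \near a, is_derive (s : R) 1 g (g1 s)) ->
  is_derive a 1 g1 g2 -> forall eta, 0 < eta ->
  exists2 d, 0 < d & forall s, `|s - a| < d ->
    `|g s - g a - g1 a * (s - a) - g2 / 2 * (s - a) ^+ 2|
    <= eta * (s - a) ^+ 2.
Proof.
move=> /near_abs_lt[d1 d10 gd] g1d eta eta0.
have [d2 d20 g1b] : exists2 d, 0 < d & forall s, `|s - a| < d ->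
    `|g1 s - g1 a - g2 * (s - a)| <= eta * `|s - a|.
  have [dv dE] := g1d.
  have cv : h^-1 *: ((g1 \o shift a) (h *: 1) - g1 a) @[h --> 0^'] --> g2.
    by rewrite -dE; exact: dv.
  have /cvgrPdist_le/(_ _ eta0) := cv.
  rewrite near_withinE => /near_abs_lt[d d0 H]; exists d => // s sd.
  have [->|sa] := eqVneq s a; first by rewrite !subrr mulr0 !normr0 subr0 normr0 mulr0.
  have := H (s - a); rewrite subr0 => /(_ sd); rewrite subr_eq0 => /(_ sa) /=.
  rewrite [(s - a)%:A]mulr1 subrK => h.
  have -> : g1 s - g1 a - g2 * (s - a)
    = - ((g2 - (s - a)^-1 *: (g1 s - g1 a)) * (s - a)).
    by rewrite /GRing.scale/=; field; rewrite subr_eq0.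
  by rewrite normrN normrM ler_wpM2r.
exists (Num.min d1 d2); first by rewrite lt_min d10.
move=> s; rewrite lt_min => /andP[sd1 sd2].
pose k t := g t - g a - g1 a * (t - a) - g2 / 2 * (t - a) ^+ 2.
have kd t : `|t - a| <= `|s - a| ->
    is_derive t 1 k (g1 t - g1 a - g2 * (t - a)).
  move=> ts.
  have gt : is_derive t 1 g (g1 t) by apply: gd; exact: le_lt_trans ts sd1.
  have h : is_derive t 1 (fun t : R => t - a) 1.
    have := is_deriveD (is_derive_id t (1 : R)) (is_derive_cst (- a) t 1).
    by rewrite addr0.
  have := is_deriveB (is_deriveB (is_deriveB gt (is_derive_cst (g a) t 1))
    (is_deriveZ (g1 a) h)) (is_deriveZ (g2 / 2) (is_deriveX 2 h)).
  rewrite subr0; set df := (X in is_derive _ _ _ X -> _).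
  suff -> : df = g1 t - g1 a - g2 * (t - a) by [].
  by rewrite /df /GRing.scale/= expr1; field.
have [c ca kE] := MVT_sym kd.
have k0 : k a = 0 by rewrite /k !subrr mulr0 expr0n/= mulr0 !subr0.
rewrite -/(k s) -[k s]subr0 -k0 kE normrM.
apply: (@le_trans _ _ (eta * `|c - a| * `|s - a|)).
  by rewrite ler_wpM2r// g1b// (le_lt_trans ca).
rewrite -mulrA ler_pM2l// -[leRHS]ger0_norm ?sqr_ge0// normrX expr2.
by rewrite ler_wpM2r.
Qed.

Lemma taylor1_quadratic (g g1 : R -> R) (g2 a : R) :
  (\forall s \near a, is_derive (s : R) 1 g (g1 s)) ->
  is_derive a 1 g1 g2 -> 
  exists C d, [/\ 0 < C, 0 < d & forall s, `|s - a| < d ->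
    `|g s - g a - g1 a * (s - a)| <= C * (s - a) ^+ 2].
Proof.
move=> gd g1d; have [d d0 H] := taylor1_bound gd g1d ltr01.
exists (1 + `|g2 / 2|), d; split=> // s /H h.
rewrite mulrDl; have -> : `|g2 / 2| * (s - a) ^+ 2 = `|g2 / 2 * (s - a) ^+ 2|.
  by rewrite [RHS]normrM (ger0_norm (sqr_ge0 _)).
rewrite -[X in `|X| <= _](subrK (g2 / 2 * (s - a) ^+ 2)).
by apply: le_trans (ler_normD _ _) _; rewrite lerD2r.
Qed.

End RealTaylor.

Section RadialOperator.
Context {R : realType} (n : nat) (p q : R).
Implicit Types (x y v w : 'rV[R]_n) (k z e : R).

(* Value of F on the second-order jet of [k1 (dist2 y) + k2 (dist2 y)^2]-type
   functions, as a function of the derivatives with respect to dist2. *)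
Definition Frad k1 k2 z : R :=
  (2 * `|k1| * Num.sqrt z) `^ (q - 2)
  * (2 * k1 * (n%:R + p - 2) + 8 * k2 * z * (p - 1)).

Lemma FradN e k1 k2 z : e ^+ 2 = 1 -> Frad (e * k1) (e * k2) z = e * Frad k1 k2 z.
Proof.
move=> e2; rewrite /Frad normrM.
have -> : `|e| = 1.
  by apply/eqP; rewrite -(@eqrXn2 _ 2)// -normrX e2 normr1 expr1n.
by rewrite mul1r; ring.
Qed.

(** The matrix 2 k1 I + 8 k2 x^T x has trace 2 k1 n + 8 k2 |x|^2 and the eigenvalue 2 k1 + 8 k2
    |x|^2 in the direction of the gradient. For w(|x|^2) this is the Hessian when k1 = w' and k2 =
    w''/2. *)
Lemma Fop_radial (hq : 2 < q) x k1 k2 (xi : 'rV[R]_n) (X : 'M[R]_n) :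
  xi = (2 * k1) *: x ->
  (forall i j, X i j = 2 * k1 * (i == j)%:R + 8 * k2 * x ord0 i * x ord0 j) ->
  Fop p q xi X = Frad k1 k2 (dot x x).
Proof.
move=> -> XE; rewrite /Fop /Frad enormZ normrM normr_nat -enormE.
(* At zero gradient both sides vanish, because 0^(q-2) = 0 for q > 2. *)
have [xi0|xi0] := eqVneq (2 * `|k1| * enorm x) 0.
  by rewrite xi0 powR0 ?mul0r// subr_eq0 gt_eqF.
congr (_ * _).
have trX : \tr X = 2 * k1 * n%:R + 8 * k2 * dot x x.
  rewrite /mxtrace (eq_bigr (fun i => 2 * k1 + 8 * k2 * (x ord0 i * x ord0 i))).
    by rewrite big_split /= sumr_const card_ord mulr_natr mulr_sumr.
  by move=> i _; rewrite XE eqxx mulr1 !mulrA.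
have quad : (((2 * k1) *: x) *m X *m ((2 * k1) *: x)^T) ord0 ord0
    = (2 * k1) ^+ 2 * (2 * k1 * dot x x + 8 * k2 * dot x x ^+ 2).
  rewrite linearZ /= -scalemxAl -scalemxAr -scalemxAl !mxE mulrA -expr2.
  congr (_ * _).
  transitivity (\sum_j (2 * k1 * (x ord0 j * x ord0 j)
      + 8 * k2 * dot x x * (x ord0 j * x ord0 j))).
    apply: eq_bigr => j _; rewrite !mxE.
    rewrite (eq_bigr (fun i => 2 * k1 * (x ord0 i * (i == j)%:R)
      + 8 * k2 * x ord0 j * (x ord0 i * x ord0 i))); last first.
      by move=> i _; rewrite XE; ring.
    rewrite big_split/= -!mulr_sumr -/(dot x x) (bigD1 j)//= eqxx big1.
      by rewrite addr0 mulr1; ring.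
    by move=> i /negbTE ->; rewrite mulr0.
  by rewrite big_split/= -!mulr_sumr -/(dot x x); ring.
rewrite trX quad !exprMn real_normK ?num_real// enorm_sqr.
have x0 : dot x x != 0.
  by apply: contra_neq xi0 => h; rewrite enormE h sqrtr0 mulr0.
have k10 : k1 != 0.
  by apply: contra_neq xi0 => ->; rewrite normr0 mulr0 mul0r.
by field; rewrite x0.
Qed.

(** The first two terms reproduce the second-order Taylor polynomial of a radial barrier in the
    variable [dist2 y]; the last is K |x - x0|^4, which makes the contact strict without changing
    the jet at [x0]. *)
Definition quartic y x0 k1 k2 (K : R) x : R :=
  k1 * (dist2 y x - dist2 y x0) + k2 * (dist2 y x - dist2 y x0) ^+ 2
  + K * dist2 x0 x ^+ 2.

Definition dquartic y x0 k1 k2 (K : R) x v : R :=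
  (k1 + 2 * k2 * (dist2 y x - dist2 y x0)) * (2 * dot (x - y) v)
  + 2 * K * dist2 x0 x * (2 * dot (x - x0) v).

Variables (y x0 : 'rV[R]_n) (k1 k2 K : R).
Local Notation P := (quartic y x0 k1 k2 K).
Local Notation DP := (dquartic y x0 k1 k2 K).

Lemma C2fun_quartic : C2fun P.
Proof.
have h : C2fun (fun x => dist2 y x - dist2 y x0).
  by apply: C2funD; [exact: C2fun_dist2|exact: C2fun_cst].
apply: C2funD; last first.
  by apply: C2funM; [exact: C2fun_cst|apply: C2funX; exact: C2fun_dist2].
apply: C2funD; (apply: C2funM; first exact: C2fun_cst) => //.
exact: C2funX.
Qed.

Lemma quartic0 : P x0 = 0.
Proof.
rewrite /quartic /dist2 !subrr dot0r; ring.
Qed.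

Lemma is_derive_quartic x v : is_derive x v P (DP x v).
Proof.
have hy := is_deriveD (is_derive_dist2 y x v)
  (is_derive_cst (- dist2 y x0) x v).
have := is_deriveD (is_deriveD (is_deriveZ k1 hy)
   (is_deriveZ k2 (is_deriveX 2 hy)))
  (is_deriveZ K (is_deriveX 2 (is_derive_dist2 x0 x v))).
set df := (X in is_derive _ _ _ X -> _).
suff -> : df = DP x v by [].
rewrite /df /dquartic /GRing.scale/= !fctE /= !expr1; ring.
Qed.

Lemma is_derive_dquartic v w :
  is_derive x0 w (fun x => DP x v)
    (2 * k1 * dot w v + 8 * k2 * dot (x0 - y) w * dot (x0 - y) v).
Proof.
have hl (c x : 'rV[R]_n) : is_derive x w (fun x : 'rV[R]_n => dot (x - c) v) (dot w v).
  have lin : is_derive x w (fun x : 'rV[R]_n => dot x v) (dot w v).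
    by apply: (@is_derive_linear _ _ (fun x : 'rV[R]_n => dot x v)) => s a b;
      rewrite dotDl dotZl.
  have := is_deriveD lin (is_derive_cst (- dot c v) x w).
  rewrite addr0; suff -> : (fun x : 'rV[R]_n => dot (x - c) v)
      = (fun x => dot x v) + cst (- dot c v) by [].
  by apply/funext => z; rewrite dotDl dotNl.
have hy := is_deriveD (is_derive_dist2 y x0 w)
  (is_derive_cst (- dist2 y x0) x0 w).
have h1 := is_deriveD (is_derive_cst k1 x0 w) (is_deriveZ (2 * k2) hy).
have := is_deriveD (is_deriveM h1 (is_deriveZ 2 (hl y x0)))
  (is_deriveM (is_deriveZ (2 * K) (is_derive_dist2 x0 x0 w))
     (is_deriveZ 2 (hl x0 x0))).
set df := (X in is_derive _ _ _ X -> _).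
suff -> : df = 2 * k1 * dot w v + 8 * k2 * dot (x0 - y) w * dot (x0 - y) v by [].
have d0 u : dot 0 u = 0 :> R by rewrite dotC dot0r.
rewrite /df /GRing.scale/= !fctE /= /dist2 !subrr !d0 !scaler0 /GRing.scale/=.
ring.
Qed.

End RadialOperator.

(** * Admissibility of separated functions *)

Section TestClasses.
Context {R : realType} {n : nat} (p q : R).
Hypothesis hq : 2 < q.
Implicit Types (x y v w : 'rV[R]_n).

Lemma gradientE (G : 'rV[R]_n -> R) x (D : 'rV[R]_n -> R) :
  (forall v, is_derive x v G (D v)) ->
  gradient G x = \row_i D (delta_mx ord0 i).
Proof. by move=> GD; apply/rowP => i; rewrite !mxE derive_val. Qed.

Lemma hessianE (G : 'rV[R]_n -> R) x (D : 'rV[R]_n -> 'rV[R]_n -> R)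
    (E : 'rV[R]_n -> 'rV[R]_n -> R) :
  (forall x v, is_derive x v G (D x v)) ->
  (forall v w, is_derive x w (D^~ v) (E v w)) ->
  forall i j, hessian G x i j = E (delta_mx ord0 j) (delta_mx ord0 i).
Proof.
move=> GD DE i j; rewrite mxE.
have -> : 'D_(delta_mx ord0 j) G = D^~ (delta_mx ord0 j).
  by apply/funext => z; rewrite derive_val.
by rewrite derive_val.
Qed.

Lemma dot_delta2 (i j : 'I_n) :
  dot (delta_mx ord0 i : 'rV[R]_n) (delta_mx ord0 j) = (i == j)%:R.
Proof. by rewrite dot_delta mxE eqxx eq_sym. Qed.

Lemma C2fun_id : C2fun (@id R).
Proof. by apply: C2fun_linear => // s; exact: cvg_id. Qed.

Lemma C2fun_on_closure (V : normedModType R) (O : set V) (f : V -> R) :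
  C2fun f -> C2_on_closure O f.
Proof.
move=> fC; have [D [E [cf fD cD DE cE]]] := fC.
have DfE (v : V) : 'D_v f = D v by apply/funext => x; exact: derive_val.
have DDfE (v w : V) : 'D_w (D v) = E v w by apply/funext => x; exact: derive_val.
split.
- exact: C2fun_C2_on.
- exact: continuous_subspaceT.
- by move=> v; exists (D v); [exact: continuous_subspaceT|move=> x _; rewrite derive_val].
- move=> v w; exists (E v w); first exact: continuous_subspaceT.
  by move=> x _; rewrite DfE derive_val.
Qed.

Lemma derive1_monomial (K : R) k :
  (fun r : R => K * r ^+ k.+1)^`() = fun r => K * k.+1%:R * r ^+ k.
Proof.
apply/funext => r; rewrite derive1E.
have := is_deriveZ K (is_deriveX k.+1 (is_derive_id r (1 : R))).
move=> /@derive_val h.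
have -> : (fun r : R => K * r ^+ k.+1) = K \*: (id ^+ k.+1).
  by apply/funext => s; rewrite /= exprfctE.
by rewrite h /GRing.scale/= mulr1 mulrA.
Qed.

Lemma quartic_pow4 (K : R) x : quartic 0 0 0 0 K x = K * enorm x ^+ 4.
Proof.
rewrite /quartic !mul0r !add0r dist2E subr0; ring.
Qed.

(** On K |x|^4 the operator equals [Frad] at k1 = 2 K |x|^2, k2 = K, hence is bounded by a multiple
    of |x|^2 near the origin. The exponent 4 thus serves every q > 2. *)
Lemma classF_pow4 (K : R) : 0 < K -> @classF R n p q (fun r => K * r ^+ 4).
Proof.
move=> K0; have fC : C2fun (fun r : R => K * r ^+ 4).
  by apply: C2funM; [exact: C2fun_cst|apply: C2funX; exact: C2fun_id].
have d1 : (fun r : R => K * r ^+ 4)^`() = fun r => K * 4 * r ^+ 3.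
  exact: derive1_monomial.
have d2 : (fun r : R => K * r ^+ 4)^`(2) = fun r => K * 4 * 3 * r ^+ 2.
  by rewrite derive1nS derive1n1 d1 derive1_monomial.
have cm (c : R) k : (fun r : R => c * r ^+ k.+1) r @[r --> 0^'+] --> (0 : R).
  apply: cvg_within_filter.
  have : c * r ^+ k.+1 @[r --> (0 : R)] --> c * 0 ^+ k.+1.
    by apply: cvgM; [exact: cvg_cst|exact: exprn_continuous].
  by rewrite expr0n mulr0.
split.
- exact: C2fun_on_closure.
- split; first by rewrite expr0n mulr0.
  + by rewrite d1; exact: cm.
  + by rewrite d2; exact: cm.
- by move=> r r0; rewrite d2 !mulr_gt0// exprn_gt0.
rewrite /=.
have -> : (fun x : 'rV[R]_n => K * enorm x ^+ 4) = quartic 0 0 0 0 K.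
  by apply/funext => x; rewrite quartic_pow4.
apply: cvg_within_filter.
pose c := (4 * K) `^ (q - 2) * (4 * K * `|n%:R + p - 2| + 8 * K * `|p - 1|).
have c0 : 0 <= c.
  by rewrite mulr_ge0 ?powR_ge0// addr_ge0// !mulr_ge0// ltW.
have FE x : Fop p q (gradient (quartic 0 0 0 0 K) x)
    (hessian (quartic 0 0 0 0 K) x)
    = Frad n p q (2 * K * dot x x) K (dot x x).
  have E (z v : 'rV[R]_n) := is_derive_quartic 0 0 0 0 K z v.
  have E2 v w : is_derive x w (fun x => dquartic 0 0 0 0 K x v)
      (4 * K * (2 * dot x w * dot x v + dot x x * dot w v)).
    have lin : is_derive x w (fun x : 'rV[R]_n => dot x v) (dot w v).
      by apply: (@is_derive_linear _ _ (fun x : 'rV[R]_n => dot x v)) => s a b;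
        rewrite dotDl dotZl.
    have := is_deriveM (is_deriveZ (4 * K) (is_derive_dist2 0 x w)) lin.
    set df := (X in is_derive _ _ _ X -> _); set f := (X in is_derive _ _ X _ -> _).
    have -> : df = 4 * K * (2 * dot x w * dot x v + dot x x * dot w v).
      by rewrite /df /GRing.scale/= /dist2 !subr0 /GRing.scale/=; ring.
    suff -> : f = (fun x => dquartic 0 0 0 0 K x v) by [].
    apply/funext => z; transitivity (4 * K * dist2 0 z * dot z v) => //.
    by rewrite /dquartic !subr0; ring.
  apply: Fop_radial => //.
    rewrite (gradientE (E x)); apply/rowP => i; rewrite !mxE /dquartic.
    by rewrite !subr0 dot_delta /dist2 !subr0; ring.
  move=> i j; rewrite (hessianE E E2) !dot_delta2 !dot_delta; ring.
apply/cvgr0Pnorm_le => e e0.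
have cd : {for 0, continuous (fun x : 'rV[R]_n => dist2 0 x)}.
  exact/C2fun_continuous/C2fun_dist2.
near=> x; rewrite FE.
have x1 : dot x x <= 1.
  have -> : dot x x = dist2 0 x by rewrite /dist2 subr0.
  near: x; apply: (cvgr_le _ cd); by rewrite /dist2 subr0 dot0r.
have xe : dot x x <= e / (c + 1).
  have -> : dot x x = dist2 0 x by rewrite /dist2 subr0.
  near: x; apply: (cvgr_le _ cd); rewrite /dist2 subr0 dot0r.
  by rewrite divr_gt0// ltr_wpDl.
have s0 := dotxx_ge0 x; set s := dot x x in s0 x1 xe *.
have sq : 0 <= Num.sqrt s <= 1.
  by rewrite sqrtr_ge0 -sqrtr1 ler_wsqrtr.
have h1 : (2 * `|2 * K * s| * Num.sqrt s) `^ (q - 2) <= (4 * K) `^ (q - 2).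
  rewrite ge0_ler_powR ?nnegrE ?mulr_ge0 ?(ltW K0) ?sqrtr_ge0//.
    by rewrite subr_ge0 ltW.
  rewrite ger0_norm ?mulr_ge0 ?(ltW K0)//.
  have -> : 2 * (2 * K * s) * Num.sqrt s = 4 * K * (s * Num.sqrt s) by ring.
  rewrite ler_piMr ?mulr_ge0 ?(ltW K0)// mulr_ile1 ?sqrtr_ge0//.
  by case/andP: sq.
have h2 : `|2 * (2 * K * s) * (n%:R + p - 2) + 8 * K * s * (p - 1)|
    <= (4 * K * `|n%:R + p - 2| + 8 * K * `|p - 1|) * s.
  apply: le_trans (ler_normD _ _) _; rewrite !normrM !normr_nat (ger0_norm s0).
  rewrite (gtr0_norm K0); lra.
rewrite /Frad normrM ger0_norm ?powR_ge0//.
apply: (@le_trans _ _ (c * s)).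
  by rewrite /c -[leRHS]mulrA; apply: ler_pM; rewrite ?powR_ge0 ?normr_ge0.
apply: (@le_trans _ _ (c * (e / (c + 1)))); first by rewrite ler_wpM2l.
rewrite mulrCA ler_piMr ?(ltW e0)// ler_pdivrMr ?ltr_wpDl//; lra.
Unshelve. all: by end_near. Qed.

Lemma classSigma_sqr (C : R) : 0 < C -> classSigma (fun r => C * r ^+ 2).
Proof.
move=> C0; split.
- by move=> r; rewrite sqrrN.
- have /(C2fun_C2_on setT)[] // : C2fun (fun r : R => C * r ^+ 2).
  by apply: C2funM; [exact: C2fun_cst|apply: C2funX; exact: C2fun_id].
- by rewrite expr0n mulr0.
- by rewrite derive1_monomial expr1 mulr0.
- by move=> r r0; rewrite mulr_gt0// exprn_even_gt0.
Qed.

Lemma C2fun_fst (G : 'rV[R]_n -> R) : C2fun G ->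
  C2fun (fun z : 'rV[R]_n * R => G z.1).
Proof.
move=> [D [E [cG GD cD DE cE]]].
have der (f : 'rV[R]_n -> R) (z v : 'rV[R]_n * R) d :
    is_derive z.1 v.1 f d -> is_derive z v (fun z => f z.1) d.
  by move=> [H1 H2]; split.
have cfst (f : 'rV[R]_n -> R) : continuous f ->
    continuous (fun z : 'rV[R]_n * R => f z.1).
  by move=> cf z; apply: continuous_comp; [exact: cvg_fst|exact: cf].
exists (fun v z : 'rV[R]_n * R => D v.1 z.1),
  (fun v w z : 'rV[R]_n * R => E v.1 w.1 z.1).
by split=> *; first [exact: cfst|exact: der].
Qed.

Lemma C2fun_snd (g g1 g2 : R -> R) : (forall s : R, is_derive s 1 g (g1 s)) ->
  (forall s : R, is_derive s 1 g1 (g2 s)) -> continuous g2 ->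
  C2fun (fun z : 'rV[R]_n * R => g z.2).
Proof.
move=> gd g1d cg2; apply: (C2real_comp gd g1d cg2).
by apply: C2fun_linear => // z; exact: cvg_snd.
Qed.

Section Separated.
Variables (Theta : set ('rV[R]_n * R)).
Variables (g g1 g2 : R -> R) (G : 'rV[R]_n -> R).
Hypotheses (gd : forall s : R, is_derive s 1 g (g1 s))
  (g1d : forall s : R, is_derive s 1 g1 (g2 s)) (cg2 : continuous g2)
  (GC : C2fun G).
Local Notation phi := (fun z : 'rV[R]_n * R => g z.2 + G z.1).

Lemma separated_time_derivative z : time_derivative phi z = g1 z.2.
Proof.
rewrite /time_derivative derive1E /=.
have -> : (fun t => g t + G z.1) = g + cst (G z.1) by [].
have /@derive_val -> := is_deriveD (gd z.2) (is_derive_cst (G z.1) z.2 1).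
by rewrite addr0.
Qed.

Lemma derive_addl_cst (c : R) v : 'D_v (fun x => c + G x) = 'D_v G.
Proof.
have [D [E [cG GD _ _ _]]] := GC.
apply/funext => x.
have := is_deriveD (is_derive_cst c x v) (GD v x).
by move=> /@derive_val h; have /@derive_val -> := GD v x; rewrite -[RHS]add0r.
Qed.

Lemma separated_gradient z : spatial_gradient phi z = gradient G z.1.
Proof.
apply/rowP => i; rewrite !mxE.
exact: (congr1 (fun f => f z.1) (derive_addl_cst (g z.2) (delta_mx ord0 i))).
Qed.

Lemma separated_hessian z : spatial_hessian phi z = hessian G z.1.
Proof.
apply/matrixP => i j; rewrite [LHS]mxE [RHS]mxE.
exact: (congr1 (fun f => 'D_(delta_mx ord0 i) f z.1)
  (derive_addl_cst (g z.2) (delta_mx ord0 j))).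
Qed.

(** The time part has a quadratic Taylor remainder at every point, which a member of [classSigma]
    absorbs. Only the space part needs fourth-order flatness, and only at its critical points. *)
Lemma separated_admissible :
  (forall z1, Theta z1 -> gradient G z1.1 = 0 ->
    exists K d, [/\ 0 < K, 0 < d & forall x, (exists t, Theta (x, t)) ->
      enorm (x - z1.1) < d -> `|G x - G z1.1| <= K * enorm (x - z1.1) ^+ 4]) ->
  admissible p q Theta phi.
Proof.
move=> HG; split.
  apply: C2fun_C2_on; apply: C2funD; first exact: C2fun_snd gd g1d cg2.
  exact: C2fun_fst.
move=> z1 Tz1; rewrite separated_gradient => /(HG _ Tz1)[K [d [K0 d0 H]]].
have gdn : \forall s \near z1.2, is_derive (s : R) 1 g (g1 s).
  by apply/nbhs_ballP; exists 1 => //= s _; exact: gd.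
have [C [d' [C0 d'0 H']]] := taylor1_quadratic gdn (g1d z1.2).
exists (Num.min d d'), (fun r => K * r ^+ 4), (fun r => C * r ^+ 2); split.
- by rewrite lt_min d0.
- exact: classF_pow4.
- exact: classSigma_sqr.
move=> z Tz; rewrite !lt_min => /andP[zd _] /andP[_ zd'].
rewrite separated_time_derivative.
have -> : g z.2 + G z.1 - (g z1.2 + G z1.1) - g1 z1.2 * (z.2 - z1.2)
  = (G z.1 - G z1.1) + (g z.2 - g z1.2 - g1 z1.2 * (z.2 - z1.2)) by ring.
apply: le_trans (ler_normD _ _) _; apply: lerD; last exact: H'.
by apply: H => //; exists z.2; rewrite -surjective_pairing.
Qed.

End Separated.
End TestClasses.

(** * A C^2 function of time above a given sequence *)

Section Majorant.
Context {R : realType} (T : R) (m : nat -> R).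
Hypothesis m_ge0 : forall k, 0 <= m k.

Let psum c j N t : R :=
  \sum_(0 <= k < N) c * m k * tpow j.+1 (t - (T + k%:R)).

Let N t : nat := (Num.truncn `|t - T|).+1.

Let lsum c j t : R := psum c j (N t) t.

Let psum_stable c j N' t : `|t - T| < N'%:R -> psum c j N' t = lsum c j t.
Proof.
move=> tN'; have tN : `|t - T| < (N t)%:R by exact: truncnS_gt.
have H N1 N2 : (N1 <= N2)%N -> `|t - T| < N1%:R -> psum c j N2 t = psum c j N1 t.
  move=> N12 tN1; rewrite /psum (big_cat_nat (n := N1))//=.
  rewrite [X in _ + X]big_nat_cond [X in _ + X]big1 ?addr0// => k /andP[/andP[N1k _] _].
  rewrite tpow_le ?mulr0//.
  have := le_trans (ltW tN1) (_ : N1%:R <= k%:R); rewrite ler_nat => /(_ N1k).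
  have := ler_norm (t - T); lra.
have [h|h] := leqP N' (N t); first by rewrite /lsum (H N').
by rewrite (H (N t)) // ltnW.
Qed.

(** The number of terms [N t] jumps with t, but terms not yet started are zero: near each t one
    fixed partial sum represents the function, and it can be differentiated term by term. *)
Let lsum_near c j (t : R) : \forall s \near t,
  psum c j (Num.truncn `|t - T|).+2 s = lsum c j s.
Proof.
apply/nbhs_ballP; exists 1 => //= s; rewrite /ball/= => st.
apply: psum_stable; rewrite -addn1 natrD.
have : `|t - T| < (Num.truncn `|t - T|).+1%:R by exact: truncnS_gt.
have : `|s - T| <= `|t - T| + `|t - s|.
  rewrite (distrC t s); have := ler_normD (t - T) (s - t).
  by have -> : t - T + (s - t) = s - T by ring.
lra.
Qed.

Let is_derive_psum c j N' (t : R) : is_derive t 1 (psum c j.+1 N')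
  (psum (c * j.+2%:R) j N' t).
Proof.
elim: N' => [|N' ih].
  have -> : psum c j.+1 0 = cst 0 by apply/funext => s; rewrite /psum big_nil.
  have -> : psum (c * j.+2%:R) j 0 t = 0 by rewrite /psum big_nil.
  exact: is_derive_cst.
have -> : psum c j.+1 N'.+1 = psum c j.+1 N'
    + (c * m N') \*: (fun s => tpow j.+2 (s - (T + N'%:R))).
  by apply/funext => s; rewrite /psum big_nat_recr.
have -> : psum (c * j.+2%:R) j N'.+1 t = psum (c * j.+2%:R) j N' t
    + (c * m N') *: (j.+2%:R * tpow j.+1 (t - (T + N'%:R))).
  by rewrite /psum big_nat_recr//= /GRing.scale/=; congr (_ + _); ring.
by apply: is_deriveD; apply: is_deriveZ; exact: is_derive_tpow_shift.
Qed.

Let is_derive_lsum c j (t : R) : is_derive t 1 (lsum c j.+1) (lsum (c * j.+2%:R) j t).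
Proof.
rewrite -(nbhs_singleton (lsum_near (c * j.+2%:R) j t)).
exact: near_eq_is_derive (lsum_near c j.+1 t) (is_derive_psum _ _ _ _).
Qed.

Let continuous_lsum c j : continuous (lsum c j).
Proof.
move=> t.
have cp N' : {for t, continuous (psum c j N')}.
  elim: N' => [|N' ih].
    have -> : psum c j 0 = cst 0 by apply/funext => s; rewrite /psum big_nil.
    exact: cvg_cst.
  have -> : psum c j N'.+1 = psum c j N'
      + (fun s => c * m N' * tpow j.+1 (s - (T + N'%:R))).
    by apply/funext => s; rewrite /psum big_nat_recr.
  apply: cvgD => //; apply: cvgM; first exact: cvg_cst.
  apply: (@continuous_comp _ _ _ (fun s : R => s - (T + N'%:R)) (tpow j.+1)).
    by apply: cvgD; [exact: cvg_id|exact: cvg_cst].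
  exact: continuous_tpow.
rewrite /continuous_at -(nbhs_singleton (lsum_near c j t)).
exact: cvg_trans (near_eq_cvg (lsum_near c j t)) (cp _).
Qed.

(** Test functions must touch in all of the infinite cylinder, while the solution is bounded only on
    bounded time intervals. The locally finite sum of m_k (t - T - k)_+^3 is C^2, and its k-th term
    exceeds m_k as soon as t >= T + k + 1. *)
Lemma C2_majorant : exists h h1 h2 : R -> R,
  [/\ forall s : R, is_derive s 1 h (h1 s), forall s : R, is_derive s 1 h1 (h2 s),
      continuous h2,
      (forall s, 0 <= h s) /\ (forall s, s <= T -> h s = 0) &
      forall k s, T + k.+1%:R <= s -> m k <= h s].
Proof.
exists (lsum 1 2), (lsum (1 * 3%:R) 1), (lsum (1 * 3%:R * 2%:R) 0).
have term_ge0 s k : 0 <= 1 * m k * tpow 3 (s - (T + k%:R)).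
  by rewrite mul1r mulr_ge0// /tpow exprn_ge0// le_max lexx orbT.
split.
- by move=> s; exact: is_derive_lsum.
- by move=> s; exact: is_derive_lsum.
- exact: continuous_lsum.
- split=> s; first by apply: sumr_ge0 => k _; exact: term_ge0.
  move=> sT; rewrite /lsum /psum big1// => k _; rewrite tpow_le ?mulr0//.
  have := ler0n R k; lra.
- move=> k s ks.
  have kN : (k < N s)%N.
    rewrite -(ltr_nat R); apply: le_lt_trans (truncnS_gt `|s - T|).
    have := ler_norm (s - T); move: ks; rewrite -natr1; lra.
  rewrite /lsum /psum (bigD1_seq k) ?mem_index_iota ?iota_uniq//.
  apply: ler_wpDr; first by apply: sumr_ge0 => i _; exact: term_ge0.
  rewrite mul1r ler_peMr// tpow_ge; last by move: ks; rewrite -natr1; lra.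
  by apply: exprn_ege1; move: ks; rewrite -natr1; lra.
Qed.

End Majorant.

Section Compactness.
Context {R : realType} {n : nat}.
Implicit Types (c x : 'rV[R]_n).

Definition cball c (r : R) : set 'rV[R]_n := [set x | enorm (x - c) <= r].

Lemma continuous_enormB c : continuous (fun x : 'rV[R]_n => enorm (x - c)).
Proof.
have -> : (fun x : 'rV[R]_n => enorm (x - c)) = Num.sqrt \o dist2 c.
  by apply/funext => x; rewrite enormE.
move=> x; apply: continuous_comp; last exact: sqrt_continuous.
exact/C2fun_continuous/C2fun_dist2.
Qed.

Lemma compact_cball c r : compact (cball c r).
Proof.
apply: bounded_closed_compact.
  exists (r + `|c|); split; first exact: num_real.
  move=> M rM x xr; apply: (@le_trans _ _ (r + `|c|)); last exact: ltW.
  rewrite -[x](subrK c); apply: le_trans (ler_normD _ _) _.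
  rewrite lerD2r; exact: le_trans (normv_le_enorm _) xr.
apply: (@preimage_closed _ _ (fun x => enorm (x - c)) [set s | s <= r]);
  last exact: closed_le.
move=> x _; exact: continuous_enormB.
Qed.

Lemma exists_max (T : topologicalType) (A : set T) (f : T -> R) :
  compact A -> A !=set0 -> {within A, continuous f} ->
  exists2 a, A a & forall b, A b -> f b <= f a.
Proof.
move=> cA A0 cf; have [a aA am] := compact_EVT_max A0 cA cf.
by exists a; [exact: set_mem|move=> b /mem_set; exact: am].
Qed.

Lemma exists_enorm_ball c (P : 'rV[R]_n -> Prop) : (\forall x \near c, P x) ->
  exists2 d, 0 < d & forall x, enorm (x - c) < d -> P x.
Proof.
move=> /nbhs_ballP[d /= d0 H]; exists d => // x xd; apply: H.
by rewrite -ball_normE /= -normrN opprB; apply: le_lt_trans xd; exact: normv_le_enorm.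
Qed.

End Compactness.

(** * Lipschitz bound and critical points of the quartic *)

Section QuarticBounds.
Context {R : realType} {n : nat}.
Implicit Types (x y v w : 'rV[R]_n).

Lemma dist2_sub c x x1 :
  dist2 c x - dist2 c x1 = dot (x - x1) (x + x1 - 2 *: c).
Proof.
by rewrite /dist2 !dotE (dotC x1 x) !(dotC c); ring.
Qed.

Lemma unit_ball_le x : unit_ball x -> enorm x <= 1.
Proof. exact: ltW. Qed.

Lemma dist2_lipschitz c x x1 : unit_ball x -> unit_ball x1 ->
  `|dist2 c x - dist2 c x1| <= (2 + 2 * enorm c) * enorm (x - x1).
Proof.
move=> bx bx1; rewrite dist2_sub; apply: le_trans (dot_le _ _) _.
rewrite mulrC ler_wpM2r ?enorm_ge0//.
apply: le_trans (ler_enormD _ _) _; rewrite enormN enormZ normr_nat lerD2r.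
apply: le_trans (ler_enormD _ _) _.
have := unit_ball_le bx; have := unit_ball_le bx1; lra.
Qed.

Lemma dist2_bound c x : unit_ball x -> dist2 c x <= (1 + enorm c) ^+ 2.
Proof.
move=> bx; rewrite dist2E lerXn2r ?nnegrE ?addr_ge0 ?enorm_ge0//.
apply: le_trans (ler_enormD _ _) _; rewrite enormN lerD2r; exact: unit_ball_le.
Qed.

Lemma dist2_ge0 c x : 0 <= dist2 c x.
Proof. exact: dotxx_ge0. Qed.

(** Converts the fourth-power estimate of [flatten_sub_le], which is in terms of values, into one in
    terms of the distance to the critical point. *)
Lemma quartic_lipschitz y x0 k1 k2 (K : R) : exists2 L, 0 < L &
  forall x x1, unit_ball x -> unit_ball x1 ->
  `|quartic y x0 k1 k2 K x - quartic y x0 k1 k2 K x1| <= L * enorm (x - x1).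
Proof.
pose b := (1 + enorm y) ^+ 2; pose b0 := (1 + enorm x0) ^+ 2.
pose l := 2 + 2 * enorm y; pose l0 := 2 + 2 * enorm x0.
have l_ge0 : 0 <= l by rewrite /l; have := enorm_ge0 y; lra.
have l0_ge0 : 0 <= l0 by rewrite /l0; have := enorm_ge0 x0; lra.
have bge0 : 0 <= b by exact: sqr_ge0.
have b0ge0 : 0 <= b0 by exact: sqr_ge0.
exists (`|k1| * l + `|k2| * (2 * (b + dist2 y x0)) * l + `|K| * (2 * b0) * l0 + 1).
  have bc : 0 <= b + dist2 y x0 by rewrite addr_ge0 ?dist2_ge0.
  have kl : 0 <= `|k1| * l by exact: mulr_ge0.
  have kb : 0 <= `|k2| * (2 * (b + dist2 y x0)) * l.
    by apply: mulr_ge0 => //; apply: mulr_ge0 => //; apply: mulr_ge0.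
  have Kb : 0 <= `|K| * (2 * b0) * l0.
    by apply: mulr_ge0 => //; apply: mulr_ge0 => //; apply: mulr_ge0.
  lra.
move=> x x1 bx bx1; rewrite /quartic.
have e0 := enorm_ge0 (x - x1); set E := enorm (x - x1) in e0 *.
have h1 := dist2_lipschitz y bx bx1.
have h2 := dist2_lipschitz x0 bx bx1.
rewrite -/E -/l -/l0 in h1 h2.
have := dist2_bound y bx; have := dist2_bound y bx1.
have := dist2_bound x0 bx; have := dist2_bound x0 bx1.
have := dist2_ge0 y x; have := dist2_ge0 y x1; have := dist2_ge0 y x0.
have := dist2_ge0 x0 x; have := dist2_ge0 x0 x1.
rewrite -/b -/b0.
set d := dist2 y x; set d1 := dist2 y x1; set c := dist2 y x0.
set f := dist2 x0 x; set f1 := dist2 x0 x1.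
move=> f1g fg cg d1g dg f1b fb d1b db.
have -> : k1 * (d - c) + k2 * (d - c) ^+ 2 + K * f ^+ 2 -
  (k1 * (d1 - c) + k2 * (d1 - c) ^+ 2 + K * f1 ^+ 2)
  = k1 * (d - d1) + k2 * (d + d1 - 2 * c) * (d - d1) + K * (f + f1) * (f - f1).
  by ring.
have a1 : `|k1 * (d - d1)| <= `|k1| * l * E.
  by rewrite normrM -mulrA ler_wpM2l.
have a2 : `|k2 * (d + d1 - 2 * c) * (d - d1)| <= `|k2| * (2 * (b + c)) * l * E.
  have A : `|d + d1 - 2 * c| <= 2 * (b + c) by rewrite ler_norml; lra.
  have := ler_wpM2l (normr_ge0 k2) (ler_pM (normr_ge0 _) (normr_ge0 _) A h1).
  by rewrite !normrM !mulrA.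
have a3 : `|K * (f + f1) * (f - f1)| <= `|K| * (2 * b0) * l0 * E.
  have A : `|f + f1| <= 2 * b0 by rewrite ler_norml; lra.
  have := ler_wpM2l (normr_ge0 K) (ler_pM (normr_ge0 _) (normr_ge0 _) A h2).
  by rewrite !normrM !mulrA.
apply: le_trans (ler_normD _ _) _; have := ler_normD (k1 * (d - d1))
  (k2 * (d + d1 - 2 * c) * (d - d1)); lra.
Qed.

Lemma dist2_CS y x0 x :
  ((dist2 y x - dist2 y x0) - dist2 x0 x) ^+ 2 <= 4 * dist2 y x0 * dist2 x0 x.
Proof.
have -> : dist2 y x - dist2 y x0 - dist2 x0 x = 2 * dot (x0 - y) (x - x0).
  by rewrite /dist2 !dotE (dotC x0 x) !(dotC y); ring.
rewrite exprMn -natrX -mulrA ler_wpM2l//; exact: dot_CS.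
Qed.

(** The vanishing gradient means al (x - y) = - 4 K s (x - x0). Pairing with x - x0 gives the first
    identity, comparing squared norms the second; with [dist2_CS] these are the hypotheses of
    [critical_value_neg]. *)
Lemma quartic_critical y x0 k1 k2 (K : R) (x : 'rV[R]_n) :
  (forall v, dquartic y x0 k1 k2 K x v = 0) ->
  let s := dist2 x0 x in let sg := dist2 y x - dist2 y x0 in
  (2 * k1 + 4 * k2 * sg) * (sg + s) / 2 = - (4 * K * s ^+ 2) /\
  (2 * k1 + 4 * k2 * sg) ^+ 2 * (dist2 y x0 + sg) = 16 * K ^+ 2 * s ^+ 3.
Proof.
move=> D0 s sg; set al := 2 * k1 + 4 * k2 * sg.
have D v : al * dot (x - y) v = - (4 * K * s) * dot (x - x0) v.
  have := D0 v; rewrite /dquartic -/sg -/s /al => h.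
  by apply/eqP; rewrite -subr_eq0 -h; apply/eqP; ring.
split.
  have := D (x - x0); rewrite -/(dist2 x0 x) -/s.
  have -> : dot (x - y) (x - x0) = (sg + s) / 2.
    by rewrite /sg /s /dist2 !dotE (dotC x0 x) !(dotC y); field.
  by rewrite mulrA => ->; ring.
have -> : dist2 y x0 + sg = dot (x - y) (x - y) by rewrite /sg /dist2; ring.
rewrite expr2 -mulrA D mulrCA (dotC (x - x0)) D -/(dist2 x0 x) -/s; ring.
Qed.

End QuarticBounds.

(** * One-sided form of the viscosity inequalities *)

Section Contact.
Context {R : realType} {n : nat} (p q : R).
Hypothesis hq : 2 < q.
Implicit Types (x y v w : 'rV[R]_n).

Definition cyl : set ('rV[R]_n * R) := [set z | unit_ball z.1 /\ 0 < z.2].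

(* Supersolution ([e = -1]) and subsolution ([e = 1]) inequalities at once. *)
Definition sided (e : R) (u : 'rV[R]_n * R -> R) : Prop :=
  forall (phi : 'rV[R]_n * R -> R) z0, cyl z0 -> admissible p q cyl phi ->
    u z0 = phi z0 -> (forall z, cyl z -> z <> z0 -> e * u z < e * phi z) ->
    (spatial_gradient phi z0 <> 0 ->
       e * (time_derivative phi z0
            - Fop p q (spatial_gradient phi z0) (spatial_hessian phi z0)) <= 0)
    /\ (spatial_gradient phi z0 = 0 -> e * time_derivative phi z0 <= 0).

Lemma viscosity_sided u e : viscosity_solution p q cyl u ->
  e = 1 \/ e = -1 -> sided e u.
Proof.
move=> [_ [_ _ _ Hsup] [_ _ _ Hsub]] [->|->] phi z0 cz0 adm uphi lt.
  rewrite !mul1r; apply: Hsub => //; split=> [/=|z cz zz0]; first by rewrite uphi.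
  by have := lt _ cz zz0; rewrite !mul1r lte_fin.
rewrite !mulN1r !oppr_le0; apply: Hsup => //.
split=> [/=|z cz zz0]; first by rewrite uphi.
by have := lt _ cz zz0; rewrite !mulN1r ltrN2 lte_fin.
Qed.

Definition sided_stationary (e : R) (w : 'rV[R]_n -> R) : Prop :=
  forall (phi : 'rV[R]_n -> R) x0, unit_ball x0 -> C2_on unit_ball phi ->
    w x0 = phi x0 -> (forall x, unit_ball x -> x <> x0 -> e * w x < e * phi x) ->
    0 <= e * (Fop p q (gradient phi x0) (hessian phi x0) + (q - 2)^-1 * w x0).

Lemma stationary_sided (w : 'rV[R]_n -> R) e : stationary_viscosity_solution p q unit_ball w ->
  e = 1 \/ e = -1 -> sided_stationary e w.
Proof.
move=> [_ Hsup Hsub] [->|->] phi x0 bx0 phiC wphi lt.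
  rewrite mul1r; apply: Hsub => //; split=> [/=|x bx xx0]; first by rewrite wphi.
  by have := lt _ bx xx0; rewrite !mul1r lte_fin.
rewrite mulN1r oppr_ge0; apply: Hsup => //.
split=> [/=|x bx xx0]; first by rewrite wphi.
by have := lt _ bx xx0; rewrite !mulN1r ltrN2 lte_fin.
Qed.

Definition locally_bounded (u : 'rV[R]_n * R -> R) : Prop :=
  forall T, exists M, forall x t, unit_ball x -> 0 < t <= T -> `|u (x, t)| <= M.

(** The majorant vanishes up to time T, so it does not disturb the jet of a test function at an
    earlier contact. *)
Lemma locally_bounded_majorant u (T : R) : locally_bounded u -> exists (h h1 h2 : R -> R) (M : R),
  [/\ forall s : R, is_derive s 1 h (h1 s), forall s : R, is_derive s 1 h1 (h2 s),
      continuous h2,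
      [/\ forall s, 0 <= h s, forall s, s <= T -> h s = 0 &
          forall s, s < T -> h1 s = 0] &
      0 < M /\ forall x t, unit_ball x -> 0 < t -> `|u (x, t)| <= M + h t].
Proof.
move=> ub; have /choice[m mP] : forall k : nat, exists M, 0 <= M /\
    forall x t, unit_ball x -> 0 < t <= T + k%:R -> `|u (x, t)| <= M.
  move=> k; have [M HM] := ub (T + k%:R); exists (Num.max M 0); split.
    by rewrite le_max lexx orbT.
  by move=> x t bx tT; rewrite le_max HM.
(* The shift by 2 pays for rounding: for T + 1 + k <= t < T + k + 2 the solution is bounded by
   [m k.+2], and h has already reached this value at time T + k + 1. *)
have [h [h1 [h2 [d1 d2 c2 [h0 hT] hm]]]] :=
  C2_majorant T (fun k => (mP k.+2).1).
exists h, h1, h2, (m 1%N + 1); split=> //.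
  split=> // s sT; rewrite -(@derive_val _ _ _ _ _ _ _ (d1 s)).
  rewrite (@near_eq_derive _ _ _ _ (cst 0)) ?derive_cst//.
  by near=> t; rewrite hT//; apply/ltW; near: t; exact: lt_nbhsl.
split; first by rewrite ltr_wpDl// (mP _).1.
move=> x t bx t0; have [tT|tT] := leP t (T + 1).
  have := (mP 1%N).2 x t bx; rewrite t0 tT => /(_ isT); have := h0 t; lra.
pose k := Num.truncn (t - T - 1).
have t10 : 0 <= t - T - 1 by lra.
have /andP[k1 k2] : k%:R <= t - T - 1 < k.+1%:R.
  exact: truncn_itv.
have hk : m k.+2 <= h t by apply: hm; rewrite -natr1; lra.
have := (mP k.+2).2 x t bx; rewrite t0 /= => /(_ _)H.
have : `|u (x, t)| <= m k.+2 by apply: H; move: k2; rewrite -!natr1; lra.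
have := (mP 1%N).1; lra.
Unshelve. all: by end_near. Qed.

End Contact.

(** * Contact inequalities *)

Section ContactInequalities.
Context {R : realType} {n : nat} (p q : R).
Hypothesis hq : 2 < q.
Implicit Types (x y v w : 'rV[R]_n).

Lemma sign_mulK (e a : R) : e ^+ 2 = 1 -> e * (e * a) = a.
Proof. by move=> e2; rewrite mulrA -expr2 e2 mul1r. Qed.

Section QuarticTest.
Variables (y x0 : 'rV[R]_n) (k1 k2 K ee e c : R).
Hypothesis ee0 : 0 < ee.
Local Notation P := (quartic y x0 k1 k2 K).
Local Notation DP := (dquartic y x0 k1 k2 K).

Let dG x v := e * (spline1 (P x / ee + 4) * DP x v).

Lemma C2fun_flat_quartic : C2fun (fun x => e * flatten ee (P x)).
Proof.
apply: C2funM; first exact: C2fun_cst.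
apply: C2real_comp (is_derive_flatten ee0) (is_derive_flatten1 ee)
  (@continuous_flatten2 _ ee) _.
exact: C2fun_quartic.
Qed.

Lemma is_derive_flat_quartic x v :
  is_derive x v (fun x => e * flatten ee (P x)) (dG x v).
Proof.
exact: is_deriveZ (is_derive_comp1 (is_derive_quartic y x0 k1 k2 K x v)
  (is_derive_flatten ee0 (P x))).
Qed.

Lemma is_derive_dflat_quartic v w : is_derive x0 w (dG^~ v)
  (e * (2 * k1 * dot w v + 8 * k2 * dot (x0 - y) w * dot (x0 - y) v)).
Proof.
have h1 := is_derive_comp1 (is_derive_quartic y x0 k1 k2 K x0 w)
  (is_derive_flatten1 ee (P x0)).
have := is_deriveZ e (is_deriveM h1 (is_derive_dquartic y x0 k1 k2 K v w)).
set df := (X in is_derive _ _ _ X -> _).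
suff -> : df = e * (2 * k1 * dot w v
    + 8 * k2 * dot (x0 - y) w * dot (x0 - y) v) by [].
(* The quartic vanishes at [x0], so the argument of the spline is 4, inside the range where
   [flatten] is the identity: the jet at [x0] is unchanged. *)
rewrite /df /= quartic0 mul0r add0r spline1_id ?spline2_id; [|lra..].
by rewrite /GRing.scale/=; ring.
Qed.

Lemma gradient_flat_quartic0 : gradient (fun x => e * flatten ee (P x)) x0
  = (2 * (e * k1)) *: (x0 - y).
Proof.
rewrite (gradientE (is_derive_flat_quartic x0)); apply/rowP => i; rewrite !mxE.
rewrite /dG quartic0 mul0r add0r spline1_id; last lra.
rewrite /dquartic dot_delta !mxE /dist2 !subrr dot0r; ring.
Qed.

Lemma Fop_flat_quartic0 :
  Fop p q (gradient (fun x => e * flatten ee (P x)) x0)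
    (hessian (fun x => e * flatten ee (P x)) x0)
  = Frad n p q (e * k1) (e * k2) (dist2 y x0).
Proof.
apply: Fop_radial => //; first exact: gradient_flat_quartic0.
move=> i j; rewrite (hessianE is_derive_flat_quartic is_derive_dflat_quartic).
by rewrite dot_delta2 !dot_delta; ring.
Qed.

(** By the chain rule the gradient is that of the quartic times a value of [spline1], and the latter
    vanishes only in the constant range. *)
Lemma flat_quartic_critical x : e != 0 ->
  gradient (fun x => e * flatten ee (P x)) x = 0 ->
  (forall v, DP x v = 0) \/ P x <= - (4 * ee).
Proof.
move=> e0; rewrite (gradientE (is_derive_flat_quartic x)) => /rowP G0.
have [s0|s0] := eqVneq (spline1 (P x / ee + 4)) 0.
  by right; apply: flatten_deriv_eq0.
left=> v; pose w := (2 * (k1 + 2 * k2 * (dist2 y x - dist2 y x0))) *: (x - y)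
  + (4 * K * dist2 x0 x) *: (x - x0).
have DPw u : DP x u = dot w u by rewrite /dquartic /w !dotE; ring.
suff w0 : w = 0 by rewrite DPw w0 dotC dot0r.
apply/rowP => i; rewrite -(dot_delta w) -DPw mxE.
have := G0 i; rewrite !mxE /dG => /eqP.
by rewrite mulf_eq0 (negbTE e0) mulf_eq0 (negbTE s0) => /eqP.
Qed.

End QuarticTest.

Variable e : R.
Hypothesis e2 : e ^+ 2 = 1.

Let e_neq0 : e != 0.
Proof. by apply: contra_eq_neq e2 => ->; rewrite expr0n eq_sym oner_eq0. Qed.

Let norme : `|e| = 1.
Proof. by apply/eqP; rewrite -(@eqrXn2 _ 2)// -normrX e2 normr1 expr1n. Qed.

Lemma time_majorant (u : 'rV[R]_n * R -> R) x0 (t0 b C d : R) :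
  locally_bounded u -> unit_ball x0 -> 0 < t0 -> 0 < d ->
  exists (g g1 g2 : R -> R) (M : R),
  [/\ forall s : R, is_derive s 1 g (g1 s), forall s : R, is_derive s 1 g1 (g2 s),
     continuous g2, [/\ g t0 = 0, g1 t0 = b & 0 < M] &
     forall x (t : R), unit_ball x -> 0 < t ->
     [/\ `|t - t0| < d -> b * (t - t0) + (C + 1) * (t - t0) ^+ 2 <= g t,
        e * (u (x, t) - u (x0, t0)) <= g t + M &
        d <= `|t - t0| -> e * (u (x, t) - u (x0, t0)) + 2 <= g t]].
Proof.
move=> ub bx0 t00 d0.
have [h [h1 [h2 [M [hd h1d ch2 [h_ge0 hT h1T] [M0 uM]]]]]] :=
  locally_bounded_majorant (t0 + 1) ub.
(* The first entry leaves a margin of (t - t0)^2 for strictness, the second keeps the parabola above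
   -1, the third makes it exceed the oscillation 2 M of u, with 2 to spare, once |t - t0| >= d. *)
pose C1 := Num.max (C + 1) (Num.max (b ^+ 2) ((`|b| + (2 * M + 2) / d) / d)).
have C1C : C + 1 <= C1 by rewrite le_max lexx.
have C1b : b ^+ 2 <= C1 by rewrite !le_max lexx !orbT.
have C1d : `|b| + (2 * M + 2) / d <= C1 * d.
  by rewrite -ler_pdivrMr// !le_max lexx !orbT.
pose g t := b * (t - t0) + C1 * (t - t0) ^+ 2 + h t.
pose g1 t := b + 2 * C1 * (t - t0) + h1 t.
have dt (t a : R) : is_derive t 1 (fun t : R => t - a) 1.
  have := is_deriveD (is_derive_id t (1 : R)) (is_derive_cst (- a) t 1).
  by rewrite addr0.
exists g, g1, (fun t => 2 * C1 + h2 t), (2 * M + 1); split.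
- move=> t; have := is_deriveD (is_deriveD (is_deriveZ b (dt t t0))
    (is_deriveZ C1 (is_deriveX 2 (dt t t0)))) (hd t).
  set df := (X in is_derive _ _ _ X -> _).
  suff -> : df = g1 t by [].
  by rewrite /df /g1 /GRing.scale/= expr1; ring.
- move=> t; have := is_deriveD (is_deriveD (is_derive_cst b t 1)
    (is_deriveZ (2 * C1) (dt t t0))) (h1d t).
  set df := (X in is_derive _ _ _ X -> _).
  suff -> : df = 2 * C1 + h2 t by [].
  by rewrite /df /GRing.scale/=; ring.
- by move=> t; apply: cvgD; [exact: cvg_cst|exact: ch2].
- rewrite /g /g1 subrr expr0n/= hT ?h1T; [|lra..].
  by rewrite !mulr0 !addr0; split=> //; lra.
move=> x t bx t_gt0.
have tpar : -1 <= b * (t - t0) + C1 * (t - t0) ^+ 2.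
  have : (b * (t - t0)) ^+ 2 <= C1 * (t - t0) ^+ 2.
    by rewrite exprMn ler_wpM2r ?sqr_ge0.
  have := sqr_ge0 (b * (t - t0) + 1 / 2); rewrite (sqrrD (b * (t - t0))); lra.
have uabs : e * (u (x, t) - u (x0, t0)) <= 2 * M + h t.
  have h0 : h t0 = 0 by apply: hT; lra.
  have := uM _ _ bx t_gt0; have := uM _ _ bx0 t00.
  have := ler_norm (e * (u (x, t) - u (x0, t0))).
  rewrite normrM norme mul1r h0; have := ler_normB (u (x, t)) (u (x0, t0)).
  lra.
have tge0 := sqr_ge0 (t - t0).
split=> [_||td].
- have := ler_wpM2r tge0 C1C; have := h_ge0 t; rewrite /g; lra.
- by rewrite /g; lra.
have h3 : - (`|b| * `|t - t0|) <= b * (t - t0).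
  by rewrite lerNl -normrM -normrN ler_norm.
have h4 : (t - t0) ^+ 2 = `|t - t0| * `|t - t0|.
  by rewrite -expr2 real_normK ?num_real.
have C10 : 0 <= C1 by apply: le_trans C1b; exact: sqr_ge0.
have h5 : C1 * d <= C1 * `|t - t0| by rewrite ler_wpM2l.
have h6 : (2 * M + 2) / d <= C1 * `|t - t0| - `|b| by lra.
have h7 : 0 <= (2 * M + 2) / d by rewrite divr_ge0 ?(ltW d0)//; lra.
have := ler_pM (ltW d0) h7 td h6.
rewrite mulrCA divff ?gt_eqF// mulr1 /g h4; lra.
Qed.

(** Passage from a local contact to the equation. The test function is f(t) + e flatten(P): a large
    K lifts P above the oscillation of u outside the d-ball, and also pushes the critical values of
    P below -4 [e1]. Flattening then makes the function constant there, up to the fourth order that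
    admissibility permits. *)
Lemma sided_contact (u : 'rV[R]_n * R -> R) x0 y (t0 b C k1 k2 d : R) :
  sided p q e u -> locally_bounded u ->
  unit_ball x0 -> 0 < t0 -> x0 != y -> k1 != 0 -> 0 < d ->
  (forall x (t : R), unit_ball x -> 0 < t -> enorm (x - x0) < d ->
     `|t - t0| < d ->
     e * (u (x, t) - u (x0, t0)) <= b * (t - t0) + C * (t - t0) ^+ 2
       + k1 * (dist2 y x - dist2 y x0) + k2 * (dist2 y x - dist2 y x0) ^+ 2) ->
  b <= Frad n p q k1 k2 (dist2 y x0).
Proof.
move=> usol ub bx0 t00 x0y k10 d0 H.
have [g [g1 [g2 [M [gd g1d cg2 [gt0 g1t0 M0] gM]]]]] :=
  time_majorant b C ub bx0 t00 d0.
have z00 : 0 < dist2 y x0 by rewrite /dist2 dotxx_gt0 subr_eq0.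
(* [ltr0Sn R 3] fixes S = 4, a bound for |x - x0|^2 in the unit ball. *)
have [K0 HK] := critical_value_neg k2 z00 k10 (ltr0Sn R 3).
pose B0 := (1 + enorm y) ^+ 2.
pose B := `|k1| * B0 + `|k2| * B0 ^+ 2.
have B00 : 0 <= B0 by exact: sqr_ge0.
have B_ge0 : 0 <= B by rewrite addr_ge0// mulr_ge0// sqr_ge0.
pose K := Num.max K0 ((B + M + 1) / d ^+ 4).
have KK0 : K0 <= K by rewrite le_max lexx.
have Kd : B + M + 1 <= K * d ^+ 4.
  by rewrite -ler_pdivrMr ?exprn_gt0// le_max lexx orbT.
have Kpos : 0 < K by rewrite lt_max divr_gt0 ?exprn_gt0 ?orbT//; lra.
have [e1 e10 He1] := HK K KK0.
(* At most [e1], so that all critical values fall in the constant range; at most 2/5, so that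
   flattening costs no more than 1. *)
pose ee := Num.min e1 (2 / 5).
have ee0 : 0 < ee by rewrite lt_min e10; lra.
have ee1 : ee <= e1 by rewrite ge_min lexx.
have ee2 : ee <= 2 / 5 by rewrite ge_min lexx orbT.
pose P := quartic y x0 k1 k2 K.
pose G x := e * flatten ee (P x).
pose f t := u (x0, t0) + e * g t.
have fd (t : R) : is_derive t 1 f (e * g1 t).
  have := is_deriveD (is_derive_cst (u (x0, t0)) t 1) (is_deriveZ e (gd t)).
  by rewrite add0r.
have f1d (t : R) : is_derive t 1 (fun t => e * g1 t) (e * g2 t).
  exact: is_deriveZ.
have cf2 : continuous (fun t => e * g2 t).
  by move=> t; apply: cvgM; [exact: cvg_cst|exact: cg2].
have GC : C2fun G by exact: C2fun_flat_quartic.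
pose phi := (fun z : 'rV[R]_n * R => f z.2 + G z.1).
have adm : admissible p q cyl phi.
  apply: (@separated_admissible _ _ p q hq cyl f _ _ G fd f1d cf2 GC).
  move=> -[x1 t1] [/= bx1 _] G0.
  have Px1 : P x1 <= - (4 * ee).
    have [D0|//] := flat_quartic_critical ee0 e_neq0 G0.
    have [eA eB] := quartic_critical D0.
    apply: (@le_trans _ _ (- (4 * e1))); last by rewrite lerN2; lra.
    apply: He1 eA eB; last exact: dist2_CS.
    rewrite dist2_ge0/=; apply: le_trans (dist2_bound _ bx1) _.
    have -> : (4 : R) = 2 ^+ 2 by rewrite -natrX.
    rewrite lerXn2r ?nnegrE ?addr_ge0 ?enorm_ge0//.
    by have := unit_ball_le bx0; lra.
  have [L L0 PL] := quartic_lipschitz y x0 k1 k2 K.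
  exists (ee * (L / ee) ^+ 4), 1; split=> // [|x [t [/= bx _]] _].
    by rewrite mulr_gt0// exprn_gt0// divr_gt0.
  rewrite /G -mulrBr normrM norme mul1r.
  apply: le_trans (flatten_sub_le ee0 _ Px1) _.
  rewrite -[leRHS]mulrA ler_pM2l// -exprMn lerXn2r ?nnegrE//.
  - by rewrite divr_ge0// ltW.
  - by rewrite mulr_ge0 ?enorm_ge0// divr_ge0// ltW.
  - by rewrite mulrAC ler_pM2r ?invr_gt0//; exact: PL.
have phi0 : phi (x0, t0) = u (x0, t0).
  by rewrite /phi /f /G /= /P quartic0 flatten0// gt0 !mulr0 !addr0.
have lt z : cyl z -> z <> (x0, t0) -> e * u z < e * phi z.
  case: z => x t [/= bx t_gt0] zz0.
  rewrite -subr_gt0.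
  have -> : e * phi (x, t) - e * u (x, t)
      = g t + flatten ee (P x) - e * (u (x, t) - u (x0, t0)).
    by rewrite /phi /f /G /= !mulrDr !(sign_mulK _ e2); ring.
  have := flatten_ge ee0 (P x); have := flatten_geN ee0 (P x).
  have [gM1 gM2 gM3] := gM _ _ bx t_gt0.
  have [xd|xd] := leP d (enorm (x - x0)).
    have : M + 1 <= P x.
      rewrite /P /quartic; have s3 : d ^+ 4 <= dist2 x0 x ^+ 2.
        rewrite dist2E -exprM; apply: lerXn2r => //; rewrite nnegrE ?enorm_ge0//.
        exact: ltW.
      have sb : `|dist2 y x - dist2 y x0| <= B0.
        have := dist2_bound y bx; have := dist2_bound y bx0.
        have := dist2_ge0 y x; have := dist2_ge0 y x0; rewrite -/B0.
        rewrite ler_norml; lra.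
      have s1 : - (`|k1| * B0) <= k1 * (dist2 y x - dist2 y x0).
        rewrite lerNl; apply: le_trans (ler_norm _) _.
        by rewrite normrN normrM ler_wpM2l.
      have s2 : - (`|k2| * B0 ^+ 2) <= k2 * (dist2 y x - dist2 y x0) ^+ 2.
        rewrite lerNl; apply: le_trans (ler_norm _) _.
        by rewrite normrN normrM ler_wpM2l// normrX lerXn2r ?nnegrE.
      have := ler_wpM2l (ltW Kpos) s3; move: Kd; rewrite /B; lra.
    lra.
  have [td|td] := leP d `|t - t0|; first by have := gM3 td; lra.
  move=> _ Pge; have := gM1 td; have Hxt := H _ _ bx t_gt0 xd td.
  have : 0 < (t - t0) ^+ 2 + K * dist2 x0 x ^+ 2.
    have [tt|tt] := eqVneq t t0; last first.
      rewrite ltr_pwDl// ?exprn_even_gt0//= ?subr_eq0//.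
      by rewrite mulr_ge0 ?sqr_ge0// ltW.
    rewrite ltr_wpDl ?sqr_ge0// mulr_gt0// exprn_gt0// /dist2 dotxx_gt0.
    by rewrite subr_eq0; apply: contra_notN zz0 => /eqP ->; rewrite tt.
  move: Pge; rewrite /P /quartic; lra.
have [+ _] := usol phi (x0, t0) (conj bx0 t00) adm (esym phi0) lt.
have -> : time_derivative phi (x0, t0) = e * g1 t0.
  exact: separated_time_derivative G fd (x0, t0).
have -> : spatial_gradient phi (x0, t0) = gradient G x0.
  exact (@separated_gradient _ _ f G GC (x0, t0)).
have -> : spatial_hessian phi (x0, t0) = hessian G x0.
  exact (@separated_hessian _ _ f G GC (x0, t0)).
rewrite /G /P Fop_flat_quartic0// gradient_flat_quartic0//.
rewrite FradN// g1t0 -mulrBr sign_mulK// subr_le0; apply.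
move/eqP; rewrite scaler_eq0 subr_eq0 (negbTE x0y) orbF !mulf_eq0.
by rewrite (negbTE e_neq0) (negbTE k10) pnatr_eq0.
Qed.

Lemma is_derive_quarticZ y x0 k1 k2 (K : R) (x v : 'rV[R]_n) :
  is_derive x v (fun x => e * quartic y x0 k1 k2 K x)
    (e * dquartic y x0 k1 k2 K x v).
Proof. exact: is_deriveZ (is_derive_quartic _ _ _ _ _ _ _). Qed.

Lemma C2fun_quarticZ y x0 k1 k2 (K : R) :
  C2fun (fun x : 'rV[R]_n => e * quartic y x0 k1 k2 K x).
Proof. by apply: C2funM; [exact: C2fun_cst|exact: C2fun_quartic]. Qed.

Lemma gradient_quarticZ0 y x0 k1 k2 (K : R) :
  gradient (fun x : 'rV[R]_n => e * quartic y x0 k1 k2 K x) x0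
  = (2 * (e * k1)) *: (x0 - y).
Proof.
rewrite (gradientE (is_derive_quarticZ y x0 k1 k2 K x0)).
apply/rowP => i; rewrite !mxE.
rewrite /dquartic dot_delta !mxE /dist2 !subrr dot0r; ring.
Qed.

Lemma sided_contact0 (u : 'rV[R]_n * R -> R) x0 (t0 b C K d : R) :
  sided p q e u -> locally_bounded u ->
  unit_ball x0 -> 0 < t0 -> 0 < d ->
  (forall x (t : R), unit_ball x -> 0 < t -> enorm (x - x0) < d ->
     `|t - t0| < d ->
     e * (u (x, t) - u (x0, t0)) <= b * (t - t0) + C * (t - t0) ^+ 2
       + K * enorm (x - x0) ^+ 4) ->
  b <= 0.
Proof.
move=> usol ub bx0 t00 d0 H.
have [g [g1 [g2 [M [gd g1d cg2 [gt0 g1t0 M0] gM]]]]] :=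
  time_majorant b C ub bx0 t00 d0.
pose K1 := Num.max (`|K| + 1) ((M + 1) / d ^+ 4).
have KK1 : `|K| + 1 <= K1 by rewrite le_max lexx.
have K10 : 0 < K1 by apply: lt_le_trans KK1; rewrite ltr_wpDl.
have K1d : M + 1 <= K1 * d ^+ 4.
  by rewrite -ler_pdivrMr ?exprn_gt0// le_max lexx orbT.
pose P := quartic x0 x0 0 0 K1.
have PE x : P x = K1 * enorm (x - x0) ^+ 4.
  by rewrite /P /quartic !mul0r !add0r dist2E -exprM.
pose G x := e * P x.
pose f t := u (x0, t0) + e * g t.
have fd (t : R) : is_derive t 1 f (e * g1 t).
  have := is_deriveD (is_derive_cst (u (x0, t0)) t 1) (is_deriveZ e (gd t)).
  by rewrite add0r.
have f1d (t : R) : is_derive t 1 (fun t => e * g1 t) (e * g2 t).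
  exact: is_deriveZ.
have cf2 : continuous (fun t => e * g2 t).
  by move=> t; apply: cvgM; [exact: cvg_cst|exact: cg2].
have GC : C2fun G by exact: C2fun_quarticZ.
pose phi := (fun z : 'rV[R]_n * R => f z.2 + G z.1).
have adm : admissible p q cyl phi.
  apply: (@separated_admissible _ _ p q hq cyl f _ _ G fd f1d cf2 GC).
  move=> -[x1 t1] [/= bx1 _] G0.
  have x10 : x1 = x0.
    apply/eqP; rewrite -subr_eq0 -dotxx_eq0; apply/eqP.
    move: G0; rewrite (gradientE (is_derive_quarticZ x0 x0 0 0 K1 x1)) => /rowP G0.
    apply/eqP; rewrite dotxx_eq0; apply/eqP/rowP => i; rewrite mxE.
    have := G0 i; rewrite !mxE.
    have -> : dquartic x0 x0 0 0 K1 x1 (delta_mx ord0 i)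
        = 4 * K1 * dist2 x0 x1 * (x1 - x0) ord0 i.
      by rewrite -(dot_delta (x1 - x0)) /dquartic; ring.
    rewrite !mxE => /eqP; rewrite mulf_eq0 (negbTE e_neq0) /=.
    rewrite mulf_eq0 => /orP[|/eqP//].
    rewrite mulf_eq0 mulf_eq0 pnatr_eq0 (gt_eqF K10)/= /dist2 dotxx_eq0 => /eqP.
    by move=> h; have := congr1 (fun m : 'rV[R]_n => m ord0 i) h; rewrite !mxE.
  exists K1, 1; split=> // x _ _.
  by rewrite /G -mulrBr normrM norme mul1r x10 !PE subrr enorm0 expr0n/= mulr0
    subr0 ger0_norm// mulr_ge0 ?exprn_ge0 ?enorm_ge0// ltW.
have phi0 : phi (x0, t0) = u (x0, t0).
  by rewrite /phi /f /G /= /P quartic0 gt0 !mulr0 !addr0.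
have lt z : cyl z -> z <> (x0, t0) -> e * u z < e * phi z.
  case: z => x t [/= bx t_gt0] zz0.
  rewrite -subr_gt0.
  have -> : e * phi (x, t) - e * u (x, t)
      = g t + P x - e * (u (x, t) - u (x0, t0)).
    have -> : e * phi (x, t) = e * u (x0, t0) + e * (e * g t) + e * (e * P x).
      by rewrite -!mulrDr.
    by rewrite !sign_mulK//; ring.
  have [gM1 gM2 gM3] := gM _ _ bx t_gt0.
  have s0 : 0 <= enorm (x - x0) ^+ 4 by rewrite exprn_ge0// enorm_ge0.
  have := mulr_ge0 (ltW K10) s0.
  rewrite PE; have [xd|xd] := leP d (enorm (x - x0)).
    have s3 : d ^+ 4 <= enorm (x - x0) ^+ 4.
      by apply: lerXn2r => //; rewrite nnegrE ?enorm_ge0// ltW.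
    have := ler_wpM2l (ltW K10) s3; lra.
  have [td|td] := leP d `|t - t0|; first by have := gM3 td; lra.
  have := gM1 td; have Hxt := H _ _ bx t_gt0 xd td.
  have : 0 < (t - t0) ^+ 2 + enorm (x - x0) ^+ 4.
    have [tt|tt] := eqVneq t t0; last first.
      by rewrite ltr_pwDl// exprn_even_gt0//= subr_eq0.
    rewrite ltr_wpDl ?sqr_ge0// exprn_gt0// enorm_gt0.
    by rewrite subr_eq0; apply: contra_notN zz0 => /eqP ->; rewrite tt.
  have h1 : K * enorm (x - x0) ^+ 4 <= `|K| * enorm (x - x0) ^+ 4.
    by rewrite ler_wpM2r// ler_norm.
  have := ler_wpM2r s0 KK1; lra.
have [_] := usol phi (x0, t0) (conj bx0 t00) adm (esym phi0) lt.
have -> : time_derivative phi (x0, t0) = e * g1 t0.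
  exact: separated_time_derivative G fd (x0, t0).
have -> : spatial_gradient phi (x0, t0) = gradient G x0.
  exact (@separated_gradient _ _ f G GC (x0, t0)).
by rewrite gradient_quarticZ0 subrr scaler0 sign_mulK// g1t0; apply.
Qed.

(** In the stationary problem every C^2 function is a test function, so the bare quartic is used.
    The cases x0 = y and k1 = 0 are allowed, which serves contacts at the origin. *)
Lemma sided_stationary_contact (w : 'rV[R]_n -> R) x0 y (k1 k2 d M : R) :
  sided_stationary p q e w -> (forall x, unit_ball x -> `|w x| <= M) ->
  unit_ball x0 -> 0 < d ->
  (forall x, unit_ball x -> enorm (x - x0) < d ->
     e * (w x - w x0) <=
       k1 * (dist2 y x - dist2 y x0) + k2 * (dist2 y x - dist2 y x0) ^+ 2) ->
  0 <= Frad n p q k1 k2 (dist2 y x0) + (q - 2)^-1 * (e * w x0).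
Proof.
move=> wsol wM bx0 d0 H.
pose B0 := (1 + enorm y) ^+ 2.
pose B := `|k1| * B0 + `|k2| * B0 ^+ 2.
have B00 : 0 <= B0 by exact: sqr_ge0.
have B_ge0 : 0 <= B by rewrite addr_ge0// mulr_ge0// sqr_ge0.
have M0 : 0 <= M by apply: le_trans (wM _ bx0).
pose K := (B + 2 * M + 1) / d ^+ 4.
have Kd : K * d ^+ 4 = B + 2 * M + 1 by rewrite divfK// gt_eqF// exprn_gt0.
have Kpos : 0 < K by rewrite divr_gt0 ?exprn_gt0//; lra.
pose P := quartic y x0 k1 k2 K.
pose G x := e * P x.
have GC : C2fun G by exact: C2fun_quarticZ.
pose phi x := w x0 + G x.
have phiC : C2_on unit_ball phi.
  by apply: C2fun_C2_on; apply: C2funD => //; exact: C2fun_cst.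
have phi0 : w x0 = phi x0.
  by rewrite /phi /G /P quartic0 mulr0 addr0.
have lt x : unit_ball x -> x <> x0 -> e * w x < e * phi x.
  move=> bx xx0; rewrite -subr_gt0.
  have -> : e * phi x - e * w x = P x - e * (w x - w x0).
    by rewrite /phi /G mulrDr sign_mulK//; ring.
  have uabs : e * (w x - w x0) <= 2 * M.
    have := wM _ bx; have := wM _ bx0.
    have := ler_norm (e * (w x - w x0)).
    rewrite normrM norme mul1r; have := ler_normB (w x) (w x0); lra.
  have [xd|xd] := leP d (enorm (x - x0)).
    have : 2 * M + 1 <= P x.
      rewrite /P /quartic; have s3 : d ^+ 4 <= dist2 x0 x ^+ 2.
        rewrite dist2E -exprM; apply: lerXn2r => //; rewrite nnegrE ?enorm_ge0//.
        exact: ltW.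
      have sb : `|dist2 y x - dist2 y x0| <= B0.
        have := dist2_bound y bx; have := dist2_bound y bx0.
        have := dist2_ge0 y x; have := dist2_ge0 y x0; rewrite -/B0.
        rewrite ler_norml; lra.
      have s1 : - (`|k1| * B0) <= k1 * (dist2 y x - dist2 y x0).
        rewrite lerNl; apply: le_trans (ler_norm _) _.
        by rewrite normrN normrM ler_wpM2l.
      have s2 : - (`|k2| * B0 ^+ 2) <= k2 * (dist2 y x - dist2 y x0) ^+ 2.
        rewrite lerNl; apply: le_trans (ler_norm _) _.
        by rewrite normrN normrM ler_wpM2l// normrX lerXn2r ?nnegrE.
      have := ler_wpM2l (ltW Kpos) s3; rewrite Kd /B; lra.
    lra.
  have Hx := H _ bx xd.
  have : 0 < K * dist2 x0 x ^+ 2.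
    rewrite mulr_gt0// exprn_gt0// /dist2 dotxx_gt0 subr_eq0.
    exact/eqP.
  rewrite /P /quartic; lra.
have := wsol phi x0 bx0 phiC phi0 lt.
have gphi : gradient phi x0 = gradient G x0.
  apply/rowP => i; rewrite !mxE.
  exact: (congr1 (fun f => f x0) (derive_addl_cst GC (w x0) (delta_mx ord0 i))).
have hphi : hessian phi x0 = hessian G x0.
  apply/matrixP => i j; rewrite [LHS]mxE [RHS]mxE.
  exact: (congr1 (fun f => 'D_(delta_mx ord0 i) f x0)
    (derive_addl_cst GC (w x0) (delta_mx ord0 j))).
rewrite gphi hphi (@Fop_radial _ _ p q hq (x0 - y) (e * k1) (e * k2)).
- rewrite /dist2.
  rewrite (FradN _ _ _ _ _ _ e2).
  rewrite mulrDr.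
  rewrite (sign_mulK _ e2).
  rewrite mulrCA.
  exact.
- exact: gradient_quarticZ0.
move=> i j; rewrite (hessianE (is_derive_quarticZ y x0 k1 k2 K)
  (fun v v' => is_deriveZ e (is_derive_dquartic y x0 k1 k2 K v v'))).
by rewrite /GRing.scale/= dot_delta2 !dot_delta; ring.
Qed.

End ContactInequalities.

(** * Contact with general radial barriers *)

Section BarrierContact.
Context {R : realType} {n : nat} (p q : R).
Hypothesis hq : 2 < q.
Implicit Types (x y v w : 'rV[R]_n).

Lemma le_of_perturbation (a b c : R) :
  (forall eta, 0 < eta <= 1 -> a <= b + c * eta) -> a <= b.
Proof.
move=> H; rewrite leNgt; apply/negP => ba.
pose eta := Num.min 1 ((a - b) / (2 * (`|c| + 1))).
have c1 : 0 < `|c| + 1 by rewrite ltr_wpDl.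
have eta0 : 0 < eta by rewrite lt_min ltr01 divr_gt0 ?subr_gt0 ?mulr_gt0.
have eta1 : eta <= (a - b) / (2 * (`|c| + 1)) by rewrite ge_min lexx orbT.
have := H eta; rewrite eta0 ge_min lexx => /(_ isT) h.
have h2 : c * eta <= (`|c| + 1) * eta.
  by rewrite ler_wpM2r ?(ltW eta0)//; have := ler_norm c; lra.
move: eta1; rewrite ler_pdivlMr ?mulr_gt0//; lra.
Qed.

(** [Frad] is affine in k2. The second derivative may therefore be enlarged by a multiple of eta to
    dominate a Taylor remainder, and eta is removed afterwards by [le_of_perturbation]. *)
Lemma FradD (k1 k2 k z : R) : Frad n p q k1 (k2 + k) z
  = Frad n p q k1 k2 z
    + (2 * `|k1| * Num.sqrt z) `^ (q - 2) * (8 * z * (p - 1)) * k.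
Proof. by rewrite /Frad; ring. Qed.

Variable e : R.
Hypothesis e2 : e ^+ 2 = 1.

Let norme : `|e| = 1.
Proof. by apply/eqP; rewrite -(@eqrXn2 _ 2)// -normrX e2 normr1 expr1n. Qed.

Let ler_e (a b : R) : `|a| <= b -> e * a <= b.
Proof. by apply: le_trans; apply: le_trans (ler_norm _) _; rewrite normrM norme mul1r. Qed.

(** Expanding A(t) w + B(t) about the contact leaves the Taylor remainder of w, which costs |A| eta
    in k2, the remainders of A and B, which are quadratic in time, and a mixed product of
    increments. Quadratic errors in time are harmless, since only the first time derivative enters
    the equation. *)
Lemma sided_barrier (u : 'rV[R]_n * R -> R) x0 y (t0 d : R)
    (A A1 B B1 w w1 : R -> R) (A2 B2 w2 : R) :
  sided p q e u -> locally_bounded u ->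
  unit_ball x0 -> 0 < t0 -> x0 != y -> 0 < d ->
  (\forall s \near t0, is_derive (s : R) 1 A (A1 s)) -> is_derive t0 1 A1 A2 ->
  (\forall s \near t0, is_derive (s : R) 1 B (B1 s)) -> is_derive t0 1 B1 B2 ->
  (\forall s \near dist2 y x0, is_derive (s : R) 1 w (w1 s)) ->
  is_derive (dist2 y x0) 1 w1 w2 ->
  A t0 != 0 -> w1 (dist2 y x0) != 0 ->
  (forall x (t : R), unit_ball x -> 0 < t -> enorm (x - x0) < d ->
     `|t - t0| < d ->
     e * (u (x, t) - u (x0, t0)) <=
     e * (A t * w (dist2 y x) + B t - (A t0 * w (dist2 y x0) + B t0))) ->
  e * (A1 t0 * w (dist2 y x0) + B1 t0) <=
  e * Frad n p q (A t0 * w1 (dist2 y x0)) (A t0 * w2 / 2) (dist2 y x0).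
Proof.
move=> usol ub bx0 t00 x0y d0 dA dA1 dB dB1 dw dw1 A0 w10 H.
set z0 := dist2 y x0 in dw dw1 w10 H *.
set k1 := A t0 * w1 z0; set k2 := A t0 * w2 / 2.
apply: (@le_of_perturbation _ _
  ((2 * `|e * k1| * Num.sqrt z0) `^ (q - 2) * (8 * z0 * (p - 1)) * (`|A t0| + 1))).
move=> eta /andP[eta0 eta1].
rewrite [leRHS](_ : _ = Frad n p q (e * k1) (e * k2 + (`|A t0| + 1) * eta) z0);
  last by rewrite FradD FradN//; ring.
have [C1 [d1 [C10 d10 HA]]] := taylor1_quadratic dA dA1.
have [C2 [d2 [C20 d20 HB]]] := taylor1_quadratic dB dB1.
have [d3 d30 Hw] := taylor1_bound dw dw1 eta0.
pose l := 2 + 2 * enorm y.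
have l0 : 0 < l by rewrite /l; have := enorm_ge0 y; lra.
pose L := `|w1 z0| + `|w2 / 2| + 1.
pose LA := `|A1 t0| + C1.
have L0 : 0 <= L by rewrite !addr_ge0.
have LA0 : 0 <= LA by rewrite addr_ge0// ltW.
pose c := LA * L.
have c0 : 0 <= c by exact: mulr_ge0.
pose dd := Num.min (Num.min d (Num.min d1 d2)) (Num.min 1 (Num.min (d3 / l) l^-1)).
have dd0 : 0 < dd by rewrite !lt_min d0 d10 d20 ltr01 divr_gt0// invr_gt0.
apply: (@sided_contact _ _ p q hq e e2 u x0 y t0 _
  (`|w z0| * C1 + C2 + c ^+ 2 / (4 * eta)) (e * k1)
  (e * k2 + (`|A t0| + 1) * eta) dd) => //.
  by rewrite !mulf_eq0 -normr_eq0 norme oner_eq0 (negbTE A0) (negbTE w10).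
move=> x t bx tgt0; rewrite !lt_min => /and3P[/and3P[xd xd1 xd2] x1 /andP[x3 xl]].
move=> /and3P[/and3P[td td1 td2] t1 _].
apply: le_trans (H _ _ bx tgt0 xd td) _.
set sg := dist2 y x - z0; set ta := t - t0.
have sgl : `|sg| <= l * enorm (x - x0) by exact: dist2_lipschitz.
have sgd3 : `|sg| < d3.
  by apply: le_lt_trans sgl _; rewrite mulrC -ltr_pdivlMr.
have sg1 : `|sg| <= 1.
  by apply: le_trans sgl _; rewrite mulrC -ler_pdivlMr// mul1r ltW.
have hw := Hw _ sgd3; rewrite -/sg in hw.
have hA := HA _ td1; rewrite -/ta in hA.
have hB := HB _ td2; rewrite -/ta in hB.
have sgE : `|sg| ^+ 2 = sg ^+ 2 by rewrite real_normK ?num_real.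
have taE : `|ta| ^+ 2 = ta ^+ 2 by rewrite real_normK ?num_real.
have hwL : `|w (dist2 y x) - w z0| <= L * `|sg|.
  have -> : w (dist2 y x) - w z0 = (w (dist2 y x) - w z0 - w1 z0 * sg
    - w2 / 2 * sg ^+ 2) + w1 z0 * sg + w2 / 2 * sg ^+ 2 by ring.
  apply: le_trans (ler_normD _ _) _; rewrite [X in _ + X]normrM normrX.
  have := ler_normD (w (dist2 y x) - w z0 - w1 z0 * sg - w2 / 2 * sg ^+ 2)
    (w1 z0 * sg); rewrite (normrM (w1 z0)).
  have s2 : `|sg| ^+ 2 <= `|sg| by rewrite expr2 ler_piMr.
  have := ler_wpM2l (normr_ge0 (w2 / 2)) s2.
  have : eta * sg ^+ 2 <= `|sg|.
    by rewrite -sgE; apply: le_trans s2; rewrite ler_piMl// sqr_ge0.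
  rewrite /L; lra.
have hAL : `|A t - A t0| <= LA * `|ta|.
  have -> : A t - A t0 = (A t - A t0 - A1 t0 * ta) + A1 t0 * ta by ring.
  apply: le_trans (ler_normD _ _) _; rewrite [X in _ + X]normrM.
  have s2 : `|ta| ^+ 2 <= `|ta| by rewrite expr2 ler_piMr// ltW.
  have := ler_wpM2l (ltW C10) s2; rewrite taE /LA; lra.
have -> : e * (A t * w (dist2 y x) + B t - (A t0 * w z0 + B t0))
  = e * (A1 t0 * w z0 + B1 t0) * ta + e * k1 * sg + e * k2 * sg ^+ 2
    + e * (A t0 * (w (dist2 y x) - w z0 - w1 z0 * sg - w2 / 2 * sg ^+ 2))
    + e * (w z0 * (A t - A t0 - A1 t0 * ta))
    + e * (B t - B t0 - B1 t0 * ta)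
    + e * ((A t - A t0) * (w (dist2 y x) - w z0)).
  by rewrite /k1 /k2; field.
have r1 : e * (A t0 * (w (dist2 y x) - w z0 - w1 z0 * sg - w2 / 2 * sg ^+ 2))
    <= `|A t0| * (eta * sg ^+ 2).
  by apply: ler_e; rewrite normrM ler_wpM2l.
have r2 : e * (w z0 * (A t - A t0 - A1 t0 * ta)) <= `|w z0| * (C1 * ta ^+ 2).
  by apply: ler_e; rewrite normrM ler_wpM2l.
have r3 : e * (B t - B t0 - B1 t0 * ta) <= C2 * ta ^+ 2 by exact: ler_e.
have r4 : e * ((A t - A t0) * (w (dist2 y x) - w z0))
    <= (LA * `|ta|) * (L * `|sg|).
  by apply: ler_e; rewrite normrM; exact: ler_pM.
(* Young's inequality: the mixed product is split so that its spatial part costs only eta, at the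
   price of a large multiple of (t - t0)^2. *)
have r5 : (LA * `|ta|) * (L * `|sg|)
    <= eta * sg ^+ 2 + c ^+ 2 / (4 * eta) * ta ^+ 2.
  have -> : (LA * `|ta|) * (L * `|sg|) = c * `|ta| * `|sg| by rewrite /c; ring.
  rewrite -sgE -taE -subr_ge0.
  have -> : eta * `|sg| ^+ 2 + c ^+ 2 / (4 * eta) * `|ta| ^+ 2 - c * `|ta| * `|sg|
    = eta * (`|sg| - c * `|ta| / (2 * eta)) ^+ 2.
    by field; rewrite gt_eqF.
  by rewrite mulr_ge0 ?sqr_ge0// ltW.
lra.
Qed.

Lemma stationary_barrier (v : 'rV[R]_n -> R) x0 y (d M : R)
    (w w1 : R -> R) (w2 : R) :
  sided_stationary p q e v -> (forall x, unit_ball x -> `|v x| <= M) ->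
  unit_ball x0 -> 0 < d ->
  (\forall s \near dist2 y x0, is_derive (s : R) 1 w (w1 s)) ->
  is_derive (dist2 y x0) 1 w1 w2 ->
  (forall x, unit_ball x -> enorm (x - x0) < d ->
     e * (v x - v x0) <= e * (w (dist2 y x) - w (dist2 y x0))) ->
  0 <= e * (Frad n p q (w1 (dist2 y x0)) (w2 / 2) (dist2 y x0)
            + (q - 2)^-1 * v x0).
Proof.
move=> vsol vM bx0 d0 dw dw1 H.
set z0 := dist2 y x0 in dw dw1 H *.
apply: (@le_of_perturbation _ _
  ((2 * `|e * w1 z0| * Num.sqrt z0) `^ (q - 2) * (8 * z0 * (p - 1)))).
move=> eta /andP[eta0 eta1].
rewrite [leRHS](_ : _ = Frad n p q (e * w1 z0) (e * (w2 / 2) + eta) z0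
  + (q - 2)^-1 * (e * v x0)); last by rewrite FradD FradN//; ring.
have [d3 d30 Hw] := taylor1_bound dw dw1 eta0.
pose l := 2 + 2 * enorm y.
have l0 : 0 < l by rewrite /l; have := enorm_ge0 y; lra.
pose dd := Num.min d (d3 / l).
have dd0 : 0 < dd by rewrite !lt_min d0 divr_gt0.
apply: (@sided_stationary_contact _ _ p q hq e e2 v x0 y _ _ dd M) => //.
move=> x bx; rewrite lt_min => /andP[xd xd3].
apply: le_trans (H _ bx xd) _; rewrite -/z0; set sg := dist2 y x - z0.
have sgl : `|sg| <= l * enorm (x - x0) by exact: dist2_lipschitz.
have sgd3 : `|sg| < d3.
  by apply: le_lt_trans sgl _; rewrite mulrC -ltr_pdivlMr.
have hw := ler_e (Hw _ sgd3); rewrite -/sg in hw.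
have -> : e * (w (dist2 y x) - w z0) = e * w1 z0 * sg + e * (w2 / 2) * sg ^+ 2
  + e * (w (dist2 y x) - w z0 - w1 z0 * sg - w2 / 2 * sg ^+ 2) by ring.
lra.
Qed.

End BarrierContact.

(** * The profile and its flattened variants *)

Section Antiderivative.
Context {R : realType}.

(** Starting the integral at -1 makes 0 an interior point, so that derivatives at the centre of a
    profile are two-sided. *)
Lemma antiderivative (f : R -> R) : continuous f ->
  exists F : R -> R, forall x : R, -1 < x -> is_derive x 1 F (f x).
Proof.
move=> cf; exists (fun x => \int[lebesgue_measure]_(t in `[-1, x]) f t)%R.
move=> x x1; have xx1 : x < x + 1 by rewrite ltrDl.
have [dF FE] := @continuous_FTC1_closed R f (-1) x (x + 1) xx1
 (continuous_compact_integrable (@segment_compact _ _ _)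
    (continuous_subspaceT cf)) x1 (cf x).
apply: DeriveDef; first exact: dF.
rewrite -derive1E; exact: FE.
Qed.

Lemma continuous_powR_norm (b : R) : 0 < b -> continuous (fun r : R => `|r| `^ b).
Proof.
move=> b0 r; have [->|r0] := eqVneq r 0; last first.
  apply: (@continuous_comp _ _ _ (fun r : R => `|r|) (fun s => s `^ b)).
    exact: norm_continuous.
  apply/differentiable_continuous/derivable1_diffP.
  have nr0 : 0 < `|r| by rewrite normr_gt0.
  by have pd := @is_derive1_powR R b `|r| nr0; exact: ex_derive.
rewrite /continuous_at normr0 powR0 ?gt_eqF//.
apply/cvgr0Pnorm_lt => eps eps0.
have /cvgr0Pnorm_lt/(_ _ eps0) := powR_cvg0 b0.
rewrite near_withinE => /near_abs_lt[dl dl0 H].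
apply/nbhs_ballP; exists dl => //= s; rewrite /ball/= sub0r normrN => sd.
have [->|s0] := eqVneq s 0; first by rewrite normr0 powR0 ?gt_eqF// normr0.
by apply: H; rewrite ?subr0 ?normr_id ?normr_gt0.
Qed.

Lemma derive_le0_noninc (f f1 : R -> R) (a b : R) : a <= b ->
  (forall s : R, a <= s <= b -> is_derive s 1 f (f1 s)) ->
  (forall s, a < s < b -> f1 s <= 0) -> f b <= f a.
Proof.
move=> ab fd f1le.
have cf : {within `[a, b], continuous f}.
  apply: derivable_within_continuous => s; rewrite in_itv/= => sab.
  by have sd := fd _ sab; exact: ex_derive.
have dab s : s \in `]a, b[%R -> is_derive s 1 f (f1 s).
  by rewrite in_itv/= => /andP[h1 h2]; apply: fd; rewrite !ltW.
move: ab; rewrite le_eqVlt => /orP[/eqP -> //|ab].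
have [c] := MVT ab dab cf; rewrite in_itv/= => cab E.
rewrite -subr_le0 E mulr_le0_ge0 ?f1le// subr_ge0; exact: ltW.
Qed.

Lemma derive_lt0_dec (f f1 : R -> R) (a b : R) : a < b ->
  (forall s : R, a <= s <= b -> is_derive s 1 f (f1 s)) ->
  (forall s, a < s < b -> f1 s < 0) -> f b < f a.
Proof.
move=> ab fd f1lt.
have cf : {within `[a, b], continuous f}.
  apply: derivable_within_continuous => s; rewrite in_itv/= => sab.
  by have sd := fd _ sab; exact: ex_derive.
have dab s : s \in `]a, b[%R -> is_derive s 1 f (f1 s).
  by rewrite in_itv/= => /andP[h1 h2]; apply: fd; rewrite !ltW.
have [c] := MVT ab dab cf; rewrite in_itv/= => cab E.
by rewrite -subr_lt0 E nmulr_rlt0 ?f1lt// subr_gt0.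
Qed.

End Antiderivative.

(** * Integration of the radial differential equation *)

Section Profile.
Context {R : realType} (n : nat) (p q : R) (V : R -> R).
Hypotheses (hn : (2 <= n)%N) (hp : 1 < p) (hq : 2 < q).
Hypothesis V_cont : {within `[0, 1], continuous V}.
Hypothesis V_gt0 : forall r, 0 <= r < 1 -> 0 < V r.
Hypothesis V1 : V 1 = 0.

(* For radial functions F is, up to a factor, the q-Laplacian in the
   fictitious dimension [fdim]. *)
Definition fdim : R := (n%:R - 1) * (q - 1) / (p - 1) + 1.

Let fdim_gt1 : 1 < fdim.
Proof.
rewrite /fdim ltrDr divr_gt0 ?subr_gt0// mulr_gt0 ?subr_gt0 ?ltr1n//.
by apply: lt_trans hq; rewrite ltr1n.
Qed.

Let q1 : 0 < q - 1. Proof. move: hq; lra. Qed.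
Let p1 : 0 < p - 1. Proof. move: hp; lra. Qed.
Let q2 : 0 < q - 2. Proof. move: hq; lra. Qed.

(** Clamping the argument makes V continuous on the whole line and zero beyond 1, as required for
    integrating it and for evaluating shifted barriers. *)
Definition Vext (r : R) : R := V (Num.min (Num.max r 0) 1).

Lemma VextE r : 0 <= r <= 1 -> Vext r = V r.
Proof. by move=> /andP[r0 r1]; rewrite /Vext max_l// min_l. Qed.

Lemma Vext_ge1 r : 1 <= r -> Vext r = 0.
Proof.
move=> r1; rewrite /Vext max_l ?min_r ?V1//.
exact: le_trans r1.
Qed.

Lemma continuous_Vext : continuous Vext.
Proof.
move=> r; pose cl (s : R) := Num.min (Num.max s 0) 1.
have cl01 s : `[0, 1]%classic (cl s).
  by rewrite /= in_itv/= /cl le_min le_max lexx ler01 orbT/= ge_min lexx orbT.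
have /subspace_continuousP/(_ _ (cl01 r)) cV := V_cont.
apply: (cvg_comp cl V _ cV).
have ccl : {for r, continuous cl}.
  rewrite /cl; apply: continuous_min; last exact: cvg_cst.
  by apply: continuous_max; [exact: cvg_id|exact: cvg_cst].
move=> A wA.
have H : \forall s \near r, `[0, 1]%classic (cl s) -> A (cl s) by exact: ccl wA.
by apply: filterS H => s H; exact: H (cl01 s).
Qed.

Lemma Vext_ge0 r : 0 <= Vext r.
Proof.
rewrite /Vext; set c := Num.min _ _.
have c0 : 0 <= c by rewrite le_min le_max lexx ler01 orbT.
have c1 : c <= 1 by rewrite ge_min lexx orbT.
move: c1; rewrite le_eqVlt => /orP[/eqP ->|c1]; first by rewrite V1.
by rewrite ltW// V_gt0// c0.
Qed.

Let kappa : R := (q - 2)^-1 * (q - 1) / (p - 1).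

Let kappa_gt0 : 0 < kappa.
Proof. by rewrite /kappa divr_gt0// mulr_gt0// invr_gt0. Qed.

(** With v = -W' the radial equation reads v^(q-2) ((n-1) v/r + (p-1) v') = V/(q-2). Multiplication
    by (q-1)/(p-1) r^(d-1), d = [fdim], turns it into (r^(d-1) v^(q-1))' = [dens]. Hence [mass] is
    the first integral and v = (r^(1-d) mass)^(1/(q-1)), which is [slope 0]. *)
Let dens (r : R) : R := kappa * (`|r| `^ (fdim - 1) * Vext r).

Let continuous_dens : continuous dens.
Proof.
move=> r; apply: cvgM; first exact: cvg_cst.
apply: cvgM; last exact: continuous_Vext.
by apply: continuous_powR_norm; rewrite subr_gt0.
Qed.

Let dens_ge0 r : 0 <= dens r.
Proof. by rewrite mulr_ge0 ?(ltW kappa_gt0)// mulr_ge0 ?powR_ge0 ?Vext_ge0. Qed.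

Let mass_sig := cid (antiderivative continuous_dens).

Let mass (r : R) : R := sval mass_sig r - sval mass_sig 0.

Let mass_deriv (r : R) : -1 < r -> is_derive r 1 mass (dens r).
Proof.
move=> r1; have := is_deriveD (svalP mass_sig r r1)
  (is_derive_cst (- sval mass_sig 0) r 1).
by rewrite addr0.
Qed.

Let mass0 : mass 0 = 0.
Proof. by rewrite /mass subrr. Qed.

Let mass_mono r s : 0 <= r -> r <= s -> mass r <= mass s.
Proof.
move=> r0 rs; rewrite -lerN2.
apply: (@derive_le0_noninc _ (fun t => - mass t) (fun t => - dens t) r s) => //.
  move=> t /andP[rt _]; apply: is_deriveN; apply: mass_deriv; lra.
by move=> t _; rewrite oppr_le0.
Qed.

Let mass_gt0 r : 0 < r -> 0 < mass r.
Proof.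
move=> r0; pose s := Num.min r 1.
have s0 : 0 < s by rewrite lt_min r0 ltr01.
have s1 : s <= 1 by rewrite ge_min lexx orbT.
have sr : s <= r by rewrite ge_min lexx.
apply: lt_le_trans (mass_mono (ltW s0) sr).
rewrite -ltrN2 -[X in _ < - X]mass0.
apply: (@derive_lt0_dec _ (fun t => - mass t) (fun t => - dens t) 0 s) => //.
  move=> t /andP[t0 _]; apply: is_deriveN; apply: mass_deriv; lra.
move=> t /andP[t0 ts]; rewrite oppr_lt0 mulr_gt0// mulr_gt0//.
  by rewrite powR_gt0// normr_gt0 gt_eqF.
rewrite VextE ?V_gt0 ?(ltW t0)//=; lra.
Qed.

Let mass_bound : exists2 C, 0 < C & forall r, 0 < r -> mass r <= C * r `^ fdim.
Proof.
have [m _ mP] : exists2 c, `[0, 1]%classic c &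
    forall b, `[0, 1]%classic b -> Vext b <= Vext c.
  apply: exists_max; first exact: segment_compact.
    by exists 0; rewrite /= in_itv/= lexx ler01.
  by apply: continuous_subspaceT; exact: continuous_Vext.
have Vm r : 0 <= r -> Vext r <= Vext m.
  move=> r0; have [r1|r1] := leP r 1; first by apply: mP; rewrite /= in_itv/= r0.
  by rewrite Vext_ge1 ?(ltW r1)// Vext_ge0.
exists (kappa * Vext m + 1).
  by rewrite ltr_wpDl// mulr_ge0 ?(ltW kappa_gt0)// Vext_ge0.
move=> r r0.
have cm : {within `[0, r], continuous mass}.
  apply: derivable_within_continuous => s; rewrite in_itv/= => /andP[s0 _].
  have sd : is_derive s 1 mass (dens s) by apply: mass_deriv; lra.
  exact: ex_derive.
have dm s : s \in `]0, r[%R -> is_derive s 1 mass (dens s).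
  by rewrite in_itv/= => /andP[s0 _]; apply: mass_deriv; lra.
have [c] := MVT r0 dm cm; rewrite in_itv/= => /andP[c0 cr].
rewrite mass0 !subr0 => ->.
have -> : r `^ fdim = r `^ (fdim - 1) * r.
  by rewrite mulrC mulr_powRB1 ?(ltW r0)//; exact: lt_trans fdim_gt1.
rewrite mulrA ler_pM2r// /dens (gtr0_norm c0).
have h1 : c `^ (fdim - 1) <= r `^ (fdim - 1).
  by rewrite ge0_ler_powR ?nnegrE ?(ltW c0) ?(ltW r0) ?(ltW cr)// subr_ge0 ltW.
have h2 := Vm c (ltW c0).
apply: (@le_trans _ _ (kappa * (r `^ (fdim - 1) * Vext m))).
  by rewrite ler_pM2l// ler_pM ?powR_ge0 ?Vext_ge0.
have := powR_ge0 r (fdim - 1); lra.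
Qed.

(** The cut factor is of order r at the centre, so its M-th power gives r^(3(q-1)) under the
    (q-1)-th root: the slope becomes of order r^3 and W(0) - W(r) of order r^4. *)
Let M : nat := (Num.truncn (3 * (q - 1))).+1.

Let Mq : 3 * (q - 1) <= M%:R.
Proof. by apply/ltW/truncnS_gt. Qed.

(* Replacing the mass by [mass * (mass / (mass + c)) ^ M] flattens the top of
   the profile and only decreases the derivative of the mass. *)
Let cut (c r : R) : R := mass r / (mass r + c).

Let flux (c r : R) : R := mass r * cut c r ^+ M.

Let flux_ratio (c r : R) : R := cut c r ^+ M * (1 + M%:R * (c / (mass r + c))).

Let cut_itv c r : 0 <= c -> 0 < r -> 0 < cut c r <= 1.
Proof.
move=> c0 r0; have m0 := mass_gt0 r0.
have mc : 0 < mass r + c by rewrite ltr_pwDl.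
by rewrite divr_gt0//= ler_pdivrMr// mul1r lerDl.
Qed.

Let flux_deriv c (r : R) : 0 <= c -> 0 < r ->
  is_derive r 1 (flux c) (dens r * flux_ratio c r).
Proof.
move=> c0 r0; have m0 := mass_gt0 r0.
have mc : mass r + c != 0 by rewrite gt_eqF// ltr_pwDl.
have md : is_derive r 1 mass (dens r) by apply: mass_deriv; lra.
have mcd : is_derive r 1 (fun s => mass s + c) (dens r).
  by have := is_deriveD md (is_derive_cst c r 1); rewrite addr0.
have id : is_derive r 1 (fun s => (mass s + c)^-1)
    (- (mass r + c) ^- 2 *: dens r).
  exact: (@is_deriveV _ (fun s => mass s + c) r (dens r) 1 mc mcd).
have := is_deriveM md (is_deriveX M (is_deriveM md id)).
set f := (X in is_derive _ _ X _ -> _); set df := (X in is_derive _ _ _ X -> _).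
have -> : df = dens r * flux_ratio c r.
  rewrite /df /flux_ratio /cut /= !fctE /GRing.scale/=.
  rewrite -/(cut c r) [cut c r ^+ M]exprS /cut; field.
  exact: mc.
suff -> : f = flux c by [].
by apply/funext => s; rewrite /f /flux /cut; congr (_ * _); rewrite exprfctE.
Qed.

(** With t = c/(mass + c), Bernoulli's inequality gives (1-t)^M (1 + M t) <= ((1-t)(1+t))^M <= 1.
    Cutting thus only weakens the source, which keeps the flattened profile on the subsolution
    side. *)
Let flux_ratio_itv c r : 0 <= c -> 0 < r -> 0 <= flux_ratio c r <= 1.
Proof.
move=> c0 r0; have m0 := mass_gt0 r0.
have mc : 0 < mass r + c by rewrite ltr_pwDl.
have /andP[c1 c2] := cut_itv c0 r0.
pose t := c / (mass r + c).
have t0 : 0 <= t by rewrite divr_ge0 ?(ltW mc).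
have cE : cut c r = 1 - t.
  have mc' := lt0r_neq0 mc; rewrite /cut /t -(divff mc') -mulrBl.
  by congr (_ / _); ring.
rewrite /flux_ratio -/t mulr_ge0 ?exprn_ge0 ?(ltW c1)//=; last first.
  by rewrite addr_ge0// mulr_ge0.
apply: (@le_trans _ _ ((1 - t) ^+ M * (1 + t) ^+ M)).
  have tp : 0 <= 1 - t by rewrite -cE ltW.
  rewrite cE; apply: ler_wpM2l; first exact: exprn_ge0.
  elim: M => [|m ih]; first by rewrite mul0r addr0.
  rewrite exprS; apply: (@le_trans _ _ ((1 + t) * (1 + m%:R * t))).
    rewrite -natr1; have : 0 <= m%:R * t * t.
      by apply: mulr_ge0 => //; apply: mulr_ge0.
    lra.
  by rewrite ler_wpM2l// addr_ge0.
rewrite -exprMn exprn_ile1//.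
  by rewrite -cE mulr_ge0 ?addr_ge0// ltW.
have := sqr_ge0 t; rewrite expr2; lra.
Qed.

Let flux_gt0 c r : 0 <= c -> 0 < r -> 0 < flux c r.
Proof.
move=> c0 r0; rewrite mulr_gt0 ?mass_gt0// exprn_gt0//.
by case/andP: (cut_itv c0 r0).
Qed.

Let flux_le c r : 0 <= c -> 0 < r -> flux c r <= mass r.
Proof.
move=> c0 r0; rewrite ler_piMr ?(ltW (mass_gt0 r0))//.
by case/andP: (cut_itv c0 r0) => h1 h2; rewrite exprn_ile1// ltW.
Qed.

Let gfun c r : R := r `^ (1 - fdim) * flux c r.

Let slope (c r : R) : R := if 0 < r then gfun c r `^ (q - 1)^-1 else 0.

Let gfun_gt0 c r : 0 <= c -> 0 < r -> 0 < gfun c r.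
Proof. by move=> c0 r0; rewrite mulr_gt0 ?powR_gt0 ?flux_gt0. Qed.

Let gfun_deriv c (r : R) : 0 <= c -> 0 < r -> is_derive r 1 (gfun c)
  ((1 - fdim) * r `^ (- fdim) * flux c r
   + r `^ (1 - fdim) * (dens r * flux_ratio c r)).
Proof.
move=> c0 r0.
have := is_deriveM (@is_derive1_powR R (1 - fdim) r r0) (flux_deriv c0 r0).
set df := (X in is_derive _ _ _ X -> _).
suff -> : df = (1 - fdim) * r `^ (- fdim) * flux c r
   + r `^ (1 - fdim) * (dens r * flux_ratio c r) by [].
by rewrite /df /GRing.scale/= addrAC subrr add0r; ring.
Qed.

Let slope_deriv c (r : R) : 0 <= c -> 0 < r -> is_derive r 1 (slope c)
  ((q - 1)^-1 * gfun c r `^ ((q - 1)^-1 - 1)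
   * ((1 - fdim) * r `^ (- fdim) * flux c r
      + r `^ (1 - fdim) * (dens r * flux_ratio c r))).
Proof.
move=> c0 r0.
have := is_derive_comp1 (gfun_deriv c0 r0)
  (@is_derive1_powR R (q - 1)^-1 _ (gfun_gt0 c0 r0)).
apply: near_eq_is_derive; near=> s; rewrite /slope ifT//.
by near: s; exact: lt_nbhsr.
Unshelve. all: by end_near. Qed.

Let slope_gt0 c r : 0 <= c -> 0 < r -> 0 < slope c r.
Proof. by move=> c0 r0; rewrite /slope r0 powR_gt0// gfun_gt0. Qed.

(** Only r = 0 is delicate: there [mass] is at most C r^d, so [gfun] is at most C r and the slope
    tends to 0. *)
Let continuous_slope c : 0 <= c -> continuous (slope c).
Proof.
move=> c0 r; have [r0|r0|->] := ltgtP r 0.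
- rewrite /continuous_at /slope ltNge (ltW r0)/=.
  apply: cvg_near_cst; near=> s; rewrite ltNge ltW//.
  by near: s; exact: lt_nbhsl.
- apply/differentiable_continuous/derivable1_diffP.
  by have sd := slope_deriv c0 r0; exact: ex_derive.
rewrite /continuous_at {2}/slope ltxx.
have [C C0 HC] := mass_bound.
have q10 : 0 < (q - 1)^-1 by rewrite invr_gt0.
have bnd s : `|slope c s| <= C `^ (q - 1)^-1 * `|s| `^ (q - 1)^-1.
  rewrite /slope; case: ifPn => s0; last by rewrite normr0 mulr_ge0 ?powR_ge0.
  rewrite ger0_norm ?powR_ge0// (gtr0_norm s0) -powRM ?(ltW C0) ?(ltW s0)//.
  have g0 := gfun_gt0 c0 s0.
  rewrite ge0_ler_powR ?nnegrE ?(ltW g0) ?(ltW q10) ?mulr_ge0 ?(ltW C0) ?(ltW s0)//.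
  apply: (@le_trans _ _ (s `^ (1 - fdim) * (C * s `^ fdim))).
    rewrite ler_pM2l ?powR_gt0//; exact: le_trans (flux_le c0 s0) (HC _ s0).
  rewrite mulrCA -powRD; first by rewrite subrK powRr1// ltW.
  by rewrite (gt_eqF s0) implybT.
have cv : C `^ (q - 1)^-1 * `|s| `^ (q - 1)^-1 @[s --> (0 : R)] --> (0 : R).
  have := cvgM (cvg_cst (C `^ (q - 1)^-1)) (continuous_powR_norm q10 (x := (0:R))).
  by rewrite normr0 powR0 ?gt_eqF// mulr0; apply.
apply/cvgr0Pnorm_lt => eps eps0; have /cvgr0Pnorm_lt/(_ _ eps0) := cv.
apply: filterS => s; apply: le_lt_trans.
by apply: le_trans (bnd s) _; exact: ler_norm.
Unshelve. all: by end_near. Qed.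

(* The jets are those of [W (sqrt z / r0)] in the squared distance [z]; [xi] is the
   factor by which the source term of the stationary equation is reduced. *)
Definition radial_profile (xi W : R -> R) : Prop :=
  [/\ forall r : R, -1 < r -> {for r, continuous W}, W 1 = 0,
      (forall r s : R, 0 <= r -> r < s -> W s < W r) &
      forall r0 z : R, 0 < r0 -> 0 < z -> exists (w1 : R -> R) (w2 : R),
      [/\ \forall s \near z, is_derive (s : R) 1 (fun s => W (Num.sqrt s / r0)) (w1 s),
          is_derive z 1 w1 w2, w1 z < 0 &
          forall A, 0 < A -> Frad n p q (A * w1 z) (A * w2 / 2) z
            = - (A `^ (q - 1) * r0 `^ (- q) * ((q - 2)^-1
                 * (xi (Num.sqrt z / r0) * Vext (Num.sqrt z / r0))))]].

Let antislope c : 0 <= c -> exists W : R -> R,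
  W 1 = 0 /\ forall r : R, -1 < r -> is_derive r 1 W (- slope c r).
Proof.
move=> c0; have [F HF] := antiderivative (continuous_slope c0).
exists (fun r => F 1 - F r); split; first by rewrite subrr.
move=> r r1; have := is_deriveB (is_derive_cst (F 1) r 1) (HF r r1).
by rewrite sub0r.
Qed.

(** Two power identities, v^(q-2) v = gfun and v^(q-2) gfun^(1/(q-1) - 1) = 1, remove all roots. The
    value of [fdim] is the one for which the (1 - fdim) term cancels (n-1) v/r. *)
Let slope_jet c r : 0 <= c -> 0 < r ->
  slope c r `^ (q - 2) * ((n%:R - 1) * slope c r / r + (p - 1) *
   ((q - 1)^-1 * gfun c r `^ ((q - 1)^-1 - 1)
   * ((1 - fdim) * r `^ (- fdim) * flux c r
      + r `^ (1 - fdim) * (dens r * flux_ratio c r))))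
  = (q - 2)^-1 * (flux_ratio c r * Vext r).
Proof.
move=> c0 r0; have g0 := gfun_gt0 c0 r0; have v0 := slope_gt0 c0 r0.
have r0' := lt0r_neq0 r0.
have e1 : slope c r `^ (q - 2) * slope c r = gfun c r.
  have -> : q - 2 = (q - 1) - 1 by ring.
  rewrite mulrC mulr_powRB1 ?(ltW v0)// /slope r0 -powRrM mulVf ?gt_eqF//.
  by rewrite powRr1// ltW.
have e2 : slope c r `^ (q - 2) * gfun c r `^ ((q - 1)^-1 - 1) = 1.
  rewrite /slope r0 -powRrM -powRD; last by rewrite (gt_eqF g0) implybT.
  have -> : (q - 1)^-1 * (q - 2) + ((q - 1)^-1 - 1) = 0.
    by field; rewrite gt_eqF.
  exact: powRr0.
set v := slope c r in e1 e2 *; set vq := v `^ (q - 2) in e1 e2 *.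
set gq := gfun c r `^ _ in e2 *.
have -> : vq * ((n%:R - 1) * v / r + (p - 1) * ((q - 1)^-1 * gq
   * ((1 - fdim) * r `^ (- fdim) * flux c r
      + r `^ (1 - fdim) * (dens r * flux_ratio c r))))
  = (n%:R - 1) / r * (vq * v) + (p - 1) / (q - 1) * (vq * gq)
   * ((1 - fdim) * r `^ (- fdim) * flux c r
      + r `^ (1 - fdim) * (dens r * flux_ratio c r)) by ring.
rewrite e1 e2 /gfun /dens (gtr0_norm r0).
have e3 : r `^ (1 - fdim) = r `^ (- fdim) * r.
  have -> : 1 - fdim = - fdim + 1 by ring.
  by rewrite powRD ?(gt_eqF r0) ?implybT// powRr1// ltW.
have e4 : r `^ (1 - fdim) * r `^ (fdim - 1) = 1.
  by rewrite -powRD ?(gt_eqF r0) ?implybT// addrC addrA subrK subrr powRr0.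
have -> : r `^ (1 - fdim) * (kappa * (r `^ (fdim - 1) * Vext r) * flux_ratio c r)
  = kappa * (r `^ (1 - fdim) * r `^ (fdim - 1)) * (flux_ratio c r * Vext r) by ring.
rewrite e4 e3 /kappa /fdim; field.
by rewrite r0' !gt_eqF.
Qed.

(** Homogeneity of F: q - 2 gradients and one second derivative give A to the power q - 1 and the
    length r0 to the power -q. *)
Let powR_scale (A r0 : R) : 0 < A -> 0 < r0 ->
  (A / r0) `^ (q - 2) * (A / r0 ^+ 2) = A `^ (q - 1) * r0 `^ (- q).
Proof.
move=> A0 r00.
have rq : r0 `^ (q - 2) != 0 by rewrite gt_eqF ?powR_gt0.
have h1 : (A / r0) `^ (q - 2) = A `^ (q - 2) / r0 `^ (q - 2).
  apply: (mulIf rq); rewrite -powRM ?divr_ge0 ?(ltW A0) ?(ltW r00)//.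
  by rewrite !divfK// gt_eqF.
have h2 : A `^ (q - 1) = A `^ (q - 2) * A.
  by rewrite -(mulr_powRB1 (ltW A0) q1) mulrC; congr (_ `^ _ * _); ring.
have h3 : r0 `^ (- q) = (r0 `^ (q - 2) * r0 ^+ 2)^-1.
  rewrite powRN -[in RHS](powR_mulrn 2 (ltW r00)) -powRD ?subrK//.
  by rewrite (gt_eqF r00) implybT.
rewrite h1 h2 h3; field.
by rewrite rq gt_eqF.
Qed.

Let slope_profile c W : 0 <= c -> W 1 = 0 ->
  (forall r : R, -1 < r -> is_derive r 1 W (- slope c r)) ->
  radial_profile (flux_ratio c) W.
Proof.
move=> c0 W1 dW; split=> //.
- move=> r r1; apply/differentiable_continuous/derivable1_diffP.
  by have Wr := dW r r1; exact: ex_derive.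
- move=> r s r0 rs; apply: (@derive_lt0_dec _ W (fun t => - slope c t) r s rs).
    by move=> t /andP[rt _]; apply: dW; lra.
  by move=> t /andP[rt _]; rewrite oppr_lt0 slope_gt0//; exact: le_lt_trans rt.
move=> r0 z r00 z0; pose rho s := Num.sqrt s / r0.
have rho0 s : 0 < s -> 0 < rho s by move=> s0; rewrite divr_gt0 ?sqrtr_gt0.
have drho (s : R) : 0 < s -> is_derive s 1 rho ((2 * Num.sqrt s)^-1 / r0).
  move=> s0; have := is_deriveZ r0^-1 (is_derive1_sqrt s0).
  have -> : r0^-1 \*: Num.sqrt = rho by apply/funext => t; rewrite /rho mulrC.
  by rewrite [_ *: _]mulrC.
pose w1 s := - slope c (rho s) * ((2 * Num.sqrt s)^-1 / r0).
have dw (s : R) : 0 < s -> is_derive s 1 (fun s => W (rho s)) (w1 s).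
  move=> s0; apply: is_derive_comp1 (drho _ s0) (dW _ _).
  by apply: lt_trans (rho0 _ s0); rewrite ltrN10.
have dinv : is_derive z 1 (fun s => (2 * Num.sqrt s)^-1 / r0)
    (- (2 * Num.sqrt z) ^- 2 * (2 * (2 * Num.sqrt z)^-1) / r0).
  have h1 : is_derive z 1 (fun s => 2 * Num.sqrt s) (2 * (2 * Num.sqrt z)^-1).
    exact: is_deriveZ (is_derive1_sqrt z0).
  have nz : 2 * Num.sqrt z != 0 by rewrite gt_eqF// mulr_gt0// sqrtr_gt0.
  have h2 := @is_deriveV R (fun s => 2 * Num.sqrt s) z _ 1 nz h1.
  have := is_deriveZ r0^-1 h2.
  set f := (X in is_derive _ _ X _ -> _); set df := (X in is_derive _ _ _ X -> _).
  have -> : df = - (2 * Num.sqrt z) ^- 2 * (2 * (2 * Num.sqrt z)^-1) / r0.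
    by rewrite /df [_ *: _]mulrC.
  suff -> : f = (fun s => (2 * Num.sqrt s)^-1 / r0) by [].
  by apply/funext => s; rewrite /f [LHS]mulrC.
have dsl := is_deriveN (is_derive_comp1 (drho _ z0) (slope_deriv c0 (rho0 _ z0))).
have := is_deriveM dsl dinv; set w2 := (X in is_derive _ _ _ X -> _) => dw1.
exists w1, w2; split; last 1 first.
- move=> A A0.
  have R0 := rho0 _ z0; have v0 := slope_gt0 c0 R0; have J := slope_jet c0 R0.
  rewrite -/(rho z).
  set v1 := (X in (p - 1) * X) in J.
  have rz : 0 < Num.sqrt z by rewrite sqrtr_gt0.
  have z2 : z = Num.sqrt z ^+ 2 by rewrite sqr_sqrtr// ltW.
  rewrite /Frad.
  have -> : 2 * `|A * w1 z| * Num.sqrt z = A / r0 * slope c (rho z).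
    rewrite /w1 mulNr mulrN normrN gtr0_norm; last first.
      by rewrite !mulr_gt0 ?invr_gt0 ?mulr_gt0.
    by field; rewrite !gt_eqF.
  rewrite powRM ?(ltW v0)//; last by rewrite divr_ge0 ?ltW.
  have -> : 2 * (A * w1 z) * (n%:R + p - 2) + 8 * (A * w2 / 2) * z * (p - 1)
    = - (A / r0 ^+ 2) * ((n%:R - 1) * slope c (rho z) / rho z + (p - 1) * v1).
    rewrite /w2 /GRing.scale/= !fctE /= -/v1 /w1 /rho.
    rewrite [X in _ * X * (p - 1)]z2; field.
    by rewrite !gt_eqF.
  transitivity (- ((A / r0) `^ (q - 2) * (A / r0 ^+ 2)
    * (slope c (rho z) `^ (q - 2) * ((n%:R - 1) * slope c (rho z) / rho z
       + (p - 1) * v1)))); first by ring.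
  by rewrite J powR_scale.
- near=> s; apply: dw; near: s; exact: lt_nbhsr.
- exact: dw1.
- rewrite /w1 nmulr_rlt0 ?oppr_lt0 ?slope_gt0 ?rho0//.
  by rewrite divr_gt0// invr_gt0 mulr_gt0// sqrtr_gt0.
Unshelve. all: by end_near. Qed.

Let slope_cubic c : 0 < c -> exists2 K, 0 < K &
  forall r, 0 < r <= 1 -> slope c r <= K * r ^+ 3.
Proof.
move=> c0; have [C C0 HC] := mass_bound.
have iq : 0 < (q - 1)^-1 by rewrite invr_gt0.
pose B := C * (C / c) ^+ M.
have B0 : 0 < B by rewrite mulr_gt0// exprn_gt0// divr_gt0.
exists (B `^ (q - 1)^-1); first by rewrite powR_gt0.
move=> r /andP[r0 r1].
have g0 := gfun_gt0 (ltW c0) r0.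
suff h : gfun c r <= B * r `^ (3 * (q - 1)).
  have -> : r ^+ 3 = (r `^ (3 * (q - 1))) `^ (q - 1)^-1.
    by rewrite -powRrM mulfK ?gt_eqF// powR_mulrn// ltW.
  rewrite /slope r0 -powRM ?powR_ge0 ?(ltW B0)//.
  rewrite ge0_ler_powR ?nnegrE ?(ltW iq) ?(ltW g0)// mulr_ge0 ?powR_ge0//.
  exact: ltW.
have m0 := mass_gt0 r0; have mC := HC _ r0.
have rd : r `^ fdim <= r.
  by rewrite -[leRHS](powRr1 (ltW r0)) ger_powR ?r0 ?r1// ltW.
have cutb : cut c r <= C / c * r.
  apply: (@le_trans _ _ (mass r / c)).
    have mc : 0 < mass r + c by exact: addr_gt0.
    have cm : c <= mass r + c by rewrite lerDr ltW.
    by rewrite /cut ler_pM2l// lef_pV2.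
  rewrite mulrAC ler_pM2r ?invr_gt0//; apply: le_trans mC _.
  by rewrite ler_pM2l.
have cut0 : 0 < cut c r by case/andP: (cut_itv (ltW c0) r0).
have h1 : flux c r <= C * r `^ fdim * ((C / c) ^+ M * r ^+ M).
  rewrite /flux -exprMn; apply: ler_pM => //; first exact: ltW.
    by rewrite exprn_ge0// ltW.
  apply: lerXn2r => //; rewrite nnegrE ?(ltW cut0)// mulr_ge0 ?(ltW r0)//.
  by rewrite divr_ge0 ?ltW.
have rp : 0 < r `^ (1 - fdim) by rewrite powR_gt0.
apply: (@le_trans _ _ (r `^ (1 - fdim) * (C * r `^ fdim * ((C / c) ^+ M * r ^+ M)))).
  by rewrite ler_pM2l.
have e1 : r `^ (1 - fdim) * r `^ fdim = r.
  by rewrite -powRD ?(gt_eqF r0) ?implybT// subrK powRr1// ltW.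
have -> : r `^ (1 - fdim) * (C * r `^ fdim * ((C / c) ^+ M * r ^+ M))
  = B * (r `^ (1 - fdim) * r `^ fdim * r ^+ M) by rewrite /B; ring.
rewrite e1 ler_pM2l// -exprS -powR_mulrn ?(ltW r0)// ger_powR ?r0//.
by rewrite -[M.+1%:R]natr1; apply: le_trans Mq _; lra.
Qed.

Let bernoulli_le (t : R) (m : nat) : 0 <= t <= 1 -> 1 - m%:R * t <= (1 - t) ^+ m.
Proof.
move=> /andP[t0 t1]; elim: m => [|m ih]; first by rewrite mul0r subr0.
rewrite exprS; apply: (@le_trans _ _ ((1 - t) * (1 - m%:R * t))).
  rewrite -natr1; have : 0 <= m%:R * t * t.
    by apply: mulr_ge0 => //; apply: mulr_ge0.
  lra.
by rewrite ler_wpM2l// subr_ge0.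
Qed.

(** Beyond r1 the mass is bounded below, so a small c makes cut^M >= 1 - M t >= mu^(q-1) by
    Bernoulli's inequality; [c] is the value for which this works at r1. *)
Let slope_compare (r1 mu : R) : 0 < r1 -> 0 < mu < 1 ->
  exists2 c, 0 < c & forall r, r1 <= r -> mu * slope 0 r <= slope c r.
Proof.
move=> r10 /andP[mu0 mu1].
have iq : 0 < (q - 1)^-1 by rewrite invr_gt0.
have muq : mu `^ (q - 1) < 1.
  have e1 : (1 : R) `^ (q - 1) = 1 by rewrite powR1.
  by rewrite -[ltRHS]e1 gt0_ltr_powR// nnegrE// ltW.
have I1 := mass_gt0 r10.
pose c := mass r1 * (1 - mu `^ (q - 1)) / M%:R.
have M0 : 0 < M%:R :> R by rewrite ltr0n.
have c0 : 0 < c by rewrite divr_gt0// mulr_gt0// subr_gt0.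
exists c => // r r1r; have r0 : 0 < r by exact: lt_le_trans r1r.
have Ir := mass_mono (ltW r10) r1r.
have I0 : 0 < mass r by exact: lt_le_trans Ir.
have g0 := gfun_gt0 (lexx 0) r0; have gc := gfun_gt0 (ltW c0) r0.
have -> : mu * slope 0 r = (mu `^ (q - 1) * gfun 0 r) `^ (q - 1)^-1.
  rewrite /slope r0 powRM ?powR_ge0 ?(ltW g0)// -powRrM divff ?gt_eqF//.
  by rewrite powRr1// ltW.
rewrite /slope r0 ge0_ler_powR ?nnegrE ?(ltW iq) ?(ltW gc)//.
  by rewrite mulr_ge0 ?powR_ge0// ltW.
rewrite /gfun mulrCA ler_pM2l ?powR_gt0// /flux.
have -> : cut 0 r = 1 by rewrite /cut addr0 divff// gt_eqF.
rewrite expr1n mulr1 mulrC ler_pM2l//.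
pose t := c / (mass r + c).
have mc : 0 < mass r + c by rewrite addr_gt0.
have cE : cut c r = 1 - t.
  have mc' := lt0r_neq0 mc; rewrite /cut /t -(divff mc') -mulrBl.
  by congr (_ / _); ring.
have t01 : 0 <= t <= 1.
  by rewrite divr_ge0 ?(ltW c0) ?(ltW mc)//= ler_pdivrMr// mul1r lerDr ltW.
rewrite cE; apply: le_trans (bernoulli_le M t01).
have : M%:R * t <= 1 - mu `^ (q - 1).
  have Mc : M%:R * c = mass r1 * (1 - mu `^ (q - 1)).
    by rewrite /c mulrC divfK// gt_eqF.
  rewrite /t mulrA ler_pdivrMr// Mc mulrC ler_pM2l ?subr_gt0//.
  by apply: le_trans Ir _; rewrite lerDl ltW.
lra.
Qed.

Let radial_profile_ge0 xi W r : radial_profile xi W -> 0 <= r <= 1 -> 0 <= W r.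
Proof.
move=> [_ W1 Wd _] /andP[r0]; rewrite le_eqVlt => /orP[/eqP ->|r1].
  by rewrite W1.
by rewrite -W1 ltW// Wd.
Qed.

Lemma exists_profiles : exists W0 : R -> R, radial_profile (fun=> 1) W0 /\
  forall nu, 0 < nu < 1 -> exists (W xi : R -> R) (K : R),
  [/\ forall r, 0 < r -> 0 <= xi r <= 1, radial_profile xi W, 0 < K,
      forall r, 0 <= r <= 1 -> W 0 - W r <= K * r ^+ 4 &
      forall r, 0 <= r <= 1 -> nu * W0 r <= W r].
Proof.
have [W0 [W01 dW0]] := antislope (lexx 0).
have P0' := slope_profile (lexx 0) W01 dW0.
have P0 : radial_profile (fun=> 1) W0.
  case: P0' => h1 h2 h3 h4; split=> // r0 z r00 z0.
  have [w1 [w2 [g1 g2 g3 g4]]] := h4 _ _ r00 z0.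
  exists w1, w2; split=> // A A0; rewrite g4// /flux_ratio.
  have rz : 0 < Num.sqrt z / r0 by rewrite divr_gt0// sqrtr_gt0.
  have -> : cut 0 (Num.sqrt z / r0) = 1.
    by rewrite /cut addr0 divff// gt_eqF// mass_gt0.
  by rewrite mul0r mulr0 addr0 expr1n mulr1.
exists W0; split=> // nu /andP[nu0 nu1].
(* The loss nu is shared equally: one factor mu for the comparison of slopes beyond [r1], one for
   the variation of [W0] between 0 and [r1]. *)
pose mu := Num.sqrt nu.
have mu0 : 0 < mu by rewrite sqrtr_gt0.
have mu2 : mu ^+ 2 = nu by rewrite sqr_sqrtr// ltW.
have mu1 : mu < 1.
  rewrite ltNge; apply/negP => /(exprn_ege1 2); rewrite mu2; lra.
have [cW0 _ W0d _] := P0.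
have W00 : 0 < W0 0 by have := W0d 0 1 (lexx _) ltr01; rewrite W01.
have [r1 /andP[r10 r11] Wr1] : exists2 r, 0 < r < 1 & mu * W0 0 <= W0 r.
  have c0 := cW0 0 (ltrN10 R).
  have /near_abs_lt[dl dl0 H] : \forall r \near (0 : R), mu * W0 0 < W0 r.
    by apply: (cvgr_gt _ c0); rewrite gtr_pMl.
  exists (Num.min (dl / 2) (1 / 2)).
    rewrite lt_min divr_gt0//= gt_min; apply/andP; split; lra.
  apply/ltW/H; rewrite subr0 gtr0_norm.
    by rewrite gt_min; apply/orP; left; lra.
  by rewrite lt_min divr_gt0//=; lra.
have mu01 : 0 < mu < 1 by rewrite mu0.
have [c c0 Hc] := slope_compare r10 mu01.
have [W [W1 dW]] := antislope (ltW c0).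
have PW := slope_profile (ltW c0) W1 dW.
have [K K0 HK] := slope_cubic c0.
have [_ _ Wd _] := PW.
(* The inequality of slopes is integrated inwards from r = 1, where both profiles vanish. *)
have Wge r : r1 <= r <= 1 -> mu * W0 r <= W r.
  move=> /andP[r1r rr1]; rewrite -subr_ge0.
  have := @derive_le0_noninc _ (fun s => W s - mu * W0 s)
    (fun s => - slope c s - mu * (- slope 0 s)) r 1 rr1.
  rewrite W1 W01 mulr0 subr0; apply.
    move=> s /andP[rs _]; apply: is_deriveB; first by apply: dW; lra.
    by apply: is_deriveZ; apply: dW0; lra.
  move=> s /andP[rs _]; have := Hc s; lra.
exists W, (flux_ratio c), K; split=> //.
- by move=> r r0; apply: flux_ratio_itv => //; exact: ltW.
- move=> r /andP[r0 rr1].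
  have := @derive_le0_noninc _ (fun s => - W s - K * s ^+ 4)
    (fun s => - - slope c s - K * (4 * s ^+ 3)) 0 r r0.
  rewrite expr0n/= mulr0 subr0 => H.
  suff : - W r - K * r ^+ 4 <= - W 0 by lra.
  apply: H.
    move=> s /andP[s0 _]; apply: is_deriveB.
      by apply: is_deriveN; apply: dW; lra.
    have := is_deriveZ K (is_deriveX 4 (is_derive_id s (1 : R))).
    by rewrite /GRing.scale/= mulr1.
  move=> s /andP[s0 sr]; have := HK s; rewrite s0 (le_trans (ltW sr) rr1).
  move=> /(_ isT) h; have := exprn_gt0 3 s0 => s3.
  have : K * s ^+ 3 <= K * (4 * s ^+ 3) by rewrite ler_pM2l//; lra.
  lra.
move=> r /andP[r0 rr1]; have [h|h] := leP r1 r.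
  apply: le_trans (Wge r _); last by rewrite h.
  rewrite -mu2 expr2 -mulrA ler_pM2l// ler_piMl ?(ltW mu1)//.
  by apply: radial_profile_ge0 P0 _; rewrite r0.
apply: (@le_trans _ _ (W r1)); last first.
  by apply/ltW/Wd.
apply: (@le_trans _ _ (mu * W0 r1)); last by apply: Wge; rewrite lexx ltW.
rewrite -mu2 expr2 -mulrA ler_pM2l//; apply: le_trans Wr1.
rewrite ler_pM2l//; move: r0; rewrite le_eqVlt => /orP[/eqP <-//|r0].
by apply/ltW/W0d.
Qed.

End Profile.

(** * Identification of V with the explicit profile *)

Section StationaryComparison.
Context {R : realType} (n : nat) (p q : R) (V : R -> R).
Hypotheses (hn : (2 <= n)%N) (hp : 1 < p) (hq : 2 < q).
Hypothesis hV : is_profile n p q V.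

Let V_cont : {within `[0, 1], continuous V}. Proof. by case: hV. Qed.
Let V_gt0 : forall r, 0 <= r < 1 -> 0 < V r. Proof. by case: hV. Qed.
Let V1 : V 1 = 0. Proof. by case: hV. Qed.

Lemma exists_enorm (r : R) : 0 <= r -> exists x : 'rV[R]_n, enorm x = r.
Proof.
move=> r0; pose i0 := Ordinal (ltnW hn : (0 < n)%N).
exists (r *: delta_mx ord0 i0); rewrite enormZ ger0_norm// enormE.
by rewrite dot_delta mxE !eqxx sqrtr1 mulr1.
Qed.

Lemma Vext_enorm (x : 'rV[R]_n) : enorm x <= 1 -> Vext V (enorm x) = V (enorm x).
Proof. by move=> x1; rewrite VextE// enorm_ge0. Qed.

Let v (x : 'rV[R]_n) := V (enorm x).

Let v_sided e : e = 1 \/ e = -1 -> sided_stationary p q e v.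
Proof. by case: hV => _ _ _ hs; exact: stationary_sided. Qed.

Let continuous_Vn : continuous (fun x : 'rV[R]_n => Vext V (enorm x)).
Proof.
move=> x; apply: (@continuous_comp _ _ _ (@enorm R n) (Vext V)).
  exact: continuous_enorm.
exact: continuous_Vext.
Qed.

Let cball_closure : compact (cball (0 : 'rV[R]_n) 1).
Proof. exact: compact_cball. Qed.

Let cball0 : cball (0 : 'rV[R]_n) 1 !=set0.
Proof. by exists 0; rewrite /cball /= subrr enorm0. Qed.

Let v_bounded : exists M, forall x : 'rV[R]_n, unit_ball x -> `|v x| <= M.
Proof.
have [m _ mP] := exists_max cball_closure cball0
  (continuous_subspaceT continuous_Vn).
exists (Vext V (enorm m)) => x /unit_ball_le x1.
have := mP x; rewrite /cball /= subr0 => /(_ x1).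
rewrite Vext_enorm// -/(v x) ger0_norm//.
by rewrite /v -Vext_enorm// Vext_ge0.
Qed.

Lemma continuous_radial (W : R -> R) (r0 : R) (y : 'rV[R]_n) : 0 < r0 ->
  (forall r, -1 < r -> {for r, continuous W}) ->
  continuous (fun x : 'rV[R]_n => W (enorm (x - y) / r0)).
Proof.
move=> r00 cW x; apply: (@continuous_comp _ _ _
  (fun x : 'rV[R]_n => enorm (x - y) / r0) W).
  have := cvgM (@continuous_enormB R n y x) (cvg_cst r0^-1); exact.
apply: cW; apply: (@lt_le_trans _ _ 0); first by rewrite ltrN10.
by rewrite divr_ge0 ?enorm_ge0// ltW.
Qed.

Lemma sqrt_dist2 (y x : 'rV[R]_n) : Num.sqrt (dist2 y x) = enorm (x - y).
Proof. by rewrite dist2E sqrtr_sqr ger0_norm// enorm_ge0. Qed.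

Lemma radial_profile_frad (xi W : R -> R) (r0 lam z : R) :
  radial_profile n p q V xi W -> 0 < r0 -> 0 < z -> 0 < lam ->
  exists (w1 : R -> R) (w2 : R),
  [/\ \forall s \near z, is_derive (s : R) 1 (fun s => lam * W (Num.sqrt s / r0)) (w1 s),
      is_derive z 1 w1 w2, w1 z < 0 &
      Frad n p q (w1 z) (w2 / 2) z = - (lam `^ (q - 1) * r0 `^ (- q) * ((q - 2)^-1
         * (xi (Num.sqrt z / r0) * Vext V (Num.sqrt z / r0))))].
Proof.
move=> [_ _ _ H] r00 z0 lam0; have [w1 [w2 [d1 d2 w10 F]]] := H _ _ r00 z0.
exists (fun s => lam * w1 s), (lam * w2); split.
- by apply: filterS d1 => s ds; exact: is_deriveZ.
- exact: is_deriveZ.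
- by rewrite pmulr_rlt0.
- by rewrite -F.
Qed.

(** A positive maximum of lam W - V would be a contact from below. Away from the origin it gives V
    <= lam^(q-1) xi V, impossible as lam < 1 and xi <= 1. At the origin the fourth-order flatness of
    W gives V(0) <= 0, which is why a flattened profile replaces [W0]. *)
Let lower (W0 : R -> R) (lam nu r : R) : 0 < lam < 1 -> 0 < nu < 1 ->
  (exists (W xi : R -> R) (K : R),
  [/\ forall r, 0 < r -> 0 <= xi r <= 1, radial_profile n p q V xi W, 0 < K,
      forall r, 0 <= r <= 1 -> W 0 - W r <= K * r ^+ 4 &
      forall r, 0 <= r <= 1 -> nu * W0 r <= W r]) ->
  0 <= r <= 1 -> lam * (nu * W0 r) <= V r.
Proof.
move=> /andP[lam0 lam1] nu01 [W [xi [K [xi01 PW K0 WK Wnu]]]] /andP[r0 r1].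
apply: (@le_trans _ _ (lam * W r)); first by rewrite ler_pM2l// Wnu ?r0.
have [cW W1 Wd _] := PW.
pose f (x : 'rV[R]_n) := lam * W (enorm (x - 0) / 1) - Vext V (enorm x).
have [x0 /= bx0 x0max] : exists2 a, cball (0 : 'rV[R]_n) 1 a &
    forall b, cball 0 1 b -> f b <= f a.
  apply: exists_max => //; apply: continuous_subspaceT => x.
  exact: (cvgB (cvgM (cvg_cst lam) (@continuous_radial W 1 0 ltr01 cW x))
    (@continuous_Vn x)).
rewrite /cball /= subr0 in bx0.
have fE (x : 'rV[R]_n) : enorm x <= 1 -> f x = lam * W (enorm x) - v x.
  by move=> x1; rewrite /f subr0 divr1 Vext_enorm.
have [h|h] := leP (f x0) 0.
  have [x xr] := exists_enorm r0.
  have := x0max x; rewrite /cball /= subr0 xr => /(_ r1).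
  rewrite fE ?xr// /v xr; lra.
exfalso.
have ux0 : unit_ball x0.
  rewrite /unit_ball /= lt_neqAle bx0 andbT; apply/eqP => x01.
  by move: h; rewrite fE ?bx0// /v x01 W1 V1 mulr0 subrr ltxx.
have vx0 : 0 < v x0 by rewrite /v V_gt0// enorm_ge0.
have [M vM] := v_bounded.
have e2 : (-1 : R) ^+ 2 = 1 by rewrite sqrrN expr1n.
have a0 : 0 < (q - 2)^-1 by rewrite invr_gt0 subr_gt0.
have cmp x : unit_ball x ->
    - (v x - v x0) <= - (lam * W (enorm x) - lam * W (enorm x0)).
  move=> ux; have := x0max x; rewrite /cball /= subr0 => /(_ (unit_ball_le ux)).
  rewrite !fE ?(unit_ball_le ux)//; lra.
have [x00|x00] := eqVneq x0 0.
  have H x : unit_ball x -> enorm (x - x0) < 1 ->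
      -1 * (v x - v x0) <= 0 * (dist2 0 x - dist2 0 x0)
        + (lam * K) * (dist2 0 x - dist2 0 x0) ^+ 2.
    move=> ux _; rewrite mulN1r; apply: le_trans (cmp x ux) _.
    rewrite x00 !dist2E !subr0 enorm0 mul0r add0r expr0n/= subr0 -exprM.
    rewrite -mulrBr -mulrN -mulrA ler_pM2l// opprB; apply: WK.
    by rewrite enorm_ge0 unit_ball_le.
  have := sided_stationary_contact hq e2 (v_sided (or_intror erefl)) vM ux0
    ltr01 H.
  rewrite /Frad x00 dist2E subrr enorm0 expr0n/= sqrtr0 mulr0 powR0; last first.
    by rewrite subr_eq0 gt_eqF.
  rewrite mul0r add0r pmulr_rge0// mulN1r oppr_ge0 leNgt -x00.
  by rewrite vx0.
have z0 : 0 < dist2 0 x0 by rewrite /dist2 subr0 dotxx_gt0.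
have [w1 [w2 [d1 d2 _ F]]] := radial_profile_frad PW ltr01 z0 lam0.
have H x : unit_ball x -> enorm (x - x0) < 1 -> -1 * (v x - v x0) <=
    -1 * (lam * W (Num.sqrt (dist2 0 x) / 1) - lam * W (Num.sqrt (dist2 0 x0) / 1)).
  by move=> ux _; rewrite !mulN1r !sqrt_dist2 !subr0 !divr1; exact: cmp.
have := stationary_barrier hq e2 (v_sided (or_intror erefl)) vM ux0 ltr01 d1 d2 H.
rewrite F mulN1r oppr_ge0 powR1 mulr1 sqrt_dist2 subr0 divr1.
rewrite Vext_enorm// -/(v x0) => h1.
have x0e : 0 < enorm x0 by rewrite enorm_gt0.
have /andP[xi0 xi1] := xi01 _ x0e.
have lq : lam `^ (q - 1) < 1.
  have e1 : (1 : R) `^ (q - 1) = 1 by rewrite powR1.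
  rewrite -[ltRHS]e1 gt0_ltr_powR ?nnegrE ?(ltW lam0)//; move: hq; lra.
have : lam `^ (q - 1) * (xi (enorm x0) * v x0) < v x0.
  apply: (@le_lt_trans _ _ (lam `^ (q - 1) * v x0)).
    by rewrite ler_wpM2l ?powR_ge0// ler_piMl// ltW.
  by rewrite gtr_pMl.
rewrite -(ltr_pM2l a0).
have -> : (q - 2)^-1 * (lam `^ (q - 1) * (xi (enorm x0) * v x0))
  = lam `^ (q - 1) * ((q - 2)^-1 * (xi (enorm x0) * v x0)) by ring.
lra.
Qed.

(** The maximum of V - lam W0(|x - c|) cannot lie off the centre c, since there the source is
    multiplied by lam^(q-1) > 1. A contact at c itself is consistent with the equation, so two
    centres 0 and y are used: adding the two maximum inequalities, the values of V cancel and
    W0(|y|) >= W0(0) remains, against strict monotonicity. *)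
Let upper (W0 : R -> R) (lam r : R) : 1 < lam ->
  radial_profile n p q V (fun=> 1) W0 -> 0 <= r <= 1 -> V r <= lam * W0 r.
Proof.
move=> lam1 PW /andP[r0 r1]; rewrite leNgt; apply/negP => gap.
have lam0 : 0 < lam by exact: lt_trans lam1.
have [cW W1 Wd _] := PW.
have Wle s t : 0 <= s -> s <= t -> W0 t <= W0 s.
  by move=> s0; rewrite le_eqVlt => /orP[/eqP ->//|st]; apply/ltW/Wd.
pose g := V r - lam * W0 r.
have g0 : 0 < g by rewrite subr_gt0.
have lq : 1 < lam `^ (q - 1).
  have e1 : (1 : R) `^ (q - 1) = 1 by rewrite powR1.
  rewrite -[ltLHS]e1 gt0_ltr_powR ?nnegrE ?(ltW lam0)//; move: hq; lra.
pose L := lam `^ (q - 1).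
(* Moving the centre replaces V(|x|) by V(|x - c|) in the source. An error below [om] costs L om =
   (L-1) g/8, half of the available margin (L-1) g/4. *)
pose om := (L - 1) * (g / 4) / (2 * L).
have L0 : 0 < L by exact: lt_trans lq.
have om0 : 0 < om.
  by apply: divr_gt0; rewrite mulr_gt0// ?subr_gt0// divr_gt0.
have [x1 x1r] := exists_enorm r0.
have cWn y : continuous (fun x : 'rV[R]_n => W0 (enorm (x - y) / 1)).
  exact: continuous_radial.
have cflip (x : 'rV[R]_n) : continuous (fun y : 'rV[R]_n => enorm (x - y)).
  by under eq_fun do rewrite enormB; exact: continuous_enormB.
have n1 : \forall y \near (0 : 'rV[R]_n), W0 (enorm (x1 - y)) < W0 r + g / (4 * lam).
  have c : {for 0, continuous (fun y : 'rV[R]_n => W0 (enorm (x1 - y)))}.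
    apply: (@continuous_comp _ _ _ (fun y : 'rV[R]_n => enorm (x1 - y)) W0).
      exact: cflip.
    by apply: cW; apply: (@lt_le_trans _ _ 0); rewrite ?ltrN10 ?enorm_ge0.
  apply: (cvgr_lt _ c); rewrite subr0 x1r ltrDl divr_gt0// mulr_gt0//.
(* |x - c| may exceed 1, where [W0] is negative; for a small shift this takes away no more than g/4
   from the gap. *)
have n2 : \forall y \near (0 : 'rV[R]_n), - (g / (4 * lam)) < W0 (1 + enorm y).
  have c : {for 0, continuous (fun y : 'rV[R]_n => W0 (1 + enorm y))}.
    apply: (@continuous_comp _ _ _ (fun y : 'rV[R]_n => 1 + enorm y) W0).
      exact: (cvgD (cvg_cst (1 : R)) (@continuous_enorm R n 0)).
    by apply: cW; rewrite enorm0 addr0; apply: lt_trans ltr01; rewrite ltrN10.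
  apply: (cvgr_gt _ c); rewrite enorm0 addr0 W1 oppr_lt0 divr_gt0// mulr_gt0//.
have n3 : \forall y \near (0 : 'rV[R]_n), cball 0 1 `<=`
    [set x | `|Vext V (enorm x) - Vext V (enorm (x - y))| < om].
  have ncov := (compact_near_coveringP (cball (0 : 'rV[R]_n) 1)).1 cball_closure.
  apply: (ncov _ (nbhs (0 : 'rV[R]_n)) (fun y x =>
    `|Vext V (enorm x) - Vext V (enorm (x - y))| < om) _) => x _.
  pose D (xy : 'rV[R]_n * 'rV[R]_n) :=
    Vext V (enorm xy.1) - Vext V (enorm (xy.1 - xy.2)).
  have cD : {for (x, 0), continuous D}.
    have s1 : {for (x, 0), continuous (fun xy : 'rV[R]_n * 'rV[R]_n =>
        Vext V (enorm xy.1))}.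
      apply: (@continuous_comp _ _ _ fst (fun x : 'rV[R]_n => Vext V (enorm x))).
        exact: cvg_fst.
      exact: continuous_Vn.
    have s2 : {for (x, 0), continuous (fun xy : 'rV[R]_n * 'rV[R]_n =>
        Vext V (enorm (xy.1 - xy.2)))}.
      apply: (@continuous_comp _ _ _ (fun xy : 'rV[R]_n * 'rV[R]_n => xy.1 - xy.2)
        (fun x : 'rV[R]_n => Vext V (enorm x))).
        exact: (cvgB (@cvg_fst _ _ (nbhs x) (nbhs 0) _)
          (@cvg_snd _ _ (nbhs x) (nbhs 0) _)).
      exact: continuous_Vn.
    exact: (cvgB s1 s2).
  have D0 : D (x, 0) = 0 by rewrite /D /= subr0 subrr.
  have : \forall xy \near (x, (0 : 'rV[R]_n)), `|D xy| < om.
    have /cvgrPdist_lt/(_ _ om0) := cD; apply: filterS => xy.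
    by rewrite D0 sub0r normrN.
  exact.
have [d d0 Hd] := exists_enorm_ball
  (filterI (filterI n1 n2) n3 : \forall y \near (0 : 'rV[R]_n), _).
have [y [y0 yd uy]] : exists y : 'rV[R]_n,
    [/\ 0 < enorm y, enorm y < d & unit_ball y].
  pose m := Num.min (d / 2) (1 / 2).
  have m0 : 0 < m by rewrite lt_min divr_gt0//=; lra.
  have [y yE] := exists_enorm (ltW m0); exists y.
  by rewrite /unit_ball /= yE m0 !gt_min; split=> //; apply/orP; [left|right]; lra.
have [M vM] := v_bounded.
have a0 : 0 < (q - 2)^-1 by rewrite invr_gt0 subr_gt0.
have e2 : (1 : R) ^+ 2 = 1 by rewrite expr1n.
have lg : lam * (g / (4 * lam)) = g / 4 by field; rewrite gt_eqF.
pose f (c x : 'rV[R]_n) := Vext V (enorm x) - lam * W0 (enorm (x - c) / 1).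
have cf c : continuous (f c).
  move=> x; exact: (cvgB (@continuous_Vn x)
    (cvgM (cvg_cst lam) (@continuous_radial W0 1 c ltr01 cW x))).
have centre c : enorm c < d -> forall x, unit_ball x -> f c x <= f c c.
  move=> cd x ux.
  have := Hd c; rewrite subr0 => /(_ cd)[[c1 c2] c3].
  have [x0 /= bx0 x0max] := exists_max cball_closure cball0
    (continuous_subspaceT (cf c)).
  rewrite /cball /= subr0 in bx0.
  have gle : 3 / 4 * g <= f c x0.
    have := x0max x1; rewrite /cball /= subr0 x1r => /(_ r1); apply: le_trans.
    rewrite /f divr1 x1r VextE ?r0// /g.
    have := c1; rewrite -(ltr_pM2l lam0) mulrDr lg /g; lra.
  have Wge z : enorm z <= 1 -> - (g / 4) < lam * W0 (enorm (z - c)).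
    move=> z1; rewrite -lg -mulrN ltr_pM2l//; apply: lt_le_trans c2 _.
    apply: Wle; first exact: enorm_ge0.
    by apply: le_trans (ler_enormD _ _) _; rewrite enormN lerD2r.
  have ux0 : unit_ball x0.
    rewrite /unit_ball /= lt_neqAle bx0 andbT; apply/eqP => x01.
    move: gle (Wge _ bx0); rewrite /f x01 Vext_ge1// divr1; lra.
  have vE z : unit_ball z -> Vext V (enorm z) = v z.
    by move=> /unit_ball_le z1; rewrite Vext_enorm.
  have [x0c|x0c] := eqVneq x0 c.
    by rewrite -[X in _ <= f _ X]x0c; apply: x0max; rewrite /cball /= subr0 unit_ball_le.
  exfalso.
  have z0 : 0 < dist2 c x0 by rewrite /dist2 dotxx_gt0 subr_eq0.
  have [w1 [w2 [d1 d2 _ F]]] := radial_profile_frad PW ltr01 z0 lam0.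
  have H z : unit_ball z -> enorm (z - x0) < 1 -> 1 * (v z - v x0) <=
      1 * (lam * W0 (Num.sqrt (dist2 c z) / 1) - lam * W0 (Num.sqrt (dist2 c x0) / 1)).
    move=> uz _; rewrite !mul1r !sqrt_dist2.
    have := x0max z; rewrite /cball /= subr0 => /(_ (unit_ball_le uz)).
    by rewrite /f !vE//; lra.
  have := stationary_barrier hq e2 (v_sided (or_introl erefl)) vM ux0 ltr01 d1 d2 H.
  rewrite F mul1r powR1 mulr1 sqrt_dist2 divr1 mul1r -/L.
  have -> : - (L * ((q - 2)^-1 * Vext V (enorm (x0 - c)))) + (q - 2)^-1 * v x0
    = (q - 2)^-1 * (v x0 - L * Vext V (enorm (x0 - c))) by ring.
  rewrite pmulr_rge0// => h1.
  have := c3 x0; rewrite /cball /= subr0 => /(_ bx0).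
  rewrite vE// => /ltr_normlP[_ h2].
  have h3 : L * (v x0 - Vext V (enorm (x0 - c))) < L * om by rewrite ltr_pM2l.
  have h4 : L * om = (L - 1) * (g / 4) / 2 by rewrite /om; field; rewrite gt_eqF.
  have h5 : g / 4 <= v x0.
    move: gle (Wge _ bx0); rewrite /f divr1 vE//; lra.
  have h6 : (L - 1) * (g / 4) <= (L - 1) * v x0 by rewrite ler_pM2l// subr_gt0.
  have : 0 < (L - 1) * (g / 4) by rewrite mulr_gt0// ?subr_gt0// divr_gt0.
  lra.
have u0 : unit_ball (0 : 'rV[R]_n) by rewrite /unit_ball /= enorm0.
have d00 : enorm (0 : 'rV[R]_n) < d by rewrite enorm0.
have := centre _ d00 _ uy; have := centre _ yd _ u0.
have := Wd 0 (enorm y) (lexx _) y0.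
rewrite -(ltr_pM2l lam0).
rewrite /f !divr1 !subrr !subr0 sub0r enormN enorm0; lra.
Qed.

Lemma profile_eq (W0 : R -> R) : radial_profile n p q V (fun=> 1) W0 ->
  (forall nu, 0 < nu < 1 -> exists (W xi : R -> R) (K : R),
  [/\ forall r, 0 < r -> 0 <= xi r <= 1, radial_profile n p q V xi W, 0 < K,
      forall r, 0 <= r <= 1 -> W 0 - W r <= K * r ^+ 4 &
      forall r, 0 <= r <= 1 -> nu * W0 r <= W r]) ->
  forall r, 0 <= r <= 1 -> V r = W0 r.
Proof.
move=> PW HW r r01; have [_ W1 Wd _] := PW.
have W0r : 0 <= W0 r.
  move: r01 => /andP[r0]; rewrite le_eqVlt => /orP[/eqP ->|r1].
    by rewrite W1.
  by rewrite -W1 ltW// Wd.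
apply/eqP; rewrite eq_le; apply/andP; split.
  apply: (@le_of_perturbation _ _ _ (W0 r)) => eta /andP[eta0 _].
  have := upper (_ : 1 < 1 + eta) PW r01; rewrite ltrDl => /(_ eta0); lra.
apply: (@le_of_perturbation _ _ _ (W0 r)) => eta /andP[eta0 eta1].
pose nu := 1 - eta / 2.
have nu01 : 0 < nu < 1 by rewrite /nu; lra.
have := lower nu01 nu01 (HW _ nu01) r01.
have : (1 - eta) * W0 r <= nu * (nu * W0 r).
  rewrite mulrA ler_wpM2r//; have := sqr_ge0 (eta / 2).
  rewrite /nu; lra.
lra.
Qed.

End StationaryComparison.

(** * Separated barriers *)

Section Penalty.
Context {R : realType}.

(** An exponential exp(L (t - t1)) with large L. It is smaller than the supposed gap at t1 and
    larger than every possible gap at t1 + 1, so a penalized maximum is not at the final time; the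
    strict sign of P1 supplies the final contradiction. *)
Lemma penalty (eps Mx t1 : R) : 0 < eps -> exists P P1 P2 : R -> R,
  [/\ forall t : R, is_derive t 1 P (P1 t), forall t : R, is_derive t 1 P1 (P2 t),
      forall t, 0 < P t, forall t, 0 < P1 t & P t1 = eps /\ Mx < P (t1 + 1)].
Proof.
move=> eps0; pose L := `|Mx| / eps + 1.
have L0 : 0 < L by rewrite ltr_wpDl// divr_ge0// ltW.
pose E (t : R) := expR (L * (t - t1)).
have dE (t : R) : is_derive t 1 E (L * E t).
  have h : is_derive t 1 (fun t : R => L * (t - t1)) L.
    have := is_deriveZ L (is_deriveD (is_derive_id t (1 : R))
      (is_derive_cst (- t1) t 1)).
    by rewrite addr0 [_ *: 1]mulr1.
  by rewrite mulrC; exact: is_derive_comp1 h (is_derive_expR _).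
exists (fun t => eps * E t), (fun t => eps * (L * E t)),
  (fun t => eps * (L * (L * E t))).
have E0 t : 0 < E t by exact: expR_gt0.
split=> [t|t|t|t|].
- exact: is_deriveZ (dE t).
- exact: is_deriveZ (is_deriveZ L (dE t)).
- by rewrite mulr_gt0.
- by rewrite !mulr_gt0.
split; first by rewrite /E subrr mulr0 expR0 mulr1.
rewrite /E addrAC subrr add0r mulr1.
have : eps * (1 + L) <= eps * expR L by rewrite ler_pM2l// expR_ge1Dx.
have -> : eps * (1 + L) = 2 * eps + `|Mx| by rewrite /L; field; rewrite gt_eqF.
have := ler_norm Mx; lra.
Qed.

Variable q : R.
Hypothesis hq : 2 < q.
Local Notation a := ((q - 2)^-1).

Let q2 : 0 < q - 2. Proof. by rewrite subr_gt0. Qed.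

Definition amp (mu tau t : R) : R := mu * (t + tau) `^ (- a).
Definition amp1 (mu tau t : R) : R := - (a * mu * (t + tau) `^ (- a - 1)).

Lemma amp_gt0 mu tau t : 0 < mu -> 0 < t + tau -> 0 < amp mu tau t.
Proof. by move=> mu0 tt; rewrite mulr_gt0 ?powR_gt0. Qed.

Lemma is_derive_powR_shift (b tau t : R) : 0 < t + tau ->
  is_derive t 1 (fun t : R => (t + tau) `^ b) (b * (t + tau) `^ (b - 1)).
Proof.
move=> tt; have h : is_derive t 1 (fun t : R => t + tau) 1.
  by have := is_deriveD (is_derive_id t (1 : R)) (is_derive_cst tau t 1);
    rewrite addr0.
by have := is_derive_comp1 h (@is_derive1_powR R b _ tt); rewrite mulr1.
Qed.

Lemma is_derive_amp mu tau (t : R) : 0 < t + tau ->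
  is_derive t 1 (amp mu tau) (amp1 mu tau t).
Proof.
move=> tt; have := is_deriveZ mu (is_derive_powR_shift (- a) tt).
have -> : mu *: (- a * (t + tau) `^ (- a - 1)) = amp1 mu tau t.
  by rewrite /amp1 /GRing.scale/=; ring.
exact.
Qed.

Lemma is_derive_amp1 mu tau (t : R) : 0 < t + tau ->
  is_derive t 1 (amp1 mu tau)
    (- (a * mu) * ((- a - 1) * (t + tau) `^ (- a - 1 - 1))).
Proof.
move=> tt; have := is_deriveZ (- (a * mu)) (is_derive_powR_shift (- a - 1) tt).
suff -> : - (a * mu) \*: (fun t : R => (t + tau) `^ (- a - 1)) = amp1 mu tau by [].
by apply/funext => s; exact: mulNr.
Qed.

Lemma near_shift_gt0 (t tau : R) : 0 < t + tau -> \forall s \near t, 0 < s + tau.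
Proof.
move=> tt; near=> s; rewrite -ltrBlDr sub0r; near: s.
by apply: lt_nbhsr; lra.
Unshelve. all: by end_near. Qed.

(* a (q - 1) = a + 1, so that [amp] solves A' = - a A^(q-1) for mu = 1. *)
Lemma amp_pow mu tau t : 0 < mu -> 0 < t + tau ->
  amp mu tau t `^ (q - 1) = mu * mu `^ (q - 2) * (t + tau) `^ (- a - 1).
Proof.
move=> mu0 tt; rewrite /amp powRM ?powR_ge0 ?(ltW mu0)// -powRrM.
have -> : - a * (q - 1) = - a - 1 by field; rewrite gt_eqF.
have q10 : 0 < q - 1 by move: hq; lra.
congr (_ * _); rewrite -(mulr_powRB1 (ltW mu0) q10); congr (_ * _ `^ _); ring.
Qed.

End Penalty.

Section RadialBarriers.
Context {R : realType} (n : nat) (p q : R) (V : R -> R).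
Hypotheses (hn : (2 <= n)%N) (hp : 1 < p) (hq : 2 < q).
Hypothesis hV : is_profile n p q V.
Local Notation a := ((q - 2)^-1).

(** By [amp_pow] the time derivative and F carry the same power of t + tau, so everything reduces to
    the sign of mu^(q-2) r0^(-q) xi V - W. The penalty is entered as e P, and e^2 = 1 restores
    P1. *)
Lemma amp_contact (e : R) (u : 'rV[R]_n * R -> R) x0 y
    (t0 d r0 mu tau : R) (xi W P P1 P2 : R -> R) :
  e = 1 \/ e = -1 -> sided p q e u -> locally_bounded u ->
  radial_profile n p q V xi W ->
  unit_ball x0 -> 0 < t0 -> x0 != y -> 0 < d -> 0 < r0 -> 0 < mu ->
  0 < t0 + tau ->
  (forall t : R, is_derive t 1 P (P1 t)) -> (forall t : R, is_derive t 1 P1 (P2 t)) ->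
  (forall x (t : R), unit_ball x -> 0 < t -> enorm (x - x0) < d ->
     `|t - t0| < d ->
     e * (u (x, t) - amp q mu tau t * W (enorm (x - y) / r0)) - P t <=
     e * (u (x0, t0) - amp q mu tau t0 * W (enorm (x0 - y) / r0)) - P t0) ->
  e * (a * mu * (t0 + tau) `^ (- a - 1)
       * (mu `^ (q - 2) * r0 `^ (- q) * (xi (enorm (x0 - y) / r0)
            * Vext V (enorm (x0 - y) / r0)) - W (enorm (x0 - y) / r0)))
    + P1 t0 <= 0.
Proof.
move=> ee usol ub PW bx0 t00 x0y d0 r00 mu0 tt dP dP1 H.
have e2 : e ^+ 2 = 1 by case: ee => ->; rewrite ?sqrrN expr1n.
have z0 : 0 < dist2 y x0 by rewrite /dist2 dotxx_gt0 subr_eq0.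
have [_ _ _ Hj] := PW; have [w1 [w2 [d1 d2 w10 F]]] := Hj _ _ r00 z0.
have A0 := amp_gt0 q mu0 tt.
have dA : \forall s \near t0, is_derive (s : R) 1 (amp q mu tau) (amp1 q mu tau s).
  by apply: filterS (near_shift_gt0 tt) => s; exact: is_derive_amp.
have dB : \forall s \near t0, is_derive (s : R) 1 (fun s => e * P s) (e * P1 s).
  by apply/nbhs_ballP; exists 1 => //= s _; exact: is_deriveZ (dP s).
have dB1 := is_deriveZ e (dP1 t0).
have := @sided_barrier _ n p q hq e e2 u x0 y t0 d _ _ _ _ _ _ _ _ _ usol ub bx0
  t00 x0y d0 dA (is_derive_amp1 q mu tt) dB dB1 d1 d2.
rewrite (gt_eqF A0) (lt_eqF w10) => /(_ isT isT).
have HH x (t : R) : unit_ball x -> 0 < t -> enorm (x - x0) < d -> `|t - t0| < d ->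
   e * (u (x, t) - u (x0, t0)) <=
   e * (amp q mu tau t * W (Num.sqrt (dist2 y x) / r0) + e * P t
     - (amp q mu tau t0 * W (Num.sqrt (dist2 y x0) / r0) + e * P t0)).
  move=> bx t_gt0 xd td; rewrite !sqrt_dist2.
  have := H x t bx t_gt0 xd td.
  set W1 := W _; set W2 := W (enorm (x0 - y) / r0).
  have -> : e * (amp q mu tau t * W1 + e * P t
      - (amp q mu tau t0 * W2 + e * P t0))
    = e * (amp q mu tau t * W1 - amp q mu tau t0 * W2) + e ^+ 2 * (P t - P t0).
    by ring.
  rewrite e2 !mulrBr; lra.
move=> /(_ HH); rewrite F// amp_pow// sqrt_dist2.
set W0 := W _; set X := xi _ * _; set T := _ `^ (- a - 1).
rewrite /amp1 -/T.
have -> : e * (- (a * mu * T) * W0 + e * P1 t0)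
  = - (e * (a * mu * T * W0)) + e ^+ 2 * P1 t0 by ring.
rewrite e2.
have -> : e * - (mu * mu `^ (q - 2) * T * r0 `^ (- q) * (a * X))
  = - (e * (a * mu * T * (mu `^ (q - 2) * r0 `^ (- q) * X))) by ring.
rewrite mulrBr mulrBr; lra.
Qed.

End RadialBarriers.

(** * Negative powers of the distance *)

Section PowerProfile.
Context {R : realType} (n : nat) (p q : R).
Hypotheses (hp : 1 < p) (hq : 2 < q).

Lemma is_derive_powR_profile (k c z : R) : 0 < z ->
  is_derive z 1 (fun s : R => s `^ (- k) - c) (- k * z `^ (- k - 1)).
Proof.
move=> z0; have := is_deriveB (@is_derive1_powR R (- k) z z0) (is_derive_cst c z 1).
by rewrite subr0.
Qed.

Lemma is_derive1_powR_profile (k z : R) : 0 < z ->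
  is_derive z 1 (fun s : R => - k * s `^ (- k - 1))
    (- k * ((- k - 1) * z `^ (- k - 1 - 1))).
Proof.
move=> z0; have := is_deriveZ (- k) (@is_derive1_powR R (- k - 1) z z0); exact.
Qed.

(** For large k the radial second derivative outweighs the first-order terms. On z <= 1 both factors
    of [Frad] are then bounded below independently of z, by A^(q-2) and A. *)
Lemma powR_profile_frad (k A z : R) : 1 <= k ->
  2 * (n%:R + p - 2) + 1 <= 4 * (k + 1) * (p - 1) -> 0 < A -> 0 < z <= 1 ->
  A `^ (q - 1) <= Frad n p q (A * (- k * z `^ (- k - 1)))
    (A * (- k * ((- k - 1) * z `^ (- k - 1 - 1))) / 2) z.
Proof.
move=> k1 kN A0 /andP[z0 z1]; set S := z `^ (- k - 1).
have -> : z `^ (- k - 1 - 1) = S / z.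
  by rewrite powRD ?powRN ?powRr1 ?(ltW z0)//; apply/implyP => _; rewrite gt_eqF.
have S0 : 0 < S by exact: powR_gt0.
have Sz : 1 <= S * z.
  have -> : S * z = z `^ (- k).
    rewrite /S -{2}(powRr1 (ltW z0)) -powRD ?subrK//.
    by apply/implyP => _; rewrite gt_eqF.
  rewrite powRN invf_ge1 ?powR_gt0// -[leRHS](powRr0 z); apply: ger_powR; [by rewrite z0|lra].
have S1 : 1 <= S by apply: le_trans Sz _; rewrite ler_piMr// ltW.
have sz : z <= Num.sqrt z.
  rewrite -{1}(sqr_sqrtr (ltW z0)) expr2 ler_piMl ?sqrtr_ge0//.
  by rewrite -sqrtr1 ler_sqrt.
have q10 : 0 < q - 1 by move: hq; lra.
rewrite -(mulr_powRB1 (ltW A0) q10) mulrC /Frad.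
have k0 : 0 <= k by lra.
apply: ler_pM; [exact: powR_ge0|exact: ltW| |].
  have -> : q - 1 - 1 = q - 2 by ring.
  apply: ge0_ler_powR; rewrite ?nnegrE ?(ltW A0)//; first by move: hq; lra.
  rewrite mulNr mulrN normrN gtr0_norm; last by rewrite !mulr_gt0//; lra.
  have h : 1 <= S * Num.sqrt z by apply: le_trans Sz _; rewrite ler_pM2l.
  have : 1 * 1 <= k * (S * Num.sqrt z) by apply: ler_pM.
  rewrite -(ler_pM2l A0) => h2.
  have : 0 <= A * (k * (S * Num.sqrt z)) by rewrite !mulr_ge0 ?sqrtr_ge0// ltW.
  lra.
have -> : 2 * (A * (- k * S)) * (n%:R + p - 2)
    + 8 * (A * (- k * ((- k - 1) * (S / z))) / 2) * z * (p - 1)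
  = A * (k * S * (4 * (k + 1) * (p - 1) - 2 * (n%:R + p - 2))).
  by field; rewrite gt_eqF.
rewrite -{1}[A]mulr1 ler_pM2l//; rewrite -[1]mulr1; apply: ler_pM => //; last lra.
by rewrite -[1]mulr1; apply: ler_pM.
Qed.

End PowerProfile.

(** * Comparison with the solution *)

Section Evolution.
Context {R : realType} (n : nat) (p q : R) (V : R -> R).
Hypotheses (hn : (2 <= n)%N) (hp : 1 < p) (hq : 2 < q).
Hypothesis hV : is_profile n p q V.
Local Notation a := ((q - 2)^-1).
Variable W0 : R -> R.
Hypothesis PW0 : radial_profile n p q V (fun=> 1) W0.
Hypothesis VW0 : forall r, 0 <= r <= 1 -> V r = W0 r.
Variables (u0 : 'rV[R]_n -> R) (u : 'rV[R]_n * R -> R).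
Hypothesis hu : ibvp_solution p q u0 u.
Hypothesis u0_ge0 : forall x, unit_ball x -> 0 <= u0 x.

Let q2 : 0 < q - 2. Proof. by rewrite subr_gt0. Qed.
Let a0 : 0 < a. Proof. by rewrite invr_gt0. Qed.

Lemma cont_u : {within [set z : 'rV[R]_n * R | enorm z.1 <= 1 /\ 0 <= z.2],
  continuous u}.
Proof. by case: hu. Qed.

Lemma u_bd x t : enorm x = 1 -> 0 < t -> u (x, t) = 0.
Proof. by case: hu => _ _ _; apply. Qed.

Lemma u_sided e : e = 1 \/ e = -1 -> sided p q e u.
Proof. by case: hu => _ hs _ _; exact: viscosity_sided. Qed.

Lemma W0_le s t : 0 <= s -> s <= t -> W0 t <= W0 s.
Proof.
case: PW0 => _ _ Wd _ s0.
by rewrite le_eqVlt => /orP[/eqP ->//|st]; apply/ltW/Wd.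
Qed.

Lemma W0_gt0 r : 0 <= r < 1 -> 0 < W0 r.
Proof. by case: PW0 => _ W1 Wd _ /andP[r0 r1]; rewrite -W1 Wd. Qed.

Lemma exists_max_cylinder (D : set 'rV[R]_n) (s T e : R) (phi : 'rV[R]_n * R -> R) :
  compact D -> D !=set0 -> (forall x, D x -> enorm x <= 1) -> 0 <= s <= T ->
  (forall x t, D x -> s <= t <= T -> {for (x, t), continuous phi}) ->
  exists x0 t0, [/\ D x0, s <= t0 <= T & forall x t, D x -> s <= t <= T ->
    e * u (x, t) - phi (x, t) <= e * u (x0, t0) - phi (x0, t0)].
Proof.
move=> cD [x1 Dx1] D1 /andP[s0 sT] cphi.
pose S : set ('rV[R]_n * R) := D `*` `[s, T]%classic.
have cS : compact S by apply: compact_setX => //; exact: segment_compact.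
have S0 : S !=set0.
  by exists (x1, s); split => //=; rewrite in_itv/= lexx.
have cu : {within S, continuous u}.
  apply: continuous_subspaceW cont_u => -[x t] [/= /D1 x1' ].
  by rewrite in_itv/= => /andP[st _]; split=> //; exact: le_trans st.
have cp : {within S, continuous phi}.
  apply: continuous_in_subspaceT => -[x t]; rewrite inE => -[/= Dx].
  by rewrite in_itv/= => st; exact: cphi.
have cf : {within S, continuous (fun z => e * u z - phi z)}.
  by move=> z; exact: (cvgB (cvgM (cvg_cst e) (cu z)) (cp z)).
have [[x0 t0] [/= Dx0]] := exists_max cS S0 cf.
rewrite in_itv/= => st0 H; exists x0, t0; split=> // x t Dx st.
by apply: (H (x, t)); split=> //=; rewrite in_itv/=.
Qed.

Lemma ucball : compact (cball (0 : 'rV[R]_n) 1). Proof. exact: compact_cball. Qed.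

Lemma ucball0 : cball (0 : 'rV[R]_n) 1 !=set0.
Proof. by exists 0; rewrite /cball /= subrr enorm0. Qed.

Lemma ucballE x : cball (0 : 'rV[R]_n) 1 x <-> enorm x <= 1.
Proof. by rewrite /cball /= subr0. Qed.

Lemma bounded_above (D : set 'rV[R]_n) (s T e : R) (phi : 'rV[R]_n * R -> R) :
  compact D -> D !=set0 -> (forall x, D x -> enorm x <= 1) -> 0 <= s <= T ->
  (forall x t, D x -> s <= t <= T -> {for (x, t), continuous phi}) ->
  exists M, forall x t, D x -> s <= t <= T -> e * u (x, t) - phi (x, t) <= M.
Proof.
move=> cD D0 D1 sT cphi.
have [x0 [t0 [_ _ H]]] := exists_max_cylinder e cD D0 D1 sT cphi.
by exists (e * u (x0, t0) - phi (x0, t0)).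
Qed.

Lemma u_bounded : locally_bounded u.
Proof.
move=> T; have [T0|T0] := leP T 0.
  by exists 0 => x t _ /andP[t0 tT]; move: (lt_le_trans t0 (le_trans tT T0));
    rewrite ltxx.
have T01 : 0 <= (0 : R) <= T by rewrite lexx ltW.
have c0 x t : cball (0 : 'rV[R]_n) 1 x -> 0 <= t <= T ->
  {for (x, t), continuous (fun _ : 'rV[R]_n * R => 0 : R)}.
  by move=> _ _; exact: cvg_cst.
have D1 x : cball (0 : 'rV[R]_n) 1 x -> enorm x <= 1 by move/ucballE.
have [M1 H1] := bounded_above 1 ucball ucball0 D1 T01 c0.
have [M2 H2] := bounded_above (-1) ucball ucball0 D1 T01 c0.
exists (Num.max M1 M2) => x t /unit_ball_le/ucballE bx /andP[t0 tT].
have t01 : 0 <= t <= T by rewrite ltW.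
have := H1 _ _ bx t01; have := H2 _ _ bx t01; rewrite mul1r mulN1r !subr0 => h1 h2.
rewrite ler_norml le_max h2 /= andbT lerNl le_max h1 orbT//.
Qed.

(** The gap exceeds P at time t1 and is below P at t1 + 1: the maximum of the difference is
    positive, hence is attained before the final time and with a positive gap. *)
Lemma penalized_max (D : set 'rV[R]_n) (s t1 e : R) (phi : 'rV[R]_n * R -> R)
    (P P1 : R -> R) (x1 : 'rV[R]_n) :
  compact D -> (forall x, D x -> enorm x <= 1) -> 0 <= s <= t1 ->
  (forall x t, D x -> s <= t <= t1 + 1 -> {for (x, t), continuous phi}) ->
  (forall t : R, is_derive t 1 P (P1 t)) -> (forall t, 0 < P t) ->
  D x1 -> P t1 < e * (u (x1, t1) - phi (x1, t1)) ->
  (forall x, D x -> e * (u (x, t1 + 1) - phi (x, t1 + 1)) < P (t1 + 1)) ->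
  exists x0 t0, [/\ D x0, s <= t0 < t1 + 1,
    0 < e * (u (x0, t0) - phi (x0, t0)) &
    forall x t, D x -> s <= t <= t1 + 1 ->
      e * (u (x, t) - phi (x, t)) - P t <= e * (u (x0, t0) - phi (x0, t0)) - P t0].
Proof.
move=> cD D1 /andP[s0 st1] cphi dP P0 Dx1 H1 H2.
have sT : 0 <= s <= t1 + 1 by rewrite s0 (le_trans st1)// lerDl.
have cP : continuous P by exact: is_derive_continuous dP.
have cf x t : D x -> s <= t <= t1 + 1 ->
    {for (x, t), continuous (fun z : 'rV[R]_n * R => e * phi z + P z.2)}.
  move=> Dx st.
  have cP2 : {for (x, t), continuous (fun z : 'rV[R]_n * R => P z.2)}.
    apply: (@continuous_comp _ _ _ snd P); [exact: cvg_snd|exact: cP].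
  exact: (cvgD (cvgM (cvg_cst e) (cphi _ _ Dx st)) cP2).
have [x0 [t0 [Dx0 st0 H]]] :=
  exists_max_cylinder e cD (ex_intro _ x1 Dx1) D1 sT cf.
have H' x t : D x -> s <= t <= t1 + 1 ->
    e * (u (x, t) - phi (x, t)) - P t <= e * (u (x0, t0) - phi (x0, t0)) - P t0.
  by move=> Dx st; have := H x t Dx st; rewrite /=; lra.
have t1T : s <= t1 <= t1 + 1 by rewrite st1 lerDl ler01.
have h1 := H' _ _ Dx1 t1T.
exists x0, t0; split=> //; last by have := P0 t0; lra.
move: st0 => /andP[st0]; rewrite st0 le_eqVlt => /orP[/eqP t0E|->//].
by have := H2 _ Dx0; move: h1; rewrite t0E; lra.
Qed.

Lemma continuous_barrier (c : 'rV[R]_n) (mu tau r0 : R) (W : R -> R) x (t : R) :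
  0 < r0 -> (forall r : R, -1 < r -> {for r, continuous W}) -> 0 < t + tau ->
  {for (x, t), continuous (fun z : 'rV[R]_n * R =>
     amp q mu tau z.2 * W (enorm (z.1 - c) / r0))}.
Proof.
move=> r00 cW tt.
have c1 : {for (x, t), continuous (fun z : 'rV[R]_n * R => amp q mu tau z.2)}.
  apply: (@continuous_comp _ _ _ snd (amp q mu tau)); first exact: cvg_snd.
  apply/differentiable_continuous/derivable1_diffP.
  by have Ad := is_derive_amp q mu tt; exact: ex_derive.
have c2 : {for (x, t), continuous (fun z : 'rV[R]_n * R => W (enorm (z.1 - c) / r0))}.
  apply: (@continuous_comp _ _ _ fst (fun x : 'rV[R]_n => W (enorm (x - c) / r0))).
    exact: cvg_fst.
  exact: continuous_radial.
exact: (cvgM c1 c2).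
Qed.

Lemma u0E x : unit_ball x -> u (x, 0) = u0 x.
Proof. by case: hu => _ _ + _; apply. Qed.

(* On the corner |x| = 1, t = 0 the boundary values are recovered by
   continuity. *)
Lemma u_corner x : enorm x = 1 -> u (x, 0) = 0.
Proof.
move=> x1; apply/eqP; apply: contraT => ux.
have n0 : 0 < `|u (x, 0)| by rewrite normr_gt0.
have /subspace_continuousP/(_ (x, 0)) := cont_u.
rewrite /= x1 lexx => /(_ (conj isT (lexx _)))/cvgrPdist_lt/(_ _ n0).
rewrite near_withinE => -[[A B] /= [nA nB] AB].
have [d d0 Bd] := near_abs_lt nB.
have Bd2 : B (d / 2) by apply: Bd; rewrite subr0 gtr0_norm; lra.
have Ax : A x by exact: nbhs_singleton nA.
have d2 : 0 < d / 2 by rewrite divr_gt0.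
have Dx : enorm x <= 1 /\ 0 <= d / 2 by rewrite x1 lexx ltW.
have : `|u (x, 0) - u (x, d / 2)| < `|u (x, 0)| := AB (x, d / 2) (conj Ax Bd2) Dx.
by rewrite (u_bd x1 d2) subr0 ltxx.
Qed.

(** Comparison with the constant 0. At the contact the barrier has no spatial variation, so
    [sided_contact0] applies with K = 0 and leaves only P1 <= 0. *)
Lemma solution_ge0 x t : enorm x <= 1 -> 0 <= t -> 0 <= u (x, t).
Proof.
move=> x1 t0; rewrite leNgt; apply/negP => ult.
have D1 z : cball (0 : 'rV[R]_n) 1 z -> enorm z <= 1 by move/ucballE.
have cphi z s : cball (0 : 'rV[R]_n) 1 z -> 0 <= s <= t + 1 ->
  {for (z, s), continuous (fun _ : 'rV[R]_n * R => 0 : R)}.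
  by move=> _ _; exact: cvg_cst.
have T01 : 0 <= (0 : R) <= t + 1 by rewrite lexx; lra.
have [M HM] := bounded_above (-1) ucball ucball0 D1 T01 cphi.
have eps0 : 0 < - u (x, t) / 2 by lra.
have [P [P1 [P2 [dP dP1 P0 P10 [Pt PM]]]]] := penalty M t eps0.
have T02 : 0 <= (0 : R) <= t by rewrite lexx.
have G1 : P t < -1 * (u (x, t) - 0) by rewrite Pt subr0 mulN1r; lra.
have G2 z : cball (0 : 'rV[R]_n) 1 z -> -1 * (u (z, t + 1) - 0) < P (t + 1).
  move=> Dz; apply: le_lt_trans PM; have := HM z (t + 1) Dz; rewrite !subr0.
  by apply; rewrite lexx andbT; lra.
have [x0 [t1 [/D1 bx0 /andP[t10 t1t] f0 H]]] := @penalized_max _ 0 t (-1) (fun=> 0)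
  P P1 x ucball D1 T02 cphi dP P0 ((ucballE x).2 x1) G1 G2.
have t1pos : 0 < t1.
  rewrite lt_neqAle t10 andbT; apply/eqP => t1E.
  move: f0; rewrite -t1E subr0 mulN1r oppr_gt0.
  move: bx0; rewrite le_eqVlt => /orP[/eqP bx0|bx0].
    by rewrite u_corner// ltxx.
  by rewrite u0E// ltNge u0_ge0.
have ux0 : unit_ball x0.
  rewrite /unit_ball /= lt_neqAle bx0 andbT; apply/eqP => x01.
  by move: f0; rewrite u_bd// subrr mulr0 ltxx.
have e2 : (-1 : R) ^+ 2 = 1 by rewrite sqrrN expr1n.
have nP : \forall s \near t1, is_derive (s : R) 1 P (P1 s).
  by apply/nbhs_ballP; exists 1 => //= s _; exact: dP.
have [C [d [C0 d0 HC]]] := taylor1_quadratic nP (dP1 t1).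
pose dd := Num.min d (Num.min t1 (t + 1 - t1)).
have dd0 : 0 < dd by rewrite !lt_min d0 t1pos subr_gt0.
have HH z (s : R) : unit_ball z -> 0 < s -> enorm (z - x0) < dd ->
   `|s - t1| < dd -> -1 * (u (z, s) - u (x0, t1)) <=
     P1 t1 * (s - t1) + C * (s - t1) ^+ 2 + 0 * enorm (z - x0) ^+ 4.
  move=> /unit_ball_le bz s0 _; rewrite !lt_min => /and3P[sd _ st].
  have sT : 0 <= s <= t + 1.
    by rewrite ltW//=; have := ler_norm (s - t1); lra.
  have := H z s ((ucballE z).2 bz) sT.
  have := HC s sd; rewrite ler_norml; lra.
have := sided_contact0 hq e2 (u_sided (or_intror erefl)) u_bounded ux0 t1pos
  dd0 HH.
by rewrite leNgt P10.
Qed.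

(* Unless the maximum of the penalized difference sits at the centre [c] of the
   barrier, [amp_contact] applies there and contradicts [0 < P']. *)
Lemma contact_at_center (e : R) (D : set 'rV[R]_n) (xi W : R -> R) (c x1 : 'rV[R]_n)
    (r0 mu tau s t1 : R) (P P1 P2 : R -> R) :
  e = 1 \/ e = -1 -> radial_profile n p q V xi W ->
  compact D -> (forall x, D x -> enorm x <= 1) -> 0 <= s <= t1 ->
  0 < r0 -> 0 < mu -> 0 < s + tau ->
  (forall t : R, is_derive t 1 P (P1 t)) -> (forall t : R, is_derive t 1 P1 (P2 t)) ->
  (forall t, 0 < P t) -> (forall t, 0 < P1 t) ->
  let f x t := e * (u (x, t) - amp q mu tau t * W (enorm (x - c) / r0)) in
  D x1 -> P t1 < f x1 t1 ->
  (forall x, D x -> f x (t1 + 1) < P (t1 + 1)) ->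
  (forall x, D x -> f x s <= 0) ->
  (forall x t, D x -> s < t -> 0 < f x t -> unit_ball x /\ exists2 d, 0 < d &
     forall z, unit_ball z -> enorm (z - x) < d -> D z) ->
  (forall x, D x -> x != c ->
     0 <= e * (mu `^ (q - 2) * r0 `^ (- q) * (xi (enorm (x - c) / r0)
            * Vext V (enorm (x - c) / r0)) - W (enorm (x - c) / r0))) ->
  exists t0, [/\ D c, s < t0 < t1 + 1, unit_ball c & forall x t, D x -> s <= t <= t1 + 1 ->
     f x t - P t <= f c t0 - P t0].
Proof.
move=> ee PW cD D1 /andP[s0 st1] r00 mu0 stau dP dP1 P0 P10 f Dx1 H1 H2 Hs Hb Hf.
have cW : forall r : R, -1 < r -> {for r, continuous W} by case: PW.
have stt t : s <= t -> 0 < t + tau by move=> st; apply: lt_le_trans stau _; rewrite lerD2r.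
pose phi (z : 'rV[R]_n * R) := amp q mu tau z.2 * W (enorm (z.1 - c) / r0).
have cphi x t : D x -> s <= t <= t1 + 1 -> {for (x, t), continuous phi}.
  by move=> _ /andP[st _]; apply: continuous_barrier => //; exact: stt.
have s01 : 0 <= s <= t1 by rewrite s0.
have [x0 [t0 [Dx0 /andP[st0 t0t] f0 H]]] := @penalized_max _ s t1 e phi P P1 x1
  cD D1 s01 cphi dP P0 Dx1 H1 H2.
have st0' : s < t0.
  rewrite lt_neqAle st0 andbT; apply/eqP => t0E.
  by have := Hs _ Dx0; move: f0; rewrite -t0E /f /phi/=; lra.
have [bx0 [d d0 Hd]] := Hb _ _ Dx0 st0' f0.
have [x0c|x0c] := eqVneq x0 c.
  by rewrite x0c in Dx0 bx0 H; exists t0; split=> //; rewrite st0'.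
have t00 : 0 < t0 by exact: le_lt_trans st0'.
pose dd := Num.min d (Num.min (t0 - s) (t1 + 1 - t0)).
have dd0 : 0 < dd by rewrite !lt_min d0 !subr_gt0 st0'.
have HH x (t : R) : unit_ball x -> 0 < t -> enorm (x - x0) < dd -> `|t - t0| < dd ->
    f x t - P t <= f x0 t0 - P t0.
  rewrite !lt_min => bx _ /andP[xd _] /and3P[_ ts tt].
  apply: H; first exact: Hd.
  exact: abs_lt_itv ts tt.
have := amp_contact hq ee (u_sided ee) u_bounded PW bx0 t00 x0c dd0 r00
  mu0 (stt _ st0) dP dP1 HH.
rewrite mulrCA leNgt => /negP[]; apply: ltr_wpDl (P10 t0).
by apply: mulr_ge0 (Hf _ Dx0 x0c); rewrite mulr_ge0 ?powR_ge0// mulr_ge0// ltW.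
Qed.

(** With this amplitude the dilated separated function again solves the equation: the two factors
    found in [powR_scale] cancel. *)
Lemma powR_exponent (R0 : R) : 0 < R0 -> (R0 `^ (q / (q - 2))) `^ (q - 2) * R0 `^ (- q) = 1.
Proof.
move=> R00; rewrite -powRrM divfK ?gt_eqF// -powRD ?subrr ?powRr0//.
by apply/implyP => _; rewrite gt_eqF.
Qed.

(* For [r0 > 1] the barrier solves the equation away from its centre. The centre
   is excluded by playing two centres against each other: the penalized maxima
   would have to sit at both of them. *)
Lemma upper_barrier (r0 tau : R) : 1 < r0 -> 0 < tau ->
  let mu := r0 `^ (q / (q - 2)) in
  (forall x, enorm x <= 1 ->
     u (x, 0) < amp q mu tau 0 * W0 ((1 + (r0 - 1) / 2) / r0)) ->
  forall x t, enorm x <= 1 -> 0 <= t -> u (x, t) <= amp q mu tau t * W0 (enorm x / r0).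
Proof.
move=> r01 tau0 mu Hu x1 t1 bx1 t10; rewrite leNgt; apply/negP => gap.
have r00 : 0 < r0 by lra.
have mu0 : 0 < mu by exact: powR_gt0.
have [cW _ Wd _] := PW0.
(* Room for the centre: for |c| <= eta and |x| <= 1 one has |x - c| <= 1 + eta < r0, so the shifted
   barrier stays positive on the closed unit ball. *)
pose eta := (r0 - 1) / 2; have eta0 : 0 < eta by rewrite /eta; lra.
have A0 (t : R) : 0 <= t -> 0 < amp q mu tau t.
  by move=> t0; apply: amp_gt0 => //; lra.
pose b (c x : 'rV[R]_n) (t : R) := amp q mu tau t * W0 (enorm (x - c) / r0).
have ratio (c x : 'rV[R]_n) : enorm c <= eta -> enorm x <= 1 ->
    0 <= enorm (x - c) / r0 <= (1 + eta) / r0.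
  move=> ce xe; rewrite divr_ge0 ?enorm_ge0 ?(ltW r00)//=.
  rewrite ler_pM2r ?invr_gt0//; apply: le_trans (ler_enormD _ _) _.
  by rewrite enormN lerD.
have eta1 : (1 + eta) / r0 < 1 by rewrite ltr_pdivrMr// /eta; lra.
have b0 (c x : 'rV[R]_n) (t : R) : enorm c <= eta -> enorm x <= 1 -> 0 <= t -> 0 < b c x t.
  move=> ce xe t0; rewrite mulr_gt0 ?A0// W0_gt0//.
  by have /andP[-> h] := ratio c x ce xe; exact: le_lt_trans h _.
have D1 z : cball (0 : 'rV[R]_n) 1 z -> enorm z <= 1 by move/ucballE.
pose g := u (x1, t1) - amp q mu tau t1 * W0 (enorm x1 / r0).
have g0 : 0 < g by rewrite subr_gt0.
(* By continuity a small shift of the centre keeps half of the gap, so one penalty serves both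
   centres. *)
have [y yeta [y0 yg]] : exists2 y : 'rV[R]_n, enorm y <= eta &
    0 < enorm y /\ g / 2 < u (x1, t1) - b y x1 t1.
  have cy := @continuous_radial _ n W0 r0 x1 r00 cW 0.
  have cvy := cvgM (cvg_cst (amp q mu tau t1)) cy.
  have hlt : amp q mu tau t1 * W0 (enorm (0 - x1) / r0) < u (x1, t1) - g / 2.
    by rewrite sub0r enormN; move: g0; rewrite /g; lra.
  have [d d0 Hd] := exists_enorm_ball (cvgr_lt _ (cvy _ _) _ hlt).
  have m0 : 0 < Num.min (d / 2) eta by rewrite lt_min eta0 divr_gt0.
  have [y ye] := exists_enorm hn (ltW m0).
  exists y; first by rewrite ye ge_min lexx orbT.
  split; first by rewrite ye.
  have yd : enorm (y - 0) < d.
    by rewrite subr0 ye; apply: (@le_lt_trans _ _ (d / 2)); [rewrite ge_min lexx|lra].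
  have := Hd y yd; rewrite /b enormB /=; lra.
have T01 : 0 <= (0 : R) <= t1 + 1 by rewrite lexx; lra.
have c0 x t : cball (0 : 'rV[R]_n) 1 x -> 0 <= t <= t1 + 1 ->
  {for (x, t), continuous (fun _ : 'rV[R]_n * R => 0 : R)}.
  by move=> _ _; exact: cvg_cst.
have [M HM] := bounded_above 1 ucball ucball0 D1 T01 c0.
have eps0 : 0 < g / 2 by lra.
have [P [P1 [P2 [dP dP1 P0 P10 [Pt PM]]]]] := penalty M t1 eps0.
have centre (c : 'rV[R]_n) : enorm c <= eta -> g / 2 < u (x1, t1) - b c x1 t1 ->
    exists t0, [/\ unit_ball c, 0 < t0 < t1 + 1 &
      forall x t, enorm x <= 1 -> 0 <= t <= t1 + 1 ->
      u (x, t) - b c x t - P t <= u (c, t0) - b c c t0 - P t0].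
  move=> ce gc.
  have T02 : 0 <= (0 : R) <= t1 by rewrite lexx.
  have tau00 : 0 < 0 + tau by rewrite add0r.
  have H1 : P t1 < 1 * (u (x1, t1) - b c x1 t1) by rewrite Pt mul1r.
  have H2 x : cball (0 : 'rV[R]_n) 1 x -> 1 * (u (x, t1 + 1) - b c x (t1 + 1)) < P (t1 + 1).
    move=> Dx; apply: le_lt_trans PM.
    have := HM x (t1 + 1) Dx; rewrite mul1r subr0 mul1r lexx andbT.
    have := @b0 c x (t1 + 1) ce (D1 _ Dx); have -> : 0 <= t1 + 1 by lra.
    by move=> /(_ isT) h1 /(_ isT) h2; lra.
  have H3 x : cball (0 : 'rV[R]_n) 1 x -> 1 * (u (x, 0) - b c x 0) <= 0.
    move=> /D1 bx; rewrite mul1r subr_le0; apply: le_trans (ltW (Hu x bx)) _.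
    rewrite ler_pM2l ?A0//; have /andP[h1 h2] := ratio c x ce bx; exact: W0_le.
  have H4 x t : cball (0 : 'rV[R]_n) 1 x -> 0 < t -> 0 < 1 * (u (x, t) - b c x t) ->
      unit_ball x /\ exists2 d, 0 < d & forall z, unit_ball z ->
      enorm (z - x) < d -> cball (0 : 'rV[R]_n) 1 z.
    move=> /D1 bx t0 f0; split; last by exists 1 => // z /unit_ball_le/ucballE.
    rewrite /unit_ball /= lt_neqAle bx andbT; apply/eqP => x01.
    by have := b0 c x t ce bx (ltW t0); move: f0; rewrite u_bd//; lra.
  have H5 x : cball (0 : 'rV[R]_n) 1 x -> x != c ->
     0 <= 1 * (mu `^ (q - 2) * r0 `^ (- q) * (1
            * Vext V (enorm (x - c) / r0)) - W0 (enorm (x - c) / r0)).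
    move=> /D1 bx _; have /andP[h1 h2] := ratio c x ce bx.
    have h3 : 0 <= enorm (x - c) / r0 <= 1 by rewrite h1 (le_trans h2)// ltW.
    by rewrite powR_exponent// !mul1r VextE// VW0// subrr.
  have [t0 [_ t0t bc HH]] := contact_at_center (or_introl erefl) PW0 ucball D1 T02
    r00 mu0 tau00 dP dP1 P0 P10 ((ucballE x1).2 bx1) H1 H2 H3 H4 H5.
  exists t0; split=> // x t /ucballE bx tt.
  by have := HH x t bx tt; rewrite !mul1r.
have g1 : g / 2 < u (x1, t1) - b 0 x1 t1 by rewrite /b subr0 -/g; lra.
have e00 : enorm (0 : 'rV[R]_n) <= eta by rewrite enorm0 ltW.
have [t0 [u0' /andP[t00 t0t] H0]] := centre 0 e00 g1.
have [ty [uy /andP[ty0 tyt] Hy]] := centre y yeta yg.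
have tyT : 0 <= ty <= t1 + 1 by rewrite !ltW.
have t0T : 0 <= t0 <= t1 + 1 by rewrite !ltW.
(* In the sum of these two inequalities the values of u and P cancel, and both remaining terms
   contradict W0(|y|/r0) < W0(0). *)
have h0 := H0 y ty (ltW uy) tyT; have hy := Hy 0 t0 (ltW u0') t0T.
have Wy : W0 (enorm y / r0) < W0 (0 / r0).
  by apply: Wd; rewrite ?mul0r ?divr_gt0.
have k1 : amp q mu tau ty * W0 (enorm y / r0) < amp q mu tau ty * W0 (0 / r0).
  by rewrite ltr_pM2l// A0// ltW.
have k2 : amp q mu tau t0 * W0 (enorm y / r0) < amp q mu tau t0 * W0 (0 / r0).
  by rewrite ltr_pM2l// A0// ltW.
by move: h0 hy; rewrite /b !subr0 (subrr y) sub0r enormN enorm0; lra.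
Qed.

Lemma exists_amp_gt (mu M : R) : 0 < mu -> exists2 tau, 0 < tau & M < amp q mu tau 0.
Proof.
move=> mu0; pose L := (`|M| + 1) / mu.
have L0 : 0 < L by rewrite divr_gt0// ltr_wpDl.
exists (L `^ (- (q - 2))); first exact: powR_gt0.
rewrite /amp add0r -powRrM mulrNN mulfV ?gt_eqF// powRr1 ?(ltW L0)//.
rewrite /L mulrC divfK ?gt_eqF//; have := ler_norm M; lra.
Qed.

Lemma W0_ge0 r : 0 <= r <= 1 -> 0 <= W0 r.
Proof.
by move=> /andP[r0 r1]; have [_ W1 _ _] := PW0; rewrite -W1; exact: W0_le.
Qed.

Lemma continuous_powR1 (b : R) : {for 1, continuous (fun r : R => r `^ b)}.
Proof.
apply/differentiable_continuous/derivable1_diffP.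
have dp := @is_derive1_powR R b 1 ltr01; exact: ex_derive.
Qed.

(** Any bounded initial datum lies below the barrier for small tau, since amp at time 0 tends to
    infinity as tau tends to 0. Afterwards tau is dropped by monotonicity, and r0 tends to 1. *)
Lemma solution_le x t : enorm x <= 1 -> 0 < t -> u (x, t) <= t `^ (- a) * W0 (enorm x).
Proof.
move=> bx t0; rewrite leNgt; apply/negP => ult.
have [cW _ _ _] := PW0.
pose h (r : R) := r `^ (q / (q - 2)) * t `^ (- a) * W0 (enorm x / r).
have ch : {for 1, continuous h}.
  have c1 : {for (1 : R), continuous (fun r : R => enorm x / r)}.
    exact: (cvgM (cvg_cst (enorm x)) (cvgV (oner_neq0 R) cvg_id)).
  have c2 : {for (1 : R), continuous (fun r : R => W0 (enorm x / r))}.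
    apply: (@continuous_comp _ _ _ (fun r : R => enorm x / r) W0) => //.
    by apply: cW; rewrite divr1; have := enorm_ge0 x; lra.
  exact: (cvgM (cvgM (@continuous_powR1 _) (cvg_cst (t `^ (- a)))) c2).
have h1 : h 1 < u (x, t) by rewrite /h powR1 mul1r divr1.
have [d d0 Hd] := near_abs_lt (cvgr_lt _ ch _ h1).
pose r0 := 1 + d / 2; have r01 : 1 < r0 by rewrite /r0; lra.
have := Hd r0; rewrite /r0 addrAC subrr add0r gtr0_norm; last by lra.
have -> : d / 2 < d by lra.
move=> /(_ isT); rewrite -/r0 ltNge => /negP; apply.
have w0 : 0 < W0 ((1 + (r0 - 1) / 2) / r0).
  apply: W0_gt0; rewrite divr_ge0 ?ltr_pdivrMr//=; rewrite /r0; lra.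
have T00 : 0 <= (0 : R) <= 0 by rewrite lexx.
have D1 z : cball (0 : 'rV[R]_n) 1 z -> enorm z <= 1 by move/ucballE.
have c0 z s : cball (0 : 'rV[R]_n) 1 z -> 0 <= s <= 0 ->
  {for (z, s), continuous (fun _ : 'rV[R]_n * R => 0 : R)}.
  by move=> _ _; exact: cvg_cst.
have [M HM] := bounded_above 1 ucball ucball0 D1 T00 c0.
have mu0 : 0 < r0 `^ (q / (q - 2)) by apply: powR_gt0; lra.
have [tau tau0 Ht] := exists_amp_gt (M / W0 ((1 + (r0 - 1) / 2) / r0)) mu0.
have Hu z : enorm z <= 1 -> u (z, 0) <
    amp q (r0 `^ (q / (q - 2))) tau 0 * W0 ((1 + (r0 - 1) / 2) / r0).
  move=> bz; move: Ht; rewrite ltr_pdivrMr//; apply: le_lt_trans.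
  by have := HM z 0 ((ucballE z).2 bz) T00; rewrite mul1r subr0.
have x0 : 0 <= enorm x / r0 <= 1.
  rewrite divr_ge0 ?enorm_ge0 ?ler_pdivrMr ?mul1r//; rewrite /r0; lra.
apply: le_trans (upper_barrier r01 tau0 Hu bx (ltW t0)) _.
rewrite /h ler_wpM2r ?W0_ge0// /amp ler_pM2l// !powRN lef_pV2 ?posrE ?powR_gt0//; last lra.
by rewrite ge0_ler_powR ?nnegrE ?(ltW a0)//; lra.
Qed.

Lemma amp_le mu tau s t : 0 < mu -> 0 < s + tau -> s <= t -> amp q mu tau t <= amp q mu tau s.
Proof.
move=> mu0 st lst; have tt : 0 < t + tau by apply: lt_le_trans st _; rewrite lerD2r.
rewrite /amp ler_pM2l// !powRN lef_pV2 ?posrE ?powR_gt0//.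
by rewrite ge0_ler_powR ?nnegrE ?(ltW a0) ?(ltW st) ?(ltW tt)// lerD2r.
Qed.

(* At its centre the barrier is flat to fourth order, so a contact there only
   sees the time derivative. *)
Lemma lower_barrier (xi W : R -> R) (K nu r0 mu s tau : R) (y : 'rV[R]_n) :
  (forall r, 0 < r -> 0 <= xi r <= 1) -> radial_profile n p q V xi W -> 0 < K ->
  (forall r, 0 <= r <= 1 -> W 0 - W r <= K * r ^+ 4) ->
  0 < nu -> (forall r, 0 <= r <= 1 -> nu * W0 r <= W r) ->
  0 < r0 -> enorm y + r0 <= 1 -> 0 <= s -> 0 < s + tau -> 0 < mu ->
  mu `^ (q - 2) * r0 `^ (- q) <= nu ->
  (forall x, cball y r0 x -> amp q mu tau s * W (enorm (x - y) / r0) <= u (x, s)) ->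
  forall x t, cball y r0 x -> s <= t -> amp q mu tau t * W (enorm (x - y) / r0) <= u (x, t).
Proof.
move=> xi01 PW K0 WK nu0 WW0 r00 yr s0 stau mu0 mur Hs x1 t1 Dx1 st1.
rewrite leNgt; apply/negP => gap.
have [cW W1 Wd _] := PW.
have W_ge0 r : 0 <= r <= 1 -> 0 <= W r.
  move=> r01; apply: le_trans (WW0 r r01); rewrite mulr_ge0 ?W0_ge0//; exact: ltW.
have stt t : s <= t -> 0 < t + tau by move=> st; apply: lt_le_trans stau _; rewrite lerD2r.
have cD : compact (cball y r0) by exact: compact_cball.
have D1 z : cball y r0 z -> enorm z <= 1.
  move=> Dz; rewrite -[z](subrK y); apply: le_trans (ler_enormD _ _) _.
  by move: Dz; rewrite /cball /=; lra.
have ratio z : cball y r0 z -> 0 <= enorm (z - y) / r0 <= 1.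
  by move=> Dz; rewrite divr_ge0 ?enorm_ge0 ?(ltW r00)//= ler_pdivrMr// mul1r.
pose b x t := amp q mu tau t * W (enorm (x - y) / r0).
have T01 : 0 <= s <= t1 + 1 by rewrite s0 (le_trans st1)// lerDl.
have T02 : 0 <= s <= t1 by rewrite s0.
have cb x t : cball y r0 x -> s <= t <= t1 + 1 ->
  {for (x, t), continuous (fun z : 'rV[R]_n * R => - b z.1 z.2)}.
  move=> _ /andP[/stt tt _].
  have h : {for (x, t), continuous (fun z : 'rV[R]_n * R => b z.1 z.2)}.
    exact: continuous_barrier.
  exact: cvgN h.
have D0 : cball y r0 !=set0 by exists x1.
have [M HM] := bounded_above (-1) cD D0 D1 T01 cb.
pose g := b x1 t1 - u (x1, t1).
have g0 : 0 < g / 2 by rewrite divr_gt0// subr_gt0.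
have [P [P1 [P2 [dP dP1 P0 P10 [Pt PM]]]]] := penalty M t1 g0.
have H1 : P t1 < -1 * (u (x1, t1) - b x1 t1) by rewrite Pt; move: g0; rewrite /g; lra.
have H2 x : cball y r0 x -> -1 * (u (x, t1 + 1) - b x (t1 + 1)) < P (t1 + 1).
  move=> Dx; apply: le_lt_trans PM; have := HM x (t1 + 1) Dx.
  have -> : s <= t1 + 1 <= t1 + 1 by rewrite lexx andbT; case/andP: T01.
  by move=> /(_ isT) /=; lra.
have H3 x : cball y r0 x -> -1 * (u (x, s) - b x s) <= 0.
  by move=> /Hs; rewrite /b; lra.
have H4 x t : cball y r0 x -> s < t -> 0 < -1 * (u (x, t) - b x t) ->
    unit_ball x /\ exists2 d, 0 < d & forall z, unit_ball z ->
    enorm (z - x) < d -> cball y r0 z.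
  move=> Dx st f0.
  have u_ge0 := solution_ge0 (D1 _ Dx) (le_trans s0 (ltW st)).
  have xy : enorm (x - y) < r0.
    rewrite lt_neqAle; have -> : enorm (x - y) <= r0 by [].
    rewrite andbT; apply/eqP => xyE.
    by move: f0; rewrite /b xyE divff ?gt_eqF// W1 mulr0; lra.
  split.
    rewrite /unit_ball /= -[x](subrK y); apply: le_lt_trans (ler_enormD _ _) _; lra.
  exists (r0 - enorm (x - y)) => [|z _ zx]; first by rewrite subr_gt0.
  rewrite /cball /= -(subrKA x); apply: le_trans (ler_enormD _ _) _; lra.
have H5 x : cball y r0 x -> x != y ->
   0 <= -1 * (mu `^ (q - 2) * r0 `^ (- q) * (xi (enorm (x - y) / r0)
          * Vext V (enorm (x - y) / r0)) - W (enorm (x - y) / r0)).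
  move=> Dx xy; have r01 := ratio x Dx.
  have rho0 : 0 < enorm (x - y) / r0 by rewrite divr_gt0// enorm_gt0 subr_eq0.
  rewrite mulN1r opprB subr_ge0; apply: le_trans (WW0 _ r01).
  have /andP[xi0 xi1] := xi01 _ rho0; rewrite VextE// VW0//.
  have w0 := W0_ge0 r01.
  apply: ler_pM => //; [by rewrite mulr_ge0 ?powR_ge0|by rewrite mulr_ge0|].
  by rewrite ler_piMl.
have [t0 [Dy /andP[st0 t0t] by1 HH]] := contact_at_center (or_intror erefl) PW cD D1 T02
  r00 mu0 stau dP dP1 P0 P10 Dx1 H1 H2 H3 H4 H5.
have t00 : 0 < t0 by exact: le_lt_trans st0.
have tt0 := stt _ (ltW st0).
(* Time derivative seen at the centre. The contact inequality requires it to be nonpositive, whereas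
   [amp1] is negative and [P1] positive. *)
pose g1 t := - W 0 * amp1 q mu tau t + P1 t.
have dg : \forall s \near t0, is_derive (s : R) 1
    (fun t => - W 0 * amp q mu tau t + P t) (g1 s).
  apply: filterS (near_shift_gt0 tt0) => t tt.
  exact: is_deriveD (is_deriveZ (- W 0) (is_derive_amp q mu tt)) (dP t).
have dg1 := is_deriveD (is_deriveZ (- W 0) (is_derive_amp1 q mu tt0)) (dP1 t0).
have [C [d [C0 d0 HC]]] := taylor1_quadratic dg dg1.
pose dd := Num.min (Num.min d r0) (Num.min (t0 - s) (t1 + 1 - t0)).
have dd0 : 0 < dd by rewrite !lt_min d0 r00 !subr_gt0 st0.
have contact x (t : R) : unit_ball x -> 0 < t -> enorm (x - y) < dd ->
   `|t - t0| < dd -> -1 * (u (x, t) - u (y, t0)) <=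
     g1 t0 * (t - t0) + C * (t - t0) ^+ 2
     + amp q mu tau s * (K / r0 ^+ 4) * enorm (x - y) ^+ 4.
  rewrite !lt_min => _ _ /andP[/andP[_ xr] _] /and3P[/andP[td _] ts tt].
  have Dx : cball y r0 x by exact: ltW.
  have sT : s <= t <= t1 + 1 by exact: abs_lt_itv ts tt.
  have st : s <= t by case/andP: sT.
  have := HH x t Dx sT; rewrite /= subrr enorm0 mul0r.
  have := HC t td; rewrite ler_norml => /andP[_ hC].
  have hW : amp q mu tau t * (W 0 - W (enorm (x - y) / r0)) <=
      amp q mu tau s * (K * (enorm (x - y) / r0) ^+ 4).
    apply: ler_pM; rewrite ?amp_le ?WK ?ratio ?subr_ge0//; first exact/ltW/amp_gt0/stt.
    have /andP[] := ratio x Dx; rewrite le_eqVlt => /orP[/eqP <-//|h _].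
    exact/ltW/Wd.
  move: hW; rewrite expr_div_n; lra.
have := sided_contact0 hq (_ : (-1) ^+ 2 = 1) (u_sided (or_intror erefl)) u_bounded by1 t00
  dd0 contact.
rewrite sqrrN expr1n leNgt => /(_ erefl)/negP; apply.
apply: ltr_wpDl (P10 t0).
rewrite /amp1 mulrNN mulr_ge0 ?W_ge0 ?lexx ?ler01// !mulr_ge0 ?powR_ge0 ?(ltW a0)//.
exact: ltW.
Qed.

Hypothesis flat_profiles : forall nu, 0 < nu < 1 -> exists (W xi : R -> R) (K : R),
  [/\ forall r, 0 < r -> 0 <= xi r <= 1, radial_profile n p q V xi W, 0 < K,
      forall r, 0 <= r <= 1 -> W 0 - W r <= K * r ^+ 4 &
      forall r, 0 <= r <= 1 -> nu * W0 r <= W r].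

(** On a compact ball u(., s) has a positive minimum m. With tau = (mu W(0)/m)^(q-2) the barrier has
    height m at time 0 and, being decreasing in time, starts below u at time s. *)
Lemma lower_bound_eventually (xi W : R -> R) (K nu r0 mu s : R) (y : 'rV[R]_n) :
  (forall r, 0 < r -> 0 <= xi r <= 1) -> radial_profile n p q V xi W -> 0 < K ->
  (forall r, 0 <= r <= 1 -> W 0 - W r <= K * r ^+ 4) ->
  0 < nu -> (forall r, 0 <= r <= 1 -> nu * W0 r <= W r) ->
  0 < r0 -> enorm y + r0 <= 1 -> 0 <= s -> 0 < mu -> mu `^ (q - 2) * r0 `^ (- q) <= nu ->
  (forall x, cball y r0 x -> 0 < u (x, s)) ->
  exists2 tau, 0 < tau & forall x t, cball y r0 x -> s <= t ->
    amp q mu tau t * W (enorm (x - y) / r0) <= u (x, t).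
Proof.
move=> xi01 PW K0 WK nu0 WW0 r00 yr s0 mu0 mur Hs.
have [_ W1 Wd _] := PW.
have Wpos : 0 < W 0 by have := Wd 0 1 (lexx _) ltr01; rewrite W1.
have D1 z : cball y r0 z -> enorm z <= 1.
  move=> Dz; rewrite -[z](subrK y); apply: le_trans (ler_enormD _ _) _.
  by move: Dz; rewrite /cball /=; lra.
have Dy : cball y r0 y by rewrite /cball /= subrr enorm0 ltW.
have D0 : cball y r0 !=set0 by exists y.
have ss : 0 <= s <= s by rewrite s0 lexx.
have c0 z t : cball y r0 z -> s <= t <= s ->
  {for (z, t), continuous (fun _ : 'rV[R]_n * R => 0 : R)}.
  by move=> _ _; exact: cvg_cst.
have [x0 [t0 [Dx0 st0 Hm]]] :=
  exists_max_cylinder (-1) (@compact_cball _ _ y r0) D0 D1 ss c0.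
have {}st0 : t0 = s by apply/eqP; rewrite eq_le andbC.
subst t0; set m := u (x0, s) in Hm; have m0 : 0 < m by exact: Hs.
have {}Hm x : cball y r0 x -> m <= u (x, s).
  by move=> Dx; have := Hm x s Dx; rewrite lexx => /(_ isT); lra.
pose L := mu * W 0 / m; have L0 : 0 < L by rewrite divr_gt0// mulr_gt0.
pose tau := L `^ (q - 2); have tau0 : 0 < tau by exact: powR_gt0.
exists tau => //; apply: (lower_barrier xi01 PW K0 WK nu0 WW0 r00 yr s0 _ mu0 mur).
  exact: ltr_wpDl s0 tau0.
move=> x Dx; apply: le_trans (Hm x Dx).
have tau0' : 0 < 0 + tau by rewrite add0r.
have h : amp q mu tau s <= m / W 0.
  apply: le_trans (amp_le mu0 tau0' s0) _.
  rewrite /amp add0r /tau -powRrM mulrN mulfV ?gt_eqF// powR_inv1 ?(ltW L0)//.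
  have -> // : mu * L^-1 = m / W 0 by rewrite /L; field; rewrite !gt_eqF.
have /andP[r_ge0 r_le1] : 0 <= enorm (x - y) / r0 <= 1.
  by rewrite divr_ge0 ?enorm_ge0 ?(ltW r00)//= ler_pdivrMr// mul1r.
have -> : m = m / W 0 * W 0 by rewrite divfK// gt_eqF.
apply: ler_pM => //; first exact/ltW/amp_gt0/(ltr_wpDl s0 tau0).
  apply: le_trans (WW0 _ _); last by rewrite r_ge0.
  by rewrite mulr_ge0 ?W0_ge0 ?(ltW nu0)// r_ge0.
by move: r_ge0; rewrite le_eqVlt => /orP[/eqP <-//|h2]; apply/ltW/Wd.
Qed.

(** Half the radius keeps W above W(1/2) > 0, and t + tau <= (1 + tau) t for t >= 1 replaces the
    shifted power by t^(-1/(q-2)). *)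
Lemma positive_core (y : 'rV[R]_n) (rho s : R) :
  0 < rho -> enorm y + rho <= 1 -> 0 <= s -> (forall x, cball y rho x -> 0 < u (x, s)) ->
  exists c0 t1, [/\ 0 < c0, 1 <= t1 & forall x t, cball y (rho / 2) x -> t1 <= t ->
    c0 * t `^ (- a) <= u (x, t)].
Proof.
move=> rho0 yrho s0 Hs; have h01 : 0 < (2^-1 : R) < 1 by lra.
have [W [xi [K [xi01 PW K0 WK WW0]]]] := flat_profiles h01.
have [_ W1 Wd _] := PW.
have rq0 : 0 < rho `^ q / 2 by rewrite divr_gt0 ?powR_gt0.
(* Makes mu^(q-2) rho^(-q) equal to 1/2, the value of nu in use. *)
pose mu := (rho `^ q / 2) `^ a; have mu0 : 0 < mu by exact: powR_gt0.
have mur : mu `^ (q - 2) * rho `^ (- q) <= 2^-1.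
  rewrite /mu -powRrM mulVf ?gt_eqF// powRr1 ?(ltW rq0)// powRN mulrAC mulfV ?mul1r//.
  by rewrite gt_eqF// powR_gt0.
have nu0 : 0 < 2^-1 :> R by lra.
have [tau tau0 Ht] := lower_bound_eventually xi01 PW K0 WK nu0 WW0 rho0 yrho s0 mu0 mur Hs.
have W20 : 0 < W 2^-1 by rewrite -W1 Wd//; lra.
exists (mu * (1 + tau) `^ (- a) * W 2^-1), (Num.max 1 s); split.
- by rewrite !mulr_gt0// powR_gt0// addr_gt0.
- by rewrite le_max lexx.
move=> x t Dx; rewrite ge_max => /andP[t1 st].
have t0 : 0 < t by lra.
have Dx2 : cball y rho x by move: Dx; rewrite /cball /=; lra.
apply: le_trans (Ht x t Dx2 st).
have -> : mu * (1 + tau) `^ (- a) * W 2^-1 * t `^ (- a)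
    = mu * ((1 + tau) * t) `^ (- a) * W 2^-1.
  by rewrite powRM; [ring|lra|lra].
have tt : t + tau <= (1 + tau) * t.
  by rewrite mulrDl mul1r lerD2l ler_peMr// ltW.
apply: ler_pM.
- by rewrite mulr_ge0 ?powR_ge0// ltW.
- exact: ltW.
- rewrite /amp ler_pM2l// !powRN lef_pV2 ?posrE ?powR_gt0//; [|by rewrite mulr_gt0// addr_gt0|lra].
  by rewrite ge0_ler_powR ?nnegrE ?(ltW a0)//; lra.
have : enorm (x - y) / rho <= 2^-1.
  by rewrite ler_pdivrMr//; move: Dx; rewrite /cball /=; lra.
rewrite le_eqVlt => /orP[/eqP ->//|h2]; apply/ltW/Wd => //.
by rewrite divr_ge0 ?enorm_ge0// ltW.
Qed.

End Evolution.

(* Outside a ball carrying the lower bound [c0 t^(-1/(q-2))], the separated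
   barrier built from a large negative power of the distance propagates positivity;
   the term [E t^(-1/(q-2)-eps)] makes it start below the solution. *)
Lemma annulus_positive {R : realType} (n : nat) (p q : R) (u0 : 'rV[R]_n -> R)
    (u : 'rV[R]_n * R -> R) (y : 'rV[R]_n) (r1 r2 c0 t1 : R) :
  1 < p -> 2 < q -> ibvp_solution p q u0 u -> (forall x, unit_ball x -> 0 <= u0 x) ->
  0 < r1 -> enorm y + r1 < 1 -> 0 < c0 -> 1 <= t1 ->
  (forall x t, cball y r1 x -> t1 <= t -> c0 * t `^ (- (q - 2)^-1) <= u (x, t)) ->
  0 < r2 -> enorm y + r2 < 1 ->
  exists2 T, 0 <= T & forall x, cball y r2 x -> 0 < u (x, T).
Proof.
move=> hp hq hu u0_ge0 r10 yr1 c00 t11 core r20 yr2.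
have q2 : 0 < q - 2 by rewrite subr_gt0.
have a0 : 0 < (q - 2)^-1 by rewrite invr_gt0.
pose R1 := 1 - enorm y.
have r1R : r1 < R1 by rewrite /R1 ltrBrDl.
have R10 : 0 < R1 by exact: lt_trans r1R.
have t10 : 0 < t1 by exact: lt_le_trans t11.
pose N := n%:R + p - 2.
have p10 : 0 < p - 1 by rewrite subr_gt0.
(* Meets the exponent condition of [powR_profile_frad]; |N| ensures k >= 1 whatever the sign of
   N. *)
pose k := 1 + (2 * `|N| + 1) / (4 * (p - 1)).
have kN0 : 0 <= (2 * `|N| + 1) / (4 * (p - 1)).
  apply: divr_ge0; first by have := normr_ge0 N; lra.
  by rewrite mulr_ge0// ltW.
have k1 : 1 <= k by rewrite lerDl.
have k0 : 0 < k by exact: lt_le_trans k1.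
have kN : 2 * N + 1 <= 4 * (k + 1) * (p - 1).
  have -> : 4 * (k + 1) * (p - 1) = 8 * (p - 1) + (2 * `|N| + 1).
    by rewrite /k; field; rewrite gt_eqF.
  have := ler_norm N; have := normr_ge0 N; lra.
pose w (z : R) := z `^ (- k) - (R1 ^+ 2) `^ (- k).
have w_lt z z' : 0 < z -> z < z' -> w z' < w z.
  move=> z0 zz; have z'0 := lt_trans z0 zz.
  rewrite /w ltrD2r !powRN ltf_pV2 ?posrE ?powR_gt0//.
  by rewrite gt0_ltr_powR ?nnegrE ?(ltW z0) ?(ltW z'0).
have w_le z z' : 0 < z -> z <= z' -> w z' <= w z.
  by move=> z0; rewrite le_eqVlt => /orP[/eqP ->//|zz]; exact/ltW/w_lt.
have wR : w (R1 ^+ 2) = 0 by rewrite /w subrr.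
pose wr := w (r1 ^+ 2); have wr0 : 0 < wr.
  by rewrite -wR /wr w_lt ?exprn_gt0// ltrXn2r ?nnegrE ?ltW.
(* M puts the barrier below c0 t^(-1/(q-2)) on the inner sphere. [eps] keeps eps w below M^(q-2) on
   the annulus. E makes the subtracted term equal to c0 t1^(-1/(q-2)) at time t1, so the barrier
   starts nonpositive. *)
pose M := c0 / wr; have M0 : 0 < M by rewrite divr_gt0.
pose eps := M `^ (q - 2) / (wr + 1).
have eps0 : 0 < eps by rewrite divr_gt0 ?powR_gt0//; lra.
pose E := c0 * t1 `^ eps; have E0 : 0 < E by rewrite mulr_gt0 ?powR_gt0.
have powE t : 0 < t -> t `^ (- ((q - 2)^-1 + eps)) = t `^ (- (q - 2)^-1) * t `^ (- eps).
  by move=> t0; rewrite opprD powRD//; apply/implyP => _; rewrite gt_eqF.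
pose b (x : 'rV[R]_n) (t : R) :=
  amp q M 0 t * w (dist2 y x) - E * (t + 0) `^ (- ((q - 2)^-1 + eps)).
pose D := cball y R1 `&` [set x | r1 <= enorm (x - y)].
have D1 z : D z -> enorm z <= 1.
  move=> [Dz _]; rewrite -[z](subrK y); apply: le_trans (ler_enormD _ _) _.
  by move: Dz; rewrite /cball /= /R1; lra.
have cD : compact D.
  apply: compact_closedI; first exact: compact_cball.
  apply: (@preimage_closed _ _ (fun x : 'rV[R]_n => enorm (x - y)) [set s : R | r1 <= s]);
    last exact: closed_ge.
  by move=> x _; exact: continuous_enormB.
have Dz x : D x -> r1 ^+ 2 <= dist2 y x <= R1 ^+ 2.
  move=> [xR xr]; rewrite dist2E.
  by apply/andP; split; rewrite lerXn2r ?nnegrE ?enorm_ge0 ?(ltW r10) ?(ltW R10).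
have Dz0 x : D x -> 0 < dist2 y x.
  by move=> /Dz/andP[h _]; apply: lt_le_trans h; rewrite exprn_gt0.
have below x t : D x -> t1 <= t -> b x t <= u (x, t).
  move=> Dx tt; rewrite leNgt; apply/negP => gap.
  have ab0 : 0 < (q - 2)^-1 + eps by exact: addr_gt0 a0 eps0.
  have pos (t' : R) : t1 <= t' -> 0 < t' + 0.
    by move=> h; rewrite addr0; exact: lt_le_trans h.
  have T02 : 0 <= t1 <= t by rewrite tt andbT ltW.
  have T01 : 0 <= t1 <= t + 1 by rewrite (ltW t10) (le_trans tt)// lerDl.
  have cb z (t' : R) : D z -> t1 <= t' <= t + 1 ->
    {for (z, t'), continuous (fun z : 'rV[R]_n * R => b z.1 z.2)}.
    move=> Dzz /andP[/pos t'0 _].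
    have c1 : {for (z, t'), continuous (fun z : 'rV[R]_n * R => amp q M 0 z.2)}.
      apply: (@continuous_comp _ _ _ snd (amp q M 0)); first exact: cvg_snd.
      apply/differentiable_continuous/derivable1_diffP.
      by have Ad := is_derive_amp q M t'0; exact: ex_derive.
    have c2 : {for (z, t'), continuous (fun z : 'rV[R]_n * R => w (dist2 y z.1))}.
      apply: (@continuous_comp _ _ _ fst (fun x : 'rV[R]_n => w (dist2 y x)));
        first exact: cvg_fst.
      apply: (@continuous_comp _ _ _ (dist2 y) w).
        exact/C2fun_continuous/C2fun_dist2.
      apply/differentiable_continuous/derivable1_diffP.
      by have wd := is_derive_powR_profile k ((R1 ^+ 2) `^ (- k)) (Dz0 _ Dzz); exact: ex_derive.
    have c3 : {for (z, t'), continuous (fun z : 'rV[R]_n * R => (z.2 + 0) `^ (- ((q - 2)^-1 + eps)))}.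
      apply: (@continuous_comp _ _ _ snd (fun t => (t + 0) `^ (- ((q - 2)^-1 + eps))));
        first exact: cvg_snd.
      apply/differentiable_continuous/derivable1_diffP.
      by have Ad := is_derive_powR_shift (- ((q - 2)^-1 + eps)) t'0; exact: ex_derive.
    exact: (cvgB (cvgM c1 c2) (cvgM (cvg_cst E) c3)).
  have cNb z (t' : R) : D z -> t1 <= t' <= t + 1 ->
    {for (z, t'), continuous (fun z : 'rV[R]_n * R => - b z.1 z.2)}.
    by move=> Dzz tz; exact: cvgN (cb z t' Dzz tz).
  have D0 : D !=set0 by exists x.
  have [Mx HM] := bounded_above hu (-1) cD D0 D1 T01 cNb.
  pose g := b x t - u (x, t).
  have g0 : 0 < g / 2 by rewrite divr_gt0// subr_gt0.
  have [P [P1 [P2 [dP dP1 P0 P10 [Pt PM]]]]] := penalty Mx t g0.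
  have H1 : P t < -1 * (u (x, t) - b x t).
    by rewrite Pt; move: g0; rewrite /g; clear; lra.
  have H2 z : D z -> -1 * (u (z, t + 1) - b z (t + 1)) < P (t + 1).
    move=> Dzz; apply: le_lt_trans PM; have := HM z (t + 1) Dzz.
    have -> : t1 <= t + 1 <= t + 1 by rewrite lexx andbT; case/andP: T01.
    by move=> /(_ isT) /=; clear; lra.
  have [x0 [t0 [Dx0 /andP[t1t0 t0t] f0 HH]]] := @penalized_max _ _ _ _ _ _ hu D t1 t (-1)
    (fun z => b z.1 z.2) P P1 x cD D1 T02 cb dP P0 Dx H1 H2.
  have {}f0 : u (x0, t0) < b x0 t0 by move: f0 => /=; clear; lra.
  have t00 : 0 < t0 by exact: lt_le_trans t1t0.
  have u0_ge0' := solution_ge0 hq hu u0_ge0 (D1 _ Dx0) (ltW t00).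
  have /andP[z0r z0R] := Dz _ Dx0.
  have At0 : 0 < amp q M 0 t0 by apply: amp_gt0 => //; exact: pos.
  have wx0 : w (dist2 y x0) <= wr by apply: w_le => //; rewrite exprn_gt0.
  have Et0 : 0 < E * (t0 + 0) `^ (- ((q - 2)^-1 + eps)) by rewrite mulr_gt0 ?powR_gt0 ?pos.
  have Mw : amp q M 0 t0 * w (dist2 y x0) <= c0 * t0 `^ (- (q - 2)^-1).
    apply: (@le_trans _ _ (amp q M 0 t0 * wr)); first by rewrite ler_pM2l.
    by rewrite /amp addr0 /M mulrAC divfK// gt_eqF.
  have [Dx0R Dx0r] := Dx0.
  have xr1 : r1 < enorm (x0 - y).
    rewrite lt_neqAle Dx0r andbT; apply/eqP => xE.
    have xc : cball y r1 x0 by rewrite /cball /= -xE.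
    move: f0; have := core x0 t0 xc t1t0; rewrite /b => h1 h2.
    by clear - h1 h2 Mw Et0; lra.
  have xR1 : enorm (x0 - y) < R1.
    rewrite lt_neqAle; have -> : enorm (x0 - y) <= R1 by [].
    rewrite andbT; apply/eqP => xE.
    move: f0; rewrite /b dist2E xE wR mulr0 sub0r ltNge => /negP; apply.
    by apply: le_trans u0_ge0'; rewrite oppr_le0 ltW.
  have t1t0' : t1 < t0.
    rewrite lt_neqAle t1t0 andbT; apply/eqP => t0E.
    have h : E * (t0 + 0) `^ (- ((q - 2)^-1 + eps)) = c0 * t0 `^ (- (q - 2)^-1).
      rewrite addr0 powE// -t0E /E powRN; field.
      by rewrite gt_eqF// powR_gt0.
    move: f0; rewrite /b h ltNge => /negP; apply; apply: le_trans u0_ge0'.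
    by rewrite subr_le0.
  have bx0 : unit_ball x0.
    rewrite /unit_ball /= -[x0](subrK y); apply: le_lt_trans (ler_enormD _ _) _.
    by rewrite -ltrBrDr.
  have x0y : x0 != y by rewrite -subr_eq0 -enorm_gt0; exact: lt_trans xr1.
  pose d := Num.min (Num.min (enorm (x0 - y) - r1) (R1 - enorm (x0 - y)))
                    (Num.min (t0 - t1) (t + 1 - t0)).
  have d0 : 0 < d by rewrite !lt_min !subr_gt0 xr1 xR1 t1t0'.
  pose B s := - E * (s + 0) `^ (- ((q - 2)^-1 + eps)) - P s.
  pose B1 s := - E * (- ((q - 2)^-1 + eps) * (s + 0) `^ (- ((q - 2)^-1 + eps) - 1)) - P1 s.
  have dB : \forall s \near t0, is_derive (s : R) 1 B (B1 s).
    apply: filterS (near_shift_gt0 (pos _ t1t0)) => s0' hs.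
    exact: is_deriveB (is_deriveZ (- E) (is_derive_powR_shift (- ((q - 2)^-1 + eps)) hs)) (dP s0').
  have dB1 := is_deriveB (is_deriveZ (- E) (is_deriveZ (- ((q - 2)^-1 + eps))
    (is_derive_powR_shift (- ((q - 2)^-1 + eps) - 1) (pos _ t1t0)))) (dP1 t0).
  have dA : \forall s \near t0, is_derive (s : R) 1 (amp q M 0) (amp1 q M 0 s).
    by apply: filterS (near_shift_gt0 (pos _ t1t0)) => s0' hs; exact: is_derive_amp.
  have z00 := Dz0 _ Dx0.
  have dw : \forall s \near dist2 y x0, is_derive (s : R) 1 w (- k * s `^ (- k - 1)).
    apply: filterS (lt_nbhsr z00) => s0' hs; exact: is_derive_powR_profile.
  have dw1 := is_derive1_powR_profile k z00.
  have e2 : (-1 : R) ^+ 2 = 1 by rewrite sqrrN expr1n.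
  have := @sided_barrier _ n p q hq (-1) e2 u x0 y t0 d _ _ _ _ _ _ _ _ _
    (u_sided hu (or_intror erefl)) (u_bounded hu) bx0 t00 x0y d0 dA
    (is_derive_amp1 q M (pos _ t1t0)) dB dB1 dw dw1.
  rewrite (gt_eqF At0) mulf_eq0 oppr_eq0 (gt_eqF k0) gt_eqF ?powR_gt0//.
  move=> /(_ isT isT).
  have contact z (t' : R) : unit_ball z -> 0 < t' -> enorm (z - x0) < d ->
     `|t' - t0| < d -> -1 * (u (z, t') - u (x0, t0)) <=
     -1 * (amp q M 0 t' * w (dist2 y z) + B t'
       - (amp q M 0 t0 * w (dist2 y x0) + B t0)).
    rewrite !lt_min => _ _ /andP[/andP[zr zR] _] /andP[_ /andP[tl tr]].
    have DD : D z.
      have h1 := ler_enormD (z - x0) (x0 - y); have h2 := ler_enormD (x0 - z) (z - y).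
      move: h1 h2; rewrite !subrKA (enormB x0 z) => h1 h2.
      by clear - h1 h2 zr zR; split; rewrite /cball /=; lra.
    have tT : t1 <= t' <= t + 1 by exact: abs_lt_itv tl tr.
    by have := HH z t' DD tT; rewrite /b /B /=; clear; lra.
  move=> /(_ contact).
  have z0le : 0 < dist2 y x0 <= 1.
    rewrite z00; apply: le_trans z0R _; rewrite expr_le1 ?(ltW R10)// /R1.
    by rewrite lerBlDr lerDl enorm_ge0.
  have := powR_profile_frad hq k1 kN At0 z0le.
  set Fr := Frad _ _ _ _ _ _; rewrite amp_pow ?pos// /B1 /amp1 addr0.
  move: f0; rewrite /b /amp addr0 powE//.
  have -> : t0 `^ (- ((q - 2)^-1 + eps) - 1) = t0 `^ (- (q - 2)^-1) * t0 `^ (- eps) / t0.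
    rewrite -powE// powRD ?powRN ?powRr1 ?(ltW t00)//.
    by apply/implyP => _; rewrite gt_eqF.
  have -> : t0 `^ (- (q - 2)^-1 - 1) = t0 `^ (- (q - 2)^-1) / t0.
    rewrite powRD ?powRN ?powRr1 ?(ltW t00)//.
    by apply/implyP => _; rewrite gt_eqF.
  set S := t0 `^ (- (q - 2)^-1); set Q := t0 `^ (- eps); set W := w _ => h1 h2 h3.
  have S0 : 0 < S by exact: powR_gt0.
  have Q0 : 0 < Q by exact: powR_gt0.
  have i0 : 0 < t0^-1 by rewrite invr_gt0.
  (* As u >= 0, the barrier is positive at the contact. The subtracted term then contributes at most
     (1/(q-2) + eps) M W to the time derivative, so the total is at most eps M W, less than the
     M^(q-1) that F requires. *)
  have h4 : E * Q < M * W.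
    have : 0 < S * (M * W - E * Q) by clear - h1 u0_ge0'; lra.
    by rewrite pmulr_rgt0// subr_gt0.
  have h5 : eps * W < M `^ (q - 2).
    have h : eps * (wr + 1) = M `^ (q - 2) by rewrite /eps divfK// gt_eqF// addr_gt0.
    rewrite -h ltr_pM2l//; apply: le_lt_trans wx0 _; by rewrite ltrDl.
  have h6 : ((q - 2)^-1 + eps) * (E * Q) <= ((q - 2)^-1 + eps) * (M * W) by rewrite ler_pM2l// ltW.
  have h7 : M * (eps * W) < M * M `^ (q - 2) by rewrite ltr_pM2l.
  have h8 : M * M `^ (q - 2) <= - (q - 2)^-1 * (M * W) + ((q - 2)^-1 + eps) * (E * Q).
    have : 0 <= S / t0 * (- (q - 2)^-1 * (M * W) + ((q - 2)^-1 + eps) * (E * Q) - M * M `^ (q - 2)).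
      have p0 := P10 t0; clear - p0 h2 h3; lra.
    by rewrite pmulr_rge0 ?mulr_gt0// subr_ge0.
  clear - h5 h6 h7 h8; lra.
pose w2 := w (r2 ^+ 2).
have w20 : 0 < w2.
  have r2R : r2 < R1 by rewrite /R1; lra.
  by rewrite -wR /w2 w_lt ?exprn_gt0// ltrXn2r ?nnegrE ?(ltW r20) ?(ltW R10).
(* The subtracted term carries the additional factor T^(-eps); from this T on, the barrier is
   positive on the part of the ball of radius r2 outside the core. *)
pose L := E / (M * w2) + 1.
have L0 : 0 < L by apply: addr_gt0 => //; rewrite divr_gt0// mulr_gt0.
pose T := Num.max t1 (L `^ eps^-1).
have T1 : t1 <= T by rewrite le_max lexx.
have T0 : 0 < T by exact: lt_le_trans T1.
exists T; first exact: ltW.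
move=> x xr2; have [xr1|xr1] := leP (enorm (x - y)) r1.
  by apply: lt_le_trans (core x T xr1 T1); rewrite mulr_gt0// powR_gt0.
have Dx : D x by split; [move: xr2; rewrite /cball /= /R1; lra|exact: ltW].
apply: lt_le_trans (below x T Dx T1).
rewrite /b /amp !addr0 powE//.
have wx : w2 <= w (dist2 y x).
  apply: w_le; first exact: Dz0.
  by rewrite dist2E lerXn2r ?nnegrE ?enorm_ge0 ?(ltW r20).
have LT : L <= T `^ eps.
  rewrite -[L]powRr1 ?(ltW L0)// -(mulVf (lt0r_neq0 eps0)) powRrM.
  by rewrite ge0_ler_powR ?nnegrE ?powR_ge0 ?(ltW eps0) ?(ltW T0)// le_max lexx orbT.
have LE : E * T `^ (- eps) < M * w2.
  rewrite powRN ltr_pdivrMr ?powR_gt0// mulrC -ltr_pdivrMr ?(mulr_gt0 M0 w20)//.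
  by apply: lt_le_trans LT; rewrite ltrDl.
have -> : M * T `^ (- (q - 2)^-1) * w (dist2 y x) - E * (T `^ (- (q - 2)^-1) * T `^ (- eps))
   = T `^ (- (q - 2)^-1) * (M * w (dist2 y x) - E * T `^ (- eps)) by ring.
rewrite mulr_gt0 ?powR_gt0// subr_gt0; apply: lt_le_trans LE _.
by rewrite ler_pM2l.
Qed.

(** * Spread of positivity and the lower bound for large times *)

Section Positivity.
Context {R : realType} (n : nat) (p q : R) (V W0 : R -> R).
Hypotheses (hn : (2 <= n)%N) (hp : 1 < p) (hq : 2 < q).
Local Notation a := ((q - 2)^-1).
Hypothesis PW0 : radial_profile n p q V (fun=> 1) W0.
Hypothesis VW0 : forall r, 0 <= r <= 1 -> V r = W0 r.
Hypothesis flat_profiles : forall nu, 0 < nu < 1 -> exists (W xi : R -> R) (K : R),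
  [/\ forall r, 0 < r -> 0 <= xi r <= 1, radial_profile n p q V xi W, 0 < K,
      forall r, 0 <= r <= 1 -> W 0 - W r <= K * r ^+ 4 &
      forall r, 0 <= r <= 1 -> nu * W0 r <= W r].
Variables (u0 : 'rV[R]_n -> R) (u : 'rV[R]_n * R -> R).
Hypothesis hu : ibvp_solution p q u0 u.
Hypothesis u0_ge0 : forall x, unit_ball x -> 0 <= u0 x.

Let q2 : 0 < q - 2. Proof. by rewrite subr_gt0. Qed.
Let a0 : 0 < a. Proof. by rewrite invr_gt0. Qed.

Lemma positive_spread (y : 'rV[R]_n) (rho s r2 : R) :
  0 < rho -> enorm y + rho <= 1 -> 0 <= s -> (forall x, cball y rho x -> 0 < u (x, s)) ->
  0 < r2 -> enorm y + r2 < 1 ->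
  exists2 T, 0 <= T & forall x, cball y r2 x -> 0 < u (x, T).
Proof.
move=> rho0 yrho s0 Hs r20 yr2.
have [c0 [t1 [c00 t11 core]]] := positive_core hq PW0 VW0 hu u0_ge0 flat_profiles
  rho0 yrho s0 Hs.
have r10 : 0 < rho / 2 by rewrite divr_gt0.
have yr1 : enorm y + rho / 2 < 1 by lra.
exact: annulus_positive hp hq hu u0_ge0 r10 yr1 c00 t11 core r20 yr2.
Qed.

(** The time is left free, since it changes at every link of the chain. *)
Definition positive_at (y : 'rV[R]_n) : Prop := exists rho s,
  [/\ 0 < rho, enorm y + rho <= 1, 0 <= s & forall x, cball y rho x -> 0 < u (x, s)].

Lemma positive_somewhere (z : 'rV[R]_n) : unit_ball z -> u0 z <> 0 -> positive_at z.
Proof.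
move=> bz uz; have uz0 : 0 < u (z, 0).
  by rewrite (u0E hu)// lt_neqAle u0_ge0// andbT eq_sym; apply/eqP.
have /subspace_continuousP/(_ (z, 0)) := cont_u hu.
move=> /(_ (conj (ltW bz) (lexx _)))/cvgrPdist_lt/(_ _ uz0).
rewrite near_withinE => -[[A B] /= [nA nB] AB].
have [d d0 Ad] := exists_enorm_ball nA.
have B0 : B 0 by exact: nbhs_singleton nB.
pose rho := Num.min (d / 2) (1 - enorm z).
have rho0 : 0 < rho by rewrite lt_min divr_gt0// subr_gt0.
have rd : rho < d.
  by apply: (@le_lt_trans _ _ (d / 2)); [rewrite ge_min lexx|lra].
have rz : rho <= 1 - enorm z by rewrite ge_min lexx orbT.
exists rho, 0; split=> //; first lra.
move=> x xz; have Dx : enorm x <= 1 /\ 0 <= (0 : R).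
  split=> //; rewrite -[x](subrK z); apply: le_trans (ler_enormD _ _) _.
  by move: xz; rewrite /cball /=; lra.
have : `|u (z, 0) - u (x, 0)| < u (z, 0).
  exact: AB (x, 0) (conj (Ad _ (le_lt_trans xz rd)) B0) Dx.
have := ler_norm (u (z, 0) - u (x, 0)); lra.
Qed.

Lemma positive_step (y y' : 'rV[R]_n) :
  positive_at y -> enorm (y' - y) < 1 - enorm y -> positive_at y'.
Proof.
move=> [rho [s [rho0 yrho s0 Hs]]] yy.
(* Midway between |y' - y| and 1 - |y|: the ball around y stays inside the unit ball and contains a
   ball around y'. *)
pose r2 := (enorm (y' - y) + (1 - enorm y)) / 2.
have yy0 := enorm_ge0 (y' - y).
have r20 : 0 < r2 by rewrite /r2; lra.
have yr2 : enorm y + r2 < 1 by rewrite /r2; lra.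
have [T T0 HT] := positive_spread rho0 yrho s0 Hs r20 yr2.
exists (r2 - enorm (y' - y)), T; split=> //.
- by rewrite /r2; lra.
- have := ler_enormD (y' - y) y; rewrite subrK /r2; lra.
move=> x xy'; apply: HT.
have := ler_enormD (x - y') (y' - y); rewrite subrKA.
by move: xy'; rewrite /cball /=; lra.
Qed.

(* Balls around the points of the segment from [z] to [0], overlapping enough. *)
Lemma positive_at0 (z : 'rV[R]_n) : unit_ball z -> positive_at z -> positive_at 0.
Proof.
(* Half the distance from z to the sphere. Neighbouring points satisfy |m z - th z| <= d < 1 - |z|
   <= 1 - |m z|, as [positive_step] demands. *)
move=> bz pz; pose d := (1 - enorm z) / 2.
have d0 : 0 < d by rewrite divr_gt0// subr_gt0.
have chain N : forall th : R, 0 <= th <= 1 -> 1 - th <= N%:R * d -> positive_at (th *: z).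
  elim: N => [|N IH] th /andP[th0 th1] thN.
    have -> : th = 1 by move: thN; rewrite mul0r; lra.
    by rewrite scale1r.
  have m0 : th <= Num.min 1 (th + d) by rewrite le_min th1; lra.
  have m1 : Num.min 1 (th + d) <= 1 by rewrite ge_min lexx.
  have md : Num.min 1 (th + d) <= th + d by rewrite ge_min lexx orbT.
  apply: (@positive_step (Num.min 1 (th + d) *: z)).
    apply: IH; first by rewrite (le_trans th0)//.
    have : 0 <= N%:R * d by rewrite mulr_ge0// ltW.
    have h : N.+1%:R * d = N%:R * d + d by rewrite -natr1 mulrDl mul1r.
    by case: (leP 1 (th + d)) => c; move: thN; rewrite h; lra.
  rewrite -scalerBl !enormZ distrC !ger0_norm ?subr_ge0//; last exact: le_trans m0.
  move: m0 m1 md; set m := Num.min _ _ => m0 m1 md.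
  have : (m - th) * enorm z <= d * 1.
    by apply: ler_pM; rewrite ?subr_ge0 ?enorm_ge0 ?(ltW bz)//; lra.
  have : m * enorm z <= 1 * enorm z by rewrite ler_wpM2r ?enorm_ge0.
  have := d0; rewrite {2}/d; move: bz; rewrite /unit_ball /= /d; lra.
have d1 : 0 <= d^-1 by rewrite invr_ge0 ltW.
have := archi_boundP d1; set N := Num.Def.archi_bound _ => hN.
have := chain N 0; rewrite scale0r; apply; first by rewrite lexx ler01.
by rewrite subr0 -ler_pdivrMr// mul1r ltW.
Qed.

(** The three losses of the lower barrier vanish together as r tends to 1: a factor r for the time
    shift, r^((1+q)/(q-2)) for the amplitude of the smaller ball, and r for the flattening.
    Compactness of [0, 1] makes this uniform in s. *)
Lemma dilation_gap (e : R) : 0 < e -> exists2 r, 0 < r < 1 &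
  forall s, 0 <= s <= 1 ->
    W0 s - e < r * r `^ ((1 + q) * a) * r * W0 (s / r).
Proof.
move=> e0; pose G (r : R) := r * r `^ ((1 + q) * a) * r.
have [cW W1 Wd _] := PW0.
have cov : \forall r \near (1 : R), `[0, 1]%classic `<=`
    [set s | W0 s - e < G r * W0 (s / r)].
  have /compact_near_coveringP cc := @segment_compact R 0 1.
  apply: (cc R (nbhs (1 : R)) (fun r s => W0 s - e < G r * W0 (s / r)) _) => s /=.
  rewrite in_itv/= => /andP[s0 s1].
  have s1' : -1 < s by lra.
  have c1 : {for (s, 1), continuous (fun z : R * R => W0 z.1)}.
    by apply: (@continuous_comp _ _ _ fst W0); [exact: cvg_fst|exact: cW].
  have c2 : {for (s, 1), continuous (fun z : R * R => z.1 / z.2)}.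
    have := cvgM (@cvg_fst _ _ (nbhs s) (nbhs (1 : R)) _)
      (cvgV (oner_neq0 R) (@cvg_snd _ _ (nbhs s) (nbhs (1 : R)) _)).
    exact.
  have c3 : {for (s, 1), continuous (fun z : R * R => W0 (z.1 / z.2))}.
    by apply: (@continuous_comp _ _ _ (fun z : R * R => z.1 / z.2) W0) => //;
      apply: cW; rewrite /= divr1.
  have cG : {for 1, continuous G}.
    exact: (cvgM (cvgM cvg_id (@continuous_powR1 R _)) cvg_id).
  have c4 : {for (s, 1), continuous (fun z : R * R => G z.2)}.
    by apply: (@continuous_comp _ _ _ snd G); [exact: cvg_snd|exact: cG].
  have c5 : {for (s, 1), continuous (fun z : R * R => W0 z.1 - G z.2 * W0 (z.1 / z.2))}.
    exact: (cvgB c1 (cvgM c4 c3)).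
  have lt0 : W0 s - G 1 * W0 (s / 1) < e by rewrite /G powR1 divr1 !mul1r subrr.
  have h := cvgr_lt _ c5 _ lt0.
  apply: (@filterS _ (filter_prod (nbhs s) (nbhs (1 : R))) _ _ _ _ (h _)) => -[s' r'] /=.
  lra.
have [d d0 Hd] := near_abs_lt cov.
pose r := Num.max (1 / 2) (1 - d / 2).
have rl : 1 / 2 <= r by rewrite le_max lexx.
have rd : 1 - d / 2 <= r by rewrite le_max lexx orbT.
have r1 : r < 1 by rewrite gt_max; apply/andP; split; lra.
exists r => [|s s01]; first by apply/andP; split; lra.
by apply: Hd; rewrite ?in_itv//= ltr0_norm; lra.
Qed.

Lemma solution_ge_eventually (e : R) : positive_at 0 -> 0 < e ->
  exists2 T, 0 < T & forall x t, enorm x <= 1 -> T <= t ->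
    W0 (enorm x) - e <= t `^ a * u (x, t).
Proof.
move=> [rho [s [rho0 yrho s0 Hs]]] e0; have [r /andP[r0 r1] Hr] := dilation_gap e0.
have [cW W1 Wd _] := PW0.
have yr : enorm (0 : 'rV[R]_n) + r < 1 by rewrite enorm0 add0r.
have [T0 T00 HT0] := positive_spread rho0 yrho s0 Hs r0 yr.
have r01 : 0 < r < 1 by rewrite r0.
have [W [xi [K [xi01 PW K0 WK WW0]]]] := flat_profiles r01.
(* The exponent gives mu^(q-2) r^(-q) = r, which is the bound allowed for the flattened profile with
   nu = r. *)
pose mu := r `^ ((1 + q) * a); have mu0 : 0 < mu by exact: powR_gt0.
have mur : mu `^ (q - 2) * r `^ (- q) <= r.
  rewrite /mu -powRrM mulfVK ?(gt_eqF q2)// -powRD ?addrK ?powRr1 ?(ltW r0)//.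
  by apply/implyP => _; rewrite gt_eqF.
have [tau tau0 Ht] := lower_bound_eventually hq PW0 VW0 hu u0_ge0 xi01 PW K0 WK r0 WW0 r0 (ltW yr) T00 mu0
  mur HT0.
have rq : r `^ (q - 2) < 1.
  by have := @gt0_ltr_powR _ _ q2 r 1; rewrite !nnegrE powR1 (ltW r0) ler01 => /(_ isT isT); exact.
(* From this time on t/(t + tau) >= r^(q-2), so the time shift costs only a factor r. *)
pose T := Num.max (Num.max 1 T0) (r `^ (q - 2) * tau / (1 - r `^ (q - 2))).
exists T; first by rewrite !lt_max ltr01.
move=> x t bx; rewrite !ge_max => /andP[/andP[t1 tT0] tT].
have t0 : 0 < t by lra.
have u_ge0 := solution_ge0 hq hu u0_ge0 bx (ltW t0).
have hx := Hr (enorm x); rewrite enorm_ge0 bx in hx; have {}hx := hx isT.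
apply: le_trans (ltW hx) _.
(* Outside the smaller ball W0(|x|/r) is negative, and nonnegativity of u suffices. *)
have [xr|xr] := leP (enorm x) r; last first.
  apply: (@le_trans _ _ 0); last by rewrite mulr_ge0 ?powR_ge0.
  rewrite mulr_ge0_le0 ?mulr_ge0 ?powR_ge0 ?(ltW r0)//.
  by rewrite -W1 ltW// Wd// ltr_pdivlMr// mul1r.
have Dx : cball 0 r x by rewrite /cball /= subr0.
have x01 : 0 <= enorm x / r <= 1 by rewrite divr_ge0 ?enorm_ge0 ?(ltW r0)//= ler_pdivrMr// mul1r.
have tt0 : 0 < t + tau by rewrite addr_gt0.
have tr : r <= t `^ a * (t + tau) `^ (- a).
  rewrite powRN ler_pdivlMr ?powR_gt0//.
  have -> : r * (t + tau) `^ a = (r `^ (q - 2) * (t + tau)) `^ a.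
    rewrite powRM ?powR_ge0 ?(ltW tt0)// -powRrM mulfV ?(gt_eqF q2)// powRr1//; exact: ltW.
  apply: ge0_ler_powR; rewrite ?nnegrE ?(ltW a0) ?(ltW t0)//.
    by rewrite mulr_ge0 ?powR_ge0// ltW.
  by move: tT; rewrite ler_pdivrMr ?subr_gt0//; lra.
have := Ht x t Dx tT0; rewrite subr0 => hu'.
have ta0 : 0 <= t `^ a by exact: powR_ge0.
apply: le_trans (ler_wpM2l ta0 hu').
have -> : t `^ a * (amp q mu tau t * W (enorm x / r))
  = (t `^ a * (t + tau) `^ (- a)) * (mu * W (enorm x / r)) by rewrite /amp; ring.
rewrite [leLHS](_ : _ = r * (mu * (r * W0 (enorm x / r)))); last by rewrite /mu; ring.
apply: ler_pM => //; [exact: ltW| |by rewrite ler_pM2l// WW0].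
by apply: mulr_ge0; [exact: ltW|rewrite mulr_ge0 ?(W0_ge0 PW0) ?(ltW r0)].
Qed.

End Positivity.

Theorem theorem6p4 (R : realType) (n : nat) (p q : R)
    (u0 : 'rV[R]_n -> R) (u : 'rV[R]_n * R -> R) (V : R -> R)
    (hn : (2 <= n)%N) (hp : 1 < p) (hq : 2 < q)
    (hu0_C2 : C2_on_closure unit_ball u0)
    (hu0_radial : radial_on unit_ball u0)
    (hu0_ge0 : forall x, unit_ball x -> 0 <= u0 x)
    (hu0_neq0 : exists2 x, unit_ball x & u0 x <> 0)
    (hu0_bd : forall x, enorm x = 1 -> u0 x = 0)
    (hu : ibvp_solution p q u0 u)
    (hV : is_profile n p q V) :
  {uniform (@unit_ball R n),
     (fun (t : R) (x : 'rV[R]_n) => t `^ (q - 2)^-1 * u (x, t)) @ +oo -->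
     (fun x : 'rV[R]_n => V (enorm x))} /\
  (forall x t, unit_ball x -> 0 < t ->
     u (x, t) <= t `^ (- (q - 2)^-1) * V (enorm x)).
Proof.
have [V_cont V_gt0 V1 _] := hV.
have [W0 [PW0 flat]] := exists_profiles hn hp hq V_cont V_gt0 V1.
have VW0 := profile_eq hn hq hV PW0 flat.
have ball01 (x : 'rV[R]_n) : unit_ball x -> 0 <= enorm x <= 1.
  by move=> bx; rewrite enorm_ge0 unit_ball_le.
have upper x t : unit_ball x -> 0 < t -> u (x, t) <= t `^ (- (q - 2)^-1) * V (enorm x).
  move=> bx t0; rewrite VW0 ?ball01//.
  by apply: (solution_le hn hq PW0 VW0 hu) => //; exact: unit_ball_le.
split=> //.
(* By the upper bound t^(1/(q-2)) u never exceeds V, so the uniform convergence reduces to a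
   one-sided estimate for large times, for which positivity around the origin is the only input from
   [u0]. *)
have [z bz uz] := hu0_neq0.
have p0 := positive_at0 hp hq PW0 VW0 flat hu hu0_ge0 bz
  (positive_somewhere hu hu0_ge0 bz uz).
move=> P /uniform_nbhs[E [entE EP]].
have : entourage_ (@ball R R) E by rewrite entourage_ballE.
move=> [e /= e0 He].
have e20 : 0 < e / 2 by rewrite divr_gt0.
have [T T0 HT] := solution_ge_eventually hp hq PW0 VW0 flat hu hu0_ge0 p0 e20.
exists T; split; first exact: num_real.
move=> t Tt; apply: EP => x bx; apply: He => /=.
have t0 : 0 < t by exact: lt_trans Tt.
have lower := HT x t (unit_ball_le bx) (ltW Tt).
have tu : t `^ (q - 2)^-1 * u (x, t) <= V (enorm x).
  by rewrite mulrC -ler_pdivlMr ?powR_gt0// -powRN mulrC upper.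
move: lower; rewrite -VW0 ?ball01// => lower.
by rewrite /ball /= ger0_norm ?subr_ge0//; lra.
Qed.
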